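(* Let $\mathcal S^{-1}\mathrm{As}$ be the nonsymmetric (ns) operad of shifted associative algebras, generated by an arity $2$ degree $1$ element $b$ with $b\circ_1b=-b\circ_2b$, and let $$\mathcal S^{-1}\mathrm{As}^{++}:=\frac{\mathcal S^{-1}\mathrm{As}\,\widehat\vee\,\gamma\,\widehat\vee\,\zeta}{\big(b(\gamma,-),\ b(-,\gamma),\ b(\zeta,-)+b(-,\zeta)\big)},$$ where $\gamma$ and $\zeta$ are arity $0$ elements of respective degrees $-4$ and $-1$ placed in $\mathrm F_1$. The map of complete dg ns operads $\mathcal S^{-1}\mathrm{As}\,\widehat\vee\,\gamma\,\widehat\vee\,\zeta\to\mathrm{Tw}\,\mathrm{ncBV}$ which sends $b$ to the connected bamboo with two white vertices and no tadpole, $\gamma$ to the graph consisting of two disjoint black vertices with no edge and no tadpole, and $\zeta$ to a single black vertex with a tadpole, induces an isomorphism of complete ns operads $$H_\bullet(\mathrm{Tw}\,\mathrm{ncBV})\cong\mathcal S^{-1}\mathrm{As}^{++}.$$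
   Context: The ns operad $\mathrm{ncBV}$: for $n\ge1$, $\mathrm{ncBV}(n)$ has as basis the bamboos with tadpoles, i.e. graphs with vertices $1,\dots,n$ ordered from left to right, whose edges form a subset of $\{(1,2),\dots,(n-1,n)\}$ and with at most one tadpole (loop) at each vertex ($\mathrm{ncBV}(0)=0$). Each edge and each tadpole has homological degree $1$; they are ordered with the edges first from left to right, then the tadpoles from left to right, and reordering produces the sign of the permutation. The composite $\Gamma_1\circ_i\Gamma_2$ ($\Gamma_2$ with $k$ vertices) places $\Gamma_2$ at vertex $i$ of $\Gamma_1$ and relabels; the edge $(i-1,i)$ (resp. $(i+k-1,i+k)$) is present iff $(i-1,i)$ (resp. $(i,i+1)$) is an edge of $\Gamma_1$. If $\Gamma_1$ has a tadpole at $i$, one sums over all ways of turning it either into a tadpole at one of the vertices $i,\dots,i+k-1$ having no tadpole yet, or into a new edge between two consecutive vertices of $\{i,\dots,i+k-1\}$ not yet joined. The sign is that obtained by reordering (edges and tadpoles of $\Gamma_1$, followed by those of $\Gamma_2$, the new tadpole or edge keeping the position of the tadpole it replaces). Let $b\in\mathrm{ncBV}(2)$ be the bamboo with edge $(1,2)$ and no tadpole. Twisting: $\mathrm{ncBV}$ carries the shifted multiplicative structure $\mathcal S^{-1}\mathcal A_\infty\to\mathcal S^{-1}\mathrm{As}\to\mathrm{ncBV}$, $\mu_2\mapsto b$, $\mu_n\mapsto0$ for $n\ge3$. Let $\alpha$ be an element of arity $0$ and degree $-2$ (filtration degree $1$). $\mathrm{Tw}\,\mathrm{ncBV}$ is the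 complete ns operad $\mathrm{ncBV}\,\widehat\vee\,\alpha$ (completed coproduct of ns operads with the operad spanned by $\alpha$), whose elements are series, indexed by $k\ge0$, of elements of $\mathrm{ncBV}$ with $k$ copies of $\alpha$ plugged in, with the differential which is the derivation characterised by $\mathrm d(\alpha)=b(\alpha,\alpha)$ and $\mathrm d(\nu)=\mu_1^\alpha\star\nu-(-1)^{|\nu|}\nu\star\mu_1^\alpha$ for $\nu\in\mathrm{ncBV}$, where $\mu_1^\alpha=b(\alpha,-)+b(-,\alpha)$ and $\nu\star\mu=\sum_i\nu\circ_i\mu$. Graphically: bamboos with tadpoles with white vertices (inputs, labelled from left to right) and black vertices (copies of $\alpha$, degree $-2$); the filtration is by the number of black vertices. $\widehat\vee$ is the completed coproduct of ns operads ($\gamma$, $\zeta$ denoting the operads spanned by these arity $0$ elements); $\mathcal S^{-1}\mathrm{As}\,\widehat\vee\,\gamma\,\widehat\vee\,\zeta$ has zero differential.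
   Formalization: With γ in filtration degree exactly 1 the inverse cannot preserve filtrations, since γ maps into F_2; so the isomorphism is proved with a continuous inverse for γ of filtration degree 1 or 2, and as a strict filtered isomorphism when γ is placed in F_2. *)

(* Defs.v *)
From HB Require Import structures.
From mathcomp Require Import all_boot all_order all_algebra.
From mathcomp Require Import generic_quotient ring_quotient.
From mathcomp Require Import boolp classical_sets functions cardinality fsbigop.

Set Implicit Arguments.
Unset Strict Implicit.
Unset Printing Implicit Defensive.

Import Order.TTheory GRing.Theory Num.Theory.

Local Open Scope classical_set_scope.
Local Open Scope ring_scope.
Local Open Scope quotient_scope.

Record subspace (K : fieldType) (V : lmodType K) := Subspace {
  subspace_pred : {pred V};
  subspaceP : submod_closed subspace_pred }.

Section Submodule.
Variables (K : fieldType) (V : lmodType K).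
Implicit Type S : subspace V.

HB.instance Definition _ S :=
  GRing.isSubmodClosed.Build K V (subspace_pred S) (subspaceP S).

Record submodule S := Submodule { subm_val : V; _ : subm_val \in subspace_pred S }.

HB.instance Definition _ S := [isSub for @subm_val S].
HB.instance Definition _ S := [Choice of submodule S by <:].
HB.instance Definition _ S := [SubChoice_isSubLmodule of submodule S by <:].

Definition lquot S := Quotient.quot (subspace_pred S).

HB.instance Definition _ S := GRing.Zmodule.on (lquot S).
HB.instance Definition _ S := EqQuotient.on (lquot S).

Definition lquot_pi S (x : V) : lquot S := \pi_(Quotient.quot (subspace_pred S)) x.

Definition lquot_repr S (q : lquot S) : V :=
  repr (q : Quotient.quot (subspace_pred S)).

Lemma lquot_reprK S : cancel (@lquot_repr S) (lquot_pi S).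
Proof. exact: reprK. Qed.

Lemma lquot_piP S x y : (lquot_pi S x = lquot_pi S y) <-> (x - y \in subspace_pred S).
Proof. by rewrite Quotient.idealrBE; split=> [h|/eqP //]; apply/eqP. Qed.

Lemma lquot_piD S x y : lquot_pi S (x + y) = lquot_pi S x + lquot_pi S y.
Proof. exact: Quotient.pi_add. Qed.

Definition lquot_scale S (a : K) (q : lquot S) : lquot S :=
  lquot_pi S (a *: lquot_repr q).

Lemma lquot_scale_pi S a x :
  lquot_scale a (lquot_pi S x) = lquot_pi S (a *: x).
Proof.
apply/lquot_piP; rewrite -scalerBr rpredZ //.
by apply/lquot_piP; rewrite lquot_reprK.
Qed.

Fact lquot_scaleA S a b (v : lquot S) :
  lquot_scale a (lquot_scale b v) = lquot_scale (a * b) v.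
Proof. by rewrite -[v]lquot_reprK !lquot_scale_pi scalerA. Qed.

Fact lquot_scale1 S : left_id 1 (@lquot_scale S).
Proof. by move=> v; rewrite -[v]lquot_reprK lquot_scale_pi scale1r. Qed.

Fact lquot_scaleDr S : right_distributive (@lquot_scale S) +%R.
Proof.
move=> a u v; rewrite -[u]lquot_reprK -[v]lquot_reprK -lquot_piD.
by rewrite !lquot_scale_pi scalerDr lquot_piD.
Qed.

Fact lquot_scaleDl S (v : lquot S) :
  {morph (@lquot_scale S)^~ v : a b / a + b}.
Proof.
move=> a b; rewrite -[v]lquot_reprK.
by rewrite !lquot_scale_pi scalerDl lquot_piD.
Qed.

HB.instance Definition _ S := GRing.Zmodule_isLmodule.Build K (lquot S)
  (@lquot_scaleA S) (@lquot_scale1 S) (@lquot_scaleDr S) (@lquot_scaleDl S).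

End Submodule.

(* [op_car P n d] is the homogeneous component of arity [n] and homological
   degree [d].  Inputs are numbered from 0, so that [op_comp _ _ i x y] is the
   partial composite written x o_(i+1) y in the 1-based convention; it is only
   meaningful when [i] is smaller than the arity of [x].  The arity and degree
   of the composite are separate parameters tied by equations, which avoids
   transports in the axioms. *)
Record operad (K : fieldType) := Operad {
  op_car :> nat -> int -> lmodType K;
  op_fil : forall n d, nat -> set (op_car n d);
  op_id : op_car 1%N 0;
  op_comp : forall m n p (d e f : int), (m + n = p.+1)%N -> d + e = f ->
    nat -> op_car m d -> op_car n e -> op_car p f }.

Record dgoperad (K : fieldType) := DgOperad {
  dg_op :> operad K;
  dg_diff : forall n (d e : int), e + 1 = d ->
    {linear dg_op n d -> dg_op n e} }.


Arguments op_fil {K P n d} k%_N x : rename.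
Arguments op_id {K} P : rename.
Arguments op_comp {K P m n p d e f} hp hf i%_N x y : rename.
Arguments dg_diff {K P n d e} h : rename.

Section OperadAxioms.
Variables (K : fieldType) (P : operad K).

Definition complete_filtration : Prop := forall n d,
  [/\ forall x : P n d, op_fil 0 x,
      forall k (x : P n d), op_fil k.+1 x -> op_fil k x,
      forall k, op_fil k (0 : P n d) /\
        forall (a : K) (x y : P n d),
          op_fil k x -> op_fil k y -> op_fil k (a *: x + y),
      forall x : P n d, (forall k, op_fil k x) -> x = 0
    & forall u : nat -> P n d, (forall k, op_fil k (u k.+1 - u k)) ->
        exists l, forall k, op_fil k (l - u k)].

Definition comp_bilinear : Prop :=
  forall m n p (d e f : int) (hp : (m + n = p.+1)%N) (hf : d + e = f) i
    (a : K) (x x' : P m d) (y y' : P n e), (i < m)%N ->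
  op_comp hp hf i (a *: x + x') y
    = a *: op_comp hp hf i x y + op_comp hp hf i x' y /\
  op_comp hp hf i x (a *: y + y')
    = a *: op_comp hp hf i x y + op_comp hp hf i x y'.

Definition comp_filtered : Prop :=
  forall m n p (d e f : int) (hp : (m + n = p.+1)%N) (hf : d + e = f) i
    (x : P m d) (y : P n e) k l, (i < m)%N ->
  op_fil k x -> op_fil l y -> op_fil (k + l)%N (op_comp hp hf i x y).

Definition comp_unital : Prop := forall n d (x : P n d),
  (forall (hp : (1 + n = n.+1)%N) (hf : 0 + d = d),
     op_comp hp hf 0 (op_id P) x = x) /\
  (forall (hp : (n + 1 = n.+1)%N) (hf : d + 0 = d) i, (i < n)%N ->
     op_comp hp hf i x (op_id P) = x).

Definition comp_sequential : Prop :=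
  forall l m n p q r (a b c ab bc abc : int)
    (hp : (l + m = p.+1)%N) (hq : (p + n = q.+1)%N)
    (hr : (m + n = r.+1)%N) (hq' : (l + r = q.+1)%N)
    (hab : a + b = ab) (habc : ab + c = abc)
    (hbc : b + c = bc) (habc' : a + bc = abc)
    i j (x : P l a) (y : P m b) (z : P n c), (i < l)%N -> (j < m)%N ->
  op_comp hq habc (i + j)%N (op_comp hp hab i x y) z
    = op_comp hq' habc' i x (op_comp hr hbc j y z).

Definition comp_parallel : Prop :=
  forall l m n p q r (a b c ab ac abc : int)
    (hp : (l + m = p.+1)%N) (hq : (p + n = q.+1)%N)
    (hr : (l + n = r.+1)%N) (hq' : (r + m = q.+1)%N)
    (hab : a + b = ab) (habc : ab + c = abc)
    (hac : a + c = ac) (habc' : ac + b = abc)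
    i j (x : P l a) (y : P m b) (z : P n c), (i < j)%N -> (j < l)%N ->
  op_comp hq habc (j + m).-1%N (op_comp hp hab i x y) z
    = (-1) ^+ (`|b|%N * `|c|%N) *:
      op_comp hq' habc' i (op_comp hr hac j x z) y.

Record is_complete_operad : Prop := IsCompleteOperad {
  cop_filtration : complete_filtration;
  cop_bilinear : comp_bilinear;
  cop_filtered : comp_filtered;
  cop_unital : comp_unital;
  cop_sequential : comp_sequential;
  cop_parallel : comp_parallel }.

End OperadAxioms.

Section DgOperadAxioms.
Variables (K : fieldType) (P : dgoperad K).

Definition diff_derivation : Prop :=
  forall m n p (d e f d' e' f' : int) (hp : (m + n = p.+1)%N)
    (hf : d + e = f) (hd : d' + 1 = d) (he : e' + 1 = e) (hf1 : f' + 1 = f)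
    (hf2 : d' + e = f') (hf3 : d + e' = f') i (x : P m d) (y : P n e),
  (i < m)%N ->
  dg_diff hf1 (op_comp hp hf i x y)
    = op_comp hp hf2 i (dg_diff hd x) y
      + (-1) ^+ `|d|%N *: op_comp hp hf3 i x (dg_diff he y).

Record is_complete_dgoperad : Prop := IsCompleteDgOperad {
  cdg_operad : is_complete_operad P;
  cdg_filtered : forall n (d e : int) (h : e + 1 = d) k (x : P n d),
    op_fil k x -> op_fil k (dg_diff h x);
  cdg_square : forall n (d e f : int) (h : e + 1 = d) (h' : f + 1 = e)
    (x : P n d), dg_diff h' (dg_diff h x) = 0;
  cdg_derivation : diff_derivation }.

End DgOperadAxioms.

Definition zero_dgoperad (K : fieldType) (P : operad K) : dgoperad K :=
  @DgOperad K P (fun _ _ _ _ => \0%R).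

Section Morphisms.
Variables (K : fieldType).

Record is_morphism (P Q : operad K) (f : forall n d, P n d -> Q n d) : Prop :=
  IsMorphism {
    mor_linear : forall n d (a : K) (x y : P n d),
      f n d (a *: x + y) = a *: f n d x + f n d y;
    mor_filtered : forall n d k (x : P n d), op_fil k x -> op_fil k (f n d x);
    mor_id : f _ _ (op_id P) = op_id Q;
    mor_comp : forall m n p (d e r : int) (hp : (m + n = p.+1)%N)
      (hr : d + e = r) i (x : P m d) (y : P n e), (i < m)%N ->
      f p r (op_comp hp hr i x y) = op_comp hp hr i (f m d x) (f n e y) }.

Record is_dgmorphism (P Q : dgoperad K) (f : forall n d, P n d -> Q n d)
  : Prop := IsDgMorphism {
    dgmor_morphism : is_morphism f;
    dgmor_diff : forall n (d e : int) (h : e + 1 = d) (x : P n d),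
      f n e (dg_diff h x) = dg_diff h (f n d x) }.

(* An isomorphism of the underlying operads which is a homeomorphism for the
   topologies defined by the filtrations.  The inverse is not required to
   preserve the filtrations on the nose: a class in F_1 which is not in F_2, such
   as gamma when its filtration degree is 1, may be sent to F_2. *)
Record is_isomorphism (P Q : operad K) (f : forall n d, P n d -> Q n d)
  : Prop := IsIsomorphism {
    iso_morphism : is_morphism f;
    iso_bijective : forall n d, bijective (f n d);
    iso_continuous_inv : forall n d k, exists l, forall x : P n d,
      op_fil l (f n d x) -> op_fil k x }.

Definition reflects_filtration (P Q : operad K)
    (f : forall n d, P n d -> Q n d) : Prop :=
  forall n d k (x : P n d), op_fil k (f n d x) -> op_fil k x.

End Morphisms.

Section QuotientOperad.
Variables (K : fieldType) (P : operad K).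

Record is_closed_ideal (J : forall n d, P n d -> Prop) : Prop :=
  IsClosedIdeal {
    ideal0 : forall n d, J n d 0;
    ideal_linear : forall n d (a : K) (x y : P n d),
      J n d x -> J n d y -> J n d (a *: x + y);
    ideal_compl : forall m n p (d e f : int) (hp : (m + n = p.+1)%N)
      (hf : d + e = f) i (x : P m d) (y : P n e), (i < m)%N ->
      J m d x -> J p f (op_comp hp hf i x y);
    ideal_compr : forall m n p (d e f : int) (hp : (m + n = p.+1)%N)
      (hf : d + e = f) i (x : P m d) (y : P n e), (i < m)%N ->
      J n e y -> J p f (op_comp hp hf i x y);
    ideal_closed : forall n d (x : P n d),
      (forall k, exists2 y, J n d y & op_fil k (x - y)) -> J n d x }.

Variable R : forall n d, P n d -> Prop.
Arguments R : clear implicits.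

Definition closed_ideal n d (x : P n d) : Prop :=
  forall J, is_closed_ideal J -> (forall n d x, R n d x -> J n d x) -> J n d x.

Fact closed_ideal_submod n d :
  submod_closed [pred x : P n d | `[< closed_ideal x >]].
Proof.
split=> [|a x y]; rewrite !inE.
  by move=> J idJ _; apply: ideal0.
move=> Jx Jy J idJ RJ.
by apply: ideal_linear => //; [apply: Jx | apply: Jy].
Qed.

Definition ideal_subspace n d : subspace (P n d) :=
  Subspace (closed_ideal_submod n d).

Definition quotient_operad : operad K := @Operad K
  (fun n d => lquot (ideal_subspace n d))
  (fun n d k => lquot_pi (ideal_subspace n d) @` op_fil k)
  (lquot_pi _ (op_id P))
  (fun m n p d e f hp hf i x y =>
     lquot_pi _ (op_comp hp hf i (lquot_repr x) (lquot_repr y))).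

Definition op_proj n d (x : P n d) : quotient_operad n d :=
  lquot_pi (ideal_subspace n d) x.

End QuotientOperad.

Section Homology.
Variables (K : fieldType) (P : dgoperad K).

Definition is_cycle n d (x : P n d) : bool := dg_diff (subrK 1 d) x == 0.

Fact cycle_submod n d : submod_closed [pred x : P n d | is_cycle x].
Proof.
split=> [|a x y]; rewrite !inE /is_cycle ?linear0 // => /eqP dx /eqP dy.
by rewrite linearP dx dy scaler0 addr0.
Qed.

Definition cycles n d : subspace (P n d) := Subspace (cycle_submod n d).

Definition is_boundary n d (x : P n d) : Prop :=
  exists y, dg_diff (erefl (d + 1)) y = x.

Fact boundary_submod n d :
  submod_closed [pred x : submodule (cycles n d) | `[< is_boundary (val x) >]].
Proof.
split=> [|a x y]; rewrite !inE.
  by exists 0; rewrite !linear0.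
move=> [x' dx'] [y' dy'].
by exists (a *: x' + y'); rewrite !linearP dx' dy'.
Qed.

Definition boundaries n d : subspace (submodule (cycles n d)) :=
  Subspace (boundary_submod n d).

(* The class of a cycle; non-cycles are sent to 0. *)
Definition hclass n d (x : P n d) : lquot (boundaries n d) :=
  lquot_pi _ (insubd 0 x).

Definition hrepr n d (h : lquot (boundaries n d)) : P n d :=
  val (lquot_repr h).

Definition homology : operad K := @Operad K
  (fun n d => lquot (boundaries n d))
  (fun n d k => @hclass n d @` [set x | is_cycle x /\ op_fil k x])
  (hclass (op_id P))
  (fun m n p d e f hp hf i x y =>
     hclass (op_comp hp hf i (hrepr x) (hrepr y))).

End Homology.

(* Complete operads with a basis of monomials.  The monomials form a type [X]
   graded by arity, degree and weight; the component of arity [n] and degree [d]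
   consists of all formal series of monomials of arity [n] and degree [d],
   filtered by the weight, and [cf i x y z] is the coefficient of [z] in the
   i-th partial composite of [x] and [y]. *)
Section Series.
Variables (K : fieldType) (X : choiceType).
Variables (ar : X -> nat) (dg : X -> int) (wt : X -> nat) (one : X).
Variable cf : nat -> X -> X -> X -> K.

Definition monomials n (d : int) := {x : X | (ar x == n) && (dg x == d)}.

Definition series n d : lmodType K := (monomials n d -> K^o).

Definition monomial x n d : series n d := fun y => (val y == x)%:R.
Arguments monomial : clear implicits.

Definition series_fil n d k (f : series n d) : Prop :=
  forall x, (wt (val x) < k)%N -> f x = 0.

(* For a fixed [z] only finitely many pairs of monomials contribute. *)
Definition series_comp m n p (d e r : int) (_ : (m + n = p.+1)%N)
    (_ : d + e = r) i (f : series m d) (g : series n e) : series p r :=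
  fun z => \sum_(u \in [set: monomials m d * monomials n e])
             f u.1 * g u.2 * cf i (val u.1) (val u.2) (val z).

Definition series_operad : operad K :=
  @Operad K series series_fil (monomial one 1%N 0) series_comp.

Variable dcf : X -> X -> K.

Definition series_diff n d e (f : series n d) : series n e :=
  fun z => \sum_(x \in [set: monomials n d]) f x * dcf (val x) (val z).

Hypothesis dcf_fin : forall z, finite_set [set x | dcf x z != 0].

Lemma series_diff_linear n d e : linear (@series_diff n d e).
Proof.
move=> a f g; apply/funext => z; rewrite /series_diff.
set A : set (monomials n d) := val @^-1` [set x | dcf x (val z) != 0].
have finA : finite_set A by apply: finite_preimage => // x y _ _ /val_inj.
have supp (h : monomials n d -> K) :
    \sum_(x \in [set: monomials n d]) h x * dcf (val x) (val z)
    = \sum_(x \in A) h x * dcf (val x) (val z).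
  apply/esym/fsbig_widen => // x [_ /= /negP]; rewrite negbK => /eqP ->.
  by rewrite mulr0.
rewrite supp; transitivity (a * (\sum_(x \in A) f x * dcf (val x) (val z))
    + \sum_(x \in A) g x * dcf (val x) (val z)); last by rewrite -!supp.
rewrite mulr_fsumr -fsbig_split //=.
by apply: eq_fsbigr => x _; rewrite mulrA -mulrDl.
Qed.

Definition series_diff_lin n d e : {linear series n d -> series n e} :=
  HB.pack (@series_diff n d e)
    (GRing.isLinear.Build K (series n d) (series n e) _ (@series_diff n d e)
       (@series_diff_linear n d e)).

Definition series_dgoperad : dgoperad K :=
  @DgOperad K series_operad (fun n d e _ => series_diff_lin n d e).

End Series.

Arguments monomial : clear implicits.

(* The completed coproduct of the shifted associative operad with the operads
   spanned by gamma and zeta is presented by the generators b, gamma, zeta and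
   the relation of the shifted associative operad.  The free completed operad on
   b, gamma, zeta has the planar binary trees below as monomials. *)
Inductive tree := Input | Gamma | Zeta | Node of tree & tree.

Fixpoint tree_encode (t : tree) : GenTree.tree nat :=
  match t with
  | Input => GenTree.Leaf 0%N
  | Gamma => GenTree.Leaf 1%N
  | Zeta => GenTree.Leaf 2%N
  | Node l r => GenTree.Node 0%N [:: tree_encode l; tree_encode r]
  end.

Fixpoint tree_decode (t : GenTree.tree nat) : tree :=
  match t with
  | GenTree.Leaf 1%N => Gamma
  | GenTree.Leaf 2%N => Zeta
  | GenTree.Node _ [:: l; r] => Node (tree_decode l) (tree_decode r)
  | _ => Input
  end.

Lemma tree_encodeK : cancel tree_encode tree_decode.
Proof. by elim=> //= l -> r ->. Qed.

HB.instance Definition _ := Choice.copy tree (can_type tree_encodeK).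

Fixpoint inputs t : nat :=
  match t with
  | Input => 1%N
  | Gamma | Zeta => 0%N
  | Node l r => (inputs l + inputs r)%N
  end.

Fixpoint tree_degree t : int :=
  match t with
  | Input => 0
  | Gamma => - 4
  | Zeta => - 1
  | Node l r => 1 + tree_degree l + tree_degree r
  end.

(* [w] is the filtration degree of gamma: for w = 1 it lies in F_1 and not in
   F_2, for w = 2 it lies in F_2, hence also in F_1. *)
Fixpoint tree_weight (w : nat) t : nat :=
  match t with
  | Input => 0%N
  | Gamma => w
  | Zeta => 1%N
  | Node l r => (tree_weight w l + tree_weight w r)%N
  end.

Fixpoint graft t i s : tree :=
  match t with
  | Input => s
  | Gamma => Gamma
  | Zeta => Zeta
  | Node l r => if (i < inputs l)%N then Node (graft l i s) r
                else Node l (graft r (i - inputs l)%N s)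
  end.

(* A tree stands for the composite of its generators read in prefix order.
   Grafting [s] on the i-th input of [t] moves [s] past the generators of [t]
   which follow that input; only b and zeta have odd degree. *)
Fixpoint odd_generators t : nat :=
  match t with
  | Input | Gamma => 0%N
  | Zeta => 1%N
  | Node l r => (odd_generators l + odd_generators r).+1%N
  end.

Fixpoint odd_generators_after t i : nat :=
  match t with
  | Input | Gamma | Zeta => 0%N
  | Node l r => if (i < inputs l)%N
                then (odd_generators_after l i + odd_generators r)%N
                else odd_generators_after r (i - inputs l)%N
  end.

Definition tree_coef (K : fieldType) i (t s u : tree) : K :=
  if (i < inputs t)%N && (u == graft t i s)
  then (-1) ^+ (odd_generators_after t i * odd_generators s)%N else 0.

Fact deg_bb : 1 + 1 = 2 :> int. Proof. by []. Qed.
Fact deg_bg : 1 + - 4 = - 3 :> int. Proof. by []. Qed.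
Fact deg_bz : 1 + - 1 = 0 :> int. Proof. by []. Qed.

Section ShiftedAs.
Variables (K : fieldType) (w : nat).

Definition tree_operad : operad K :=
  series_operad inputs tree_degree (tree_weight w) Input (@tree_coef K).

Definition tree_b : tree_operad 2%N 1 :=
  monomial K tree inputs tree_degree (Node Input Input) 2%N 1.
Definition tree_gamma : tree_operad 0%N (- 4) :=
  monomial K tree inputs tree_degree Gamma 0%N (- 4).
Definition tree_zeta : tree_operad 0%N (- 1) :=
  monomial K tree inputs tree_degree Zeta 0%N (- 1).

Section Relations.
Variables (P : operad K) (b : P 2%N 1) (g : P 0%N (- 4)) (z : P 0%N (- 1)).

Let bb i : P 3%N 2 := op_comp (erefl 4%N : (2 + 2 = 4)%N) deg_bb i b b.
Let bg i : P 1%N (- 3) :=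
  op_comp (erefl 2%N : (2 + 0 = 2)%N) deg_bg i b g.
Let bz i : P 1%N 0 :=
  op_comp (erefl 2%N : (2 + 0 = 2)%N) deg_bz i b z.

Inductive as_relation : forall n d, P n d -> Prop :=
  | As_assoc : as_relation (bb 0%N + bb 1%N).

Inductive aspp_relation : forall n d, P n d -> Prop :=
  | AsPP_gamma_left : aspp_relation (bg 0%N)
  | AsPP_gamma_right : aspp_relation (bg 1%N)
  | AsPP_zeta : aspp_relation (bz 0%N + bz 1%N).

End Relations.

Definition AsGZ : operad K := quotient_operad (as_relation tree_b).

Definition AsGZ_b : AsGZ 2%N 1 := op_proj (as_relation tree_b) tree_b.
Definition AsGZ_gamma : AsGZ 0%N (- 4) :=
  op_proj (as_relation tree_b) tree_gamma.
Definition AsGZ_zeta : AsGZ 0%N (- 1) :=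
  op_proj (as_relation tree_b) tree_zeta.

Definition AsPP_relation : forall n d, AsGZ n d -> Prop :=
  aspp_relation AsGZ_b AsGZ_gamma AsGZ_zeta.

Definition AsPP : operad K := quotient_operad AsPP_relation.

Definition AsPP_proj n d (x : AsGZ n d) : AsPP n d := op_proj AsPP_relation x.

End ShiftedAs.

(* A vertex records whether it is black and whether it carries a tadpole; a
   bamboo is its leftmost vertex followed by the other vertices from left to
   right, each with a flag telling whether it is joined to its predecessor.
   Vertices are numbered from 0. *)
Definition vertex := (bool * bool)%type.
Definition bamboo := (vertex * seq (bool * vertex))%type.

(* [edge j] joins the vertices j and j+1; [tadpole j] is at the vertex j. *)
Definition cell := (nat + nat)%type.
Definition edge (j : nat) : cell := inl j.
Definition tadpole (j : nat) : cell := inr j.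

Definition cell_lt (c c' : cell) : bool :=
  match c, c' with
  | inl i, inl j => (i < j)%N
  | inl _, inr _ => true
  | inr _, inl _ => false
  | inr i, inr j => (i < j)%N
  end.

Section Bamboo.
Implicit Types (x y z : bamboo) (v : nat).

Definition nvertices x : nat := (size x.2).+1.
Definition vertices x : seq vertex := x.1 :: [seq p.2 | p <- x.2].
Definition colours x : seq bool := [seq p.1 | p <- vertices x].
Definition black x v : bool := nth false (colours x) v.
Definition has_tadpole x v : bool := nth false [seq p.2 | p <- vertices x] v.
Definition joined x v : bool := nth false [seq p.1 | p <- x.2] v.

Definition whites x : seq nat :=
  [seq v <- iota 0%N (nvertices x) | ~~ black x v].
Definition blacks x : seq nat := [seq v <- iota 0%N (nvertices x) | black x v].

Definition cells x : seq cell :=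
  [seq edge v | v <- iota 0%N (size x.2) & joined x v] ++
  [seq tadpole v | v <- iota 0%N (nvertices x) & has_tadpole x v].

Definition bamboo_arity x : nat := size (whites x).
Definition bamboo_weight x : nat := size (blacks x).
Definition bamboo_degree x : int := (size (cells x))%:Z - (size (blacks x)).*2%:Z.

(* What becomes of a cell of [x] when the vertex [v] is replaced by [k]
   vertices: the list of the possible new cells. *)
Definition blow_up v k (c : cell) : seq cell :=
  match c with
  | inl j => if (j < v)%N then [:: edge j] else [:: edge (j + k).-1%N]
  | inr j =>
      if (j < v)%N then [:: tadpole j]
      else if (v < j)%N then [:: tadpole (j + k).-1%N]
      else [seq tadpole u | u <- iota v k] ++ [seq edge u | u <- iota v k.-1]
  end.

Definition shift_cell v (c : cell) : cell :=
  match c with inl j => edge (v + j)%N | inr j => tadpole (v + j)%N end.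

Fixpoint choices (T : Type) (ss : seq (seq T)) : seq (seq T) :=
  if ss is s :: ss' then [seq c :: r | c <- s, r <- choices ss'] else [:: [::]].

Definition insertion_words v x y : seq (seq cell) :=
  [seq r ++ [seq shift_cell v c | c <- cells y]
  | r <- choices [seq blow_up v (nvertices y) c | c <- cells x]].

Fixpoint inversions (r : seq cell) : nat :=
  if r is c :: r' then (count (fun c' => cell_lt c' c) r' + inversions r')%N else 0%N.

Definition insertion_colours v x y : seq bool :=
  take v (colours x) ++ colours y ++ drop v.+1 (colours x).

Variable K : fieldType.

(* Words with a repeated cell do not contribute: the cells of a bamboo are
   pairwise distinct. *)
Definition word_coef (r : seq cell) z : K :=
  if perm_eq r (cells z) then (-1) ^+ inversions r else 0.

(* The coefficient of [z] in the sum obtained by placing [y] at the vertex [v],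
   white or black, of [x]. *)
Definition insertion v x y z : K :=
  if colours z == insertion_colours v x y
  then \sum_(r <- insertion_words v x y) word_coef r z else 0.

Definition bamboo_coef i x y z : K :=
  if (i < bamboo_arity x)%N then insertion (nth 0%N (whites x) i) x y z else 0.

(* Two joined vertices with the given colours and no tadpole. *)
Definition link (c c' : bool) : bamboo := ((c, false), [:: (true, (c', false))]).

(* A bamboo x with black vertices is nu(.., alpha, ..), where nu is the same
   bamboo with only white vertices, and
     d x = (d nu)(.., alpha, ..) + (-1)^|nu| sum nu(.., d alpha, ..),
   with d nu = mu * nu - (-1)^|nu| nu * mu, mu = b(alpha, -) + b(-, alpha), and
   d alpha = b(alpha, alpha).  The three terms below are the contributions of
   mu * nu, of nu * mu and of d alpha. *)
Definition bamboo_diff x z : K :=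
  insertion 1%N (link true false) x z + insertion 0%N (link false true) x z
  - (-1) ^+ size (cells x) *
      (\sum_(v <- iota 0%N (nvertices x))
         (insertion v x (link true (black x v)) z +
          insertion v x (link (black x v) true) z))
  + (-1) ^+ size (cells x) *
      (\sum_(v <- blacks x) insertion v x (link true true) z).

End Bamboo.

Arguments word_coef {K} r z.
Arguments insertion {K} v x y z.

Section Finiteness.
Variable K : fieldType.
Implicit Types x y z : bamboo.

Lemma size_colours x : size (colours x) = nvertices x.
Proof. by rewrite !size_map /= size_map. Qed.

Lemma insertion0l v x y z : (v < nvertices x)%N ->
  (nvertices z < nvertices x)%N -> insertion v x y z = 0 :> K.
Proof.
move=> vx zx; rewrite /insertion; case: eqP => // /(congr1 size) /eqP.
rewrite !size_cat size_take size_drop !size_colours vx => /eqP e.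
move: zx; rewrite e -{2}(subnKC vx) addSnnS ltn_add2l {1}/nvertices.
by rewrite addSn ltnS ltnNge leq_addl.
Qed.

Lemma insertion0r v x y z :
  (nvertices z < nvertices y)%N -> insertion v x y z = 0 :> K.
Proof.
move=> zy; rewrite /insertion; case: eqP => // /(congr1 size) /eqP.
rewrite !size_cat !size_colours => /eqP e; move: zy.
by rewrite e addnCA ltnNge leq_addr.
Qed.

Lemma bamboo_diff0 x z :
  (nvertices z < nvertices x)%N -> bamboo_diff K x z = 0.
Proof.
move=> zx; rewrite /bamboo_diff !insertion0r // add0r.
rewrite !big_seq !big1 ?mulr0 ?subr0 ?addr0 //.
  move=> v; rewrite mem_filter mem_iota => /andP[_ vx].
  exact: insertion0l.
by move=> v; rewrite mem_iota => vx; rewrite !insertion0l ?addr0.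
Qed.

Lemma finite_bamboo n : finite_set [set x : bamboo | (size x.2 <= n)%N].
Proof.
pose f (p : vertex * n.-bseq (bool * vertex)) : bamboo := (p.1, val p.2).
apply: (@sub_finite_set _ _ (range f)); last by apply: finite_image; apply: finite_finset.
by move=> [a s] /= h; exists (a, Bseq h).
Qed.

Lemma bamboo_diff_fin z : finite_set [set x | bamboo_diff K x z != 0].
Proof.
apply: sub_finite_set (finite_bamboo (size z.2)) => x /=.
by apply: contraNT; rewrite -ltnNge => zx; apply/eqP/bamboo_diff0.
Qed.

End Finiteness.

Section Twisted.
Variable K : fieldType.

Definition white_vertex : bamboo := ((false, false), [::]).
Definition black_tadpole : bamboo := ((true, true), [::]).
Definition two_blacks : bamboo :=
  ((true, false), [:: (false, (true, false))]).

(* The weight of a bamboo is its number of black vertices, the copies of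
   alpha. *)
Definition TwncBV : dgoperad K :=
  series_dgoperad bamboo_arity bamboo_degree bamboo_weight white_vertex
    (@bamboo_coef K) (@bamboo_diff_fin K).

Definition Tw_b : TwncBV 2%N 1 :=
  monomial K bamboo bamboo_arity bamboo_degree (link false false) 2%N 1.
Definition Tw_gamma : TwncBV 0%N (- 4) :=
  monomial K bamboo bamboo_arity bamboo_degree two_blacks 0%N (- 4).
Definition Tw_zeta : TwncBV 0%N (- 1) :=
  monomial K bamboo bamboo_arity bamboo_degree black_tadpole 0%N (- 1).

Definition is_canonical_map (w : nat)
    (Phi : forall n d, AsGZ K w n d -> TwncBV n d) : Prop :=
  [/\ @is_dgmorphism K (zero_dgoperad (AsGZ K w)) TwncBV Phi,
      Phi _ _ (AsGZ_b K w) = Tw_b,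
      Phi _ _ (AsGZ_gamma K w) = Tw_gamma
    & Phi _ _ (AsGZ_zeta K w) = Tw_zeta].

End Twisted.

(* Main.v *)
Require Import Defs.
From HB Require Import structures.
From mathcomp Require Import all_boot all_order all_algebra.
From mathcomp Require Import boolp classical_sets functions cardinality fsbigop.
From mathcomp Require Import zify ring.

(** The homology of the twisted operad is computed by discrete Morse theory on the
    basis of bamboos, and compared with normal forms in the quotient operad.

    A bamboo is read from left to right as a word of vertices, each with a flag
    telling whether it is joined to its predecessor.  When the cells are ordered by
    position instead of putting the edges first, the many terms of the differential
    telescope: a black vertex inserted between two joined neighbours comes once from
    each of them, with opposite signs.  What remains is a derivation of words
    ([bamboo_diff_delta]), determined by three rules: a plain black vertex is sent to
    two joined ones; a white vertex with a tadpole is sent to the commutator of a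
    black tadpole t and a plain white vertex x; a break between two vertices is sent
    to the sum of the two words with a black vertex joined to either side of the
    break.  The letters t and x are cycles.

    A block of joined plain black vertices thus carries an acyclic complex, and a
    white tadpole kills the difference between t x and x t.  Accordingly the words
    are matched by lengthening or shortening the first block by one vertex, or by
    exchanging a white tadpole with x t ([matching_after], [matching]).  This matching
    is acyclic: the other terms of the differential of a source are sources, or have
    more tadpoles to the left of a white vertex ([matching_triangular]).  The words
    left over are the connected words of k letters t followed by n letters x, and two
    isolated black vertices, that is, gamma.  They are cycles, and every cycle is
    homologous to a series of them ([cycle_reduction]).  Conversely the signed count of
    the connected words with k letters t and n letters x in any order vanishes on
    boundaries ([derivation_plain]), so that no critical word of low weight can be
    removed by adding a boundary ([critical_not_boundary]).

    In the quotient operad, associativity turns a planar tree into the product of its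
    leaves, gamma annihilates any other factor, and zeta commutes with everything up
    to sign.  Hence every element is a series of normal trees: gamma, and the products
    of k copies of zeta and n inputs ([normal_form], [tree_class_normal_series]).  The
    canonical map sends the normal trees bijectively, up to sign, to the critical
    bamboos.  It induces a map to the homology because b(gamma, -) and b(-, gamma) lie
    in an arity and degree without critical bamboo, and because the relation on zeta
    is the differential of a white vertex with a tadpole.  Surjectivity is the
    reduction of cycles.  The image of a series of normal trees is small for the
    filtration only if the series is small, up to the shift by the weight two of the
    bamboo of gamma; this is the continuity of the inverse, and it gives injectivity
    since the quotient is separated.

    The operads of trees and of bamboos consist of formal series, and their axioms
    reduce to finite identities between structure constants ([structure_constants],
    [series_operad_complete]).  For bamboos these identities are checked in the
    exterior algebra on the cells, where an insertion becomes a substitution in a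
    product of linear forms ([insertion_expand]).  The homology is complete because
    the boundaries are closed, the differential being homogeneous for the weight. *)

Set Implicit Arguments.
Unset Strict Implicit.
Unset Printing Implicit Defensive.

Import Order.TTheory GRing.Theory Num.Theory.
Local Open Scope classical_set_scope.
Local Open Scope ring_scope.

(** * Coefficients of formal series *)

Section Coefficients.
Variables (K : fieldType) (X : choiceType) (ar : X -> nat) (dg : X -> int).
Variable wt : X -> nat.

Local Notation ser := (series K ar dg).

(** The coefficient at an arbitrary monomial: allowing the wrong arities and
    degrees, where it vanishes, avoids dependent sums over monomials. *)
Definition scoef n d (f : ser n d) (x : X) : K := oapp f 0 (insub x).

Lemma scoef_val n d (f : ser n d) (m : monomials ar dg n d) :
  scoef f (val m) = f m.
Proof. by rewrite /scoef valK. Qed.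

Lemma scoef_supp n d (f : ser n d) x :
  scoef f x != 0 -> ar x = n /\ dg x = d.
Proof.
rewrite /scoef; case: insubP => [m /andP[/eqP-> /eqP->] //|_ /=].
by rewrite eqxx.
Qed.

Lemma series_ext n d (f g : ser n d) :
  (forall x, scoef f x = scoef g x) -> f = g.
Proof. by move=> fg; apply/funext => m; rewrite -!scoef_val fg. Qed.

Lemma scoefP n d a (f g : ser n d) x :
  scoef (a *: f + g) x = a * scoef f x + scoef g x.
Proof.
by rewrite /scoef; case: insub => //=; rewrite mulr0 addr0.
Qed.

Lemma scoef0 n d x : scoef (0 : ser n d) x = 0.
Proof. by rewrite /scoef; case: insub. Qed.

Lemma scoefB n d (f g : ser n d) x : scoef (f - g) x = scoef f x - scoef g x.
Proof.
have -> : f - g = (-1) *: g + f by rewrite scaleN1r addrC.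
by rewrite scoefP mulN1r addrC.
Qed.

Lemma scoefZ n d a (f : ser n d) x : scoef (a *: f) x = a * scoef f x.
Proof. by rewrite -[a *: f]addr0 scoefP scoef0 addr0. Qed.

Lemma scoefD n d (f g : ser n d) x : scoef (f + g) x = scoef f x + scoef g x.
Proof. by rewrite -[f in LHS]scale1r scoefP mul1r. Qed.

Lemma scoef_sum n d (I : Type) (r : seq I) (F : I -> ser n d) x :
  scoef (\sum_(i <- r) F i) x = \sum_(i <- r) scoef (F i) x.
Proof.
by elim: r => [|i r IH]; rewrite ?big_nil ?scoef0 // !big_cons scoefD IH.
Qed.

Lemma scoef_monomial y n d x :
  scoef (monomial K X ar dg y n d) x
    = [&& x == y, ar y == n & dg y == d]%:R.
Proof.
rewrite /scoef; case: insubP => [m /andP[/eqP am /eqP dm] <-|] /=.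
  rewrite /monomial; case: eqP => // <-.
  by have /andP[-> ->] := valP m.
by have [<- /negbTE->|//] := eqVneq x y.
Qed.

Lemma filP n d k (f : ser n d) :
  series_fil wt k f <-> forall x, (wt x < k)%N -> scoef f x = 0.
Proof.
split=> h x xk; last by rewrite -scoef_val h.
rewrite /scoef; case: insubP => [m _ mx|//] /=; apply: h; by rewrite mx.
Qed.

Definition ser_of n d (F : X -> K) : ser n d := fun m => F (val m).
Arguments ser_of : clear implicits.

Lemma scoef_ser_of n d (F : X -> K) x :
  (F x != 0 -> ar x = n /\ dg x = d) -> scoef (ser_of n d F) x = F x.
Proof.
rewrite /scoef => h; case: insubP => [m _ <- //|/negP nx] /=.
by have [-> //|/h[ax dx]] := eqVneq (F x) 0; case: nx; rewrite ax dx !eqxx.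
Qed.

(** A sum over all monomials becomes a sum over any list containing the support. *)
Lemma sum_monomials n d (L : seq X) (G : monomials ar dg n d -> K) :
  uniq L -> (forall m, G m != 0 -> val m \in L) ->
  \sum_(m \in [set: monomials ar dg n d]) G m = \sum_(x <- L) oapp G 0 (insub x).
Proof.
move=> uL GL.
rewrite -(big_pmap insub G) (fsbigE (pmap insub L)) //.
- by apply: eq_bigl => m; apply/asboolP.
- exact: pmap_sub_uniq.
move=> m _; rewrite mem_pmap_sub; apply: contraNeq => /GL; exact.
Qed.

Lemma sum_monomials2 m n d e (L : seq X)
    (G : monomials ar dg m d -> monomials ar dg n e -> K) :
  uniq L -> (forall u v, G u v != 0 -> val u \in L /\ val v \in L) ->
  \sum_(u \in [set: monomials ar dg m d * monomials ar dg n e]) G u.1 u.2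
   = \sum_(x <- L) \sum_(y <- L) oapp (fun u => oapp (G u) 0 (insub y)) 0 (insub x).
Proof.
move=> uL GL.
have E : forall x, \sum_(y <- L) oapp (fun u => oapp (G u) 0 (insub y)) 0 (insub x)
  = oapp (fun u => \sum_(v <- pmap insub L) G u v) 0 (insub x : option (monomials ar dg m d)).
  move=> x; case: (insub x : option (monomials ar dg m d)) => [u|] /=; last by rewrite big1.
  by rewrite big_pmap.
rewrite [RHS](eq_bigr _ (fun x _ => E x)).
rewrite -(big_pmap insub (fun u => \sum_(v <- pmap insub L) G u v)).
rewrite -(big_allpairs (F := fun u => G u.1 u.2)) (fsbigE [seq (u, v) | u <- pmap insub L, v <- pmap insub L]) //.
- by apply: eq_bigl => p; apply/asboolP.
- by apply: allpairs_uniq; rewrite ?pmap_sub_uniq // => -[? ?] [? ?].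
move=> [u v] _ /=; apply: contraNeq => /GL [Lu Lv].
by apply/allpairsP; exists (u, v); rewrite /= !mem_pmap_sub.
Qed.

End Coefficients.

Arguments ser_of {K X} ar dg n d F.

Section TripleSums.
Variables (K : fieldType) (T : Type) (L : seq T) (A B C : T -> K).

Lemma triple_sum_left (F : T -> T -> T -> K) (G : T -> T -> K) :
  \sum_(p <- L) \sum_(c <- L)
     (\sum_(a <- L) \sum_(b <- L) A a * B b * F a b p) * C c * G p c
  = \sum_(a <- L) \sum_(b <- L) \sum_(c <- L)
     A a * B b * C c * \sum_(p <- L) F a b p * G p c.
Proof.
under eq_bigr => p _ do under eq_bigr => c _ do rewrite -mulrA mulr_suml.
under [RHS]eq_bigr => a _ do under eq_bigr => b _ do
  under eq_bigr => c _ do rewrite mulr_sumr.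
under [RHS]eq_bigr => a _ do under eq_bigr => b _ do rewrite exchange_big /=.
under eq_bigr => p _ do rewrite exchange_big /=.
rewrite exchange_big /=; apply: eq_bigr => a _.
rewrite [RHS]exchange_big /=; apply: eq_bigr => p _.
under eq_bigr => c _ do rewrite mulr_suml.
rewrite exchange_big /=; apply: eq_bigr => b _; apply: eq_bigr => c _.
ring.
Qed.

Lemma triple_sum_right (F : T -> T -> T -> K) (G : T -> T -> K) :
  \sum_(a <- L) \sum_(p <- L)
     A a * (\sum_(b <- L) \sum_(c <- L) B b * C c * F b c p) * G a p
  = \sum_(a <- L) \sum_(b <- L) \sum_(c <- L)
     A a * B b * C c * \sum_(p <- L) F b c p * G a p.
Proof.
apply: eq_bigr => a _.
under [RHS]eq_bigr => b _ do under eq_bigr => c _ do rewrite mulr_sumr.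
under [RHS]eq_bigr => b _ do rewrite exchange_big /=.
rewrite [RHS]exchange_big /=; apply: eq_bigr => p _.
rewrite mulr_sumr mulr_suml; apply: eq_bigr => b _.
rewrite mulr_sumr mulr_suml; apply: eq_bigr => c _.
ring.
Qed.

End TripleSums.

(** * Operads of formal series *)

Section SeriesOperad.
Variables (K : fieldType) (X : choiceType) (ar : X -> nat) (dg : X -> int).
Variables (wt : X -> nat) (one : X) (cf : nat -> X -> X -> X -> K).
Variables (sz : X -> nat) (lst : nat -> seq X).

(** The axioms of a complete operad, tested on monomials.  The size [sz] bounds
    the factors of a monomial in terms of the monomial itself, so that the list
    [lst N] of monomials of size at most [N] supports all the sums which occur in
    the coefficient at a monomial of size at most [N]. *)
Record structure_constants : Prop := StructureConstants {
  sc_uniq : forall N, uniq (lst N);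
  sc_mem : forall N x, (x \in lst N) = (sz x <= N)%N;
  sc_supp : forall i x y z, cf i x y z != 0 ->
    [/\ (i < ar x)%N, (ar x + ar y = (ar z).+1)%N, dg x + dg y = dg z,
        (wt x + wt y = wt z)%N & (sz x <= sz z)%N && (sz y <= sz z)%N];
  sc_one : ar one = 1%N /\ dg one = 0;
  sc_unitl : forall y z, cf 0 one y z = (y == z)%:R;
  sc_unitr : forall i x z, (i < ar x)%N -> cf i x one z = (x == z)%:R;
  sc_seq : forall i j a b c z N, (i < ar a)%N -> (j < ar b)%N ->
    (sz z <= N)%N ->
    \sum_(p <- lst N) cf i a b p * cf (i + j) p c z
      = \sum_(p <- lst N) cf j b c p * cf i a p z;
  sc_par : forall i j a b c z N, (i < j)%N -> (j < ar a)%N ->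
    (sz z <= N)%N ->
    \sum_(p <- lst N) cf i a b p * cf (j + ar b).-1 p c z
      = (-1) ^+ (`|dg b|%N * `|dg c|%N) *
        \sum_(p <- lst N) cf j a c p * cf i p b z }.

Hypothesis sc : structure_constants.

Local Notation P := (series_operad ar dg wt one cf).
Local Notation ser := (series K ar dg).

Lemma scoef_comp m n p (d e f : int) (hp : (m + n = p.+1)%N) (hf : d + e = f)
    i (x : ser m d) (y : ser n e) z N : (sz z <= N)%N ->
  scoef (series_comp cf hp hf i x y) z
    = \sum_(a <- lst N) \sum_(b <- lst N) scoef x a * scoef y b * cf i a b z.
Proof.
move=> zN.
have E (z' : monomials ar dg p f) : (sz (val z') <= N)%N ->
    series_comp cf hp hf i x y z'
     = \sum_(a <- lst N) \sum_(b <- lst N) scoef x a * scoef y b * cf i a b (val z').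
  move=> zN'; rewrite /series_comp.
  rewrite (sum_monomials2 (L := lst N)
     (G := fun u v => x u * y v * cf i (val u) (val v) (val z'))).
  - apply: eq_bigr => a _; apply: eq_bigr => b _.
    rewrite /scoef; case: (insubP (monomials ar dg m d) a) => [u _ <-|_] /=; last by rewrite !mul0r.
    by case: (insubP (monomials ar dg n e) b) => [v _ <-|_] //=; rewrite mulr0 mul0r.
  - exact: (sc_uniq sc).
  move=> u v; rewrite mulf_eq0 negb_or => /andP[_ /(sc_supp sc)[_ _ _ _]].
  by rewrite !(sc_mem sc) => /andP[az bz]; split; apply: leq_trans zN'.
rewrite {1}/scoef; case: insubP => [z' _ zz|nz] /=.
  by rewrite E zz.
rewrite big1 // => a _; rewrite big1 // => b _.
have [->|xa] := eqVneq (scoef x a) 0; first by rewrite !mul0r.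
have [->|yb] := eqVneq (scoef y b) 0; first by rewrite mulr0 mul0r.
have [->|/(sc_supp sc)[_ az dz _ _]] := eqVneq (cf i a b z) 0.
  by rewrite mulr0.
have [ax dx] := scoef_supp xa; have [ay dy] := scoef_supp yb.
case/negP: nz; rewrite -dz dx dy hf eqxx andbT.
by rewrite -eqSS -az ax ay hp.
Qed.

Lemma series_filtration : complete_filtration P.
Proof.
move=> n d; split=> [x m //|k x h m mk|k|x h|u h].
- by apply: h; exact: leqW.
- split=> [m //|a x y hx hy m mk] /=.
  by rewrite -!scoef_val scoefP !scoef_val hx // hy // mulr0 addr0.
- apply/funext => m; exact: (h (wt (val m)).+1).
(* The coefficient at a monomial is stationary beyond its weight. *)
exists (fun m => u (wt (val m)).+1 m) => k m mk.
have H j : (wt (val m) < j)%N -> u j m = u (wt (val m)).+1 m.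
  elim: j => // j IH; rewrite ltnS leq_eqVlt => /orP[/eqP-> //|mj].
  rewrite -(IH mj); apply/eqP; rewrite -subr_eq0; apply/eqP; exact: (h j m mj).
by apply/eqP; rewrite subr_eq0 (H k mk).
Qed.

Lemma series_bilinear : comp_bilinear P.
Proof.
move=> m n p d e f hp hf i a x x' y y' im; split; apply: series_ext => z;
  rewrite scoefP !(scoef_comp _ _ _ _ _ (leqnn (sz z))) mulr_sumr -big_split /=;
  apply: eq_bigr => u _; rewrite mulr_sumr -big_split /=;
  apply: eq_bigr => v _; rewrite scoefP; ring.
Qed.

Lemma series_filtered : comp_filtered P.
Proof.
move=> m n p d e f hp hf i x y k l im /filP xk /filP yl.
apply/filP => z zkl; rewrite (scoef_comp _ _ _ _ _ (leqnn (sz z))).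
rewrite big1 // => a _; rewrite big1 // => b _.
have [->|/(sc_supp sc)[_ _ _ wz _]] := eqVneq (cf i a b z) 0.
  by rewrite mulr0.
have [ak|ka] := ltnP (wt a) k; first by rewrite xk // !mul0r.
have [bl|lb] := ltnP (wt b) l; first by rewrite yl // mulr0 mul0r.
by move: zkl; rewrite -wz ltnNge leq_add.
Qed.

Lemma sum_delta (L : seq X) (F : X -> K) a : uniq L -> a \in L ->
  \sum_(x <- L) (x == a)%:R * F x = F a.
Proof.
move=> uL aL; rewrite (bigD1_seq a) //= eqxx mul1r big1 ?addr0 // => x.
by move=> /negbTE->; rewrite mul0r.
Qed.

Lemma scoef_one a : scoef (monomial K X ar dg one 1%N 0) a = (a == one)%:R.
Proof. by have [a1 d0] := sc_one sc; rewrite scoef_monomial a1 d0 !eqxx !andbT. Qed.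

Lemma sum_delta0 (L : seq X) (F : X -> K) a : uniq L ->
  (a \notin L -> F a = 0) -> \sum_(x <- L) (x == a)%:R * F x = F a.
Proof.
have [aL uL _|aL _ /(_ isT) ->] := boolP (a \in L); first exact: sum_delta.
rewrite big_seq big1 // => x xL; case: eqP => [xa|_]; last by rewrite mul0r.
by rewrite -xa xL in aL.
Qed.

Lemma series_unital : comp_unital P.
Proof.
move=> n d x; split=> [hp hf|hp hf i im]; apply: series_ext => z;
  rewrite (scoef_comp _ _ _ _ _ (leqnn (sz z))).
- under eq_bigr => a _ do
    (under eq_bigr => b _ do rewrite scoef_one -mulrA; rewrite -mulr_sumr).
  rewrite sum_delta0 ?(sc_uniq sc) //; last first.
    move=> L1; rewrite big1 // => b _.
    have [->|/(sc_supp sc)[_ _ _ _]] := eqVneq (cf 0 one b z) 0.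
      by rewrite mulr0.
    by rewrite -(sc_mem sc) (negbTE L1).
  under eq_bigr => b _ do rewrite (sc_unitl sc) mulrC.
  by rewrite sum_delta ?(sc_uniq sc) ?(sc_mem sc).
rewrite exchange_big /=.
under eq_bigr => a _ do
  (under eq_bigr => b _ do rewrite scoef_one mulrAC mulrC; rewrite -mulr_sumr).
rewrite sum_delta0 ?(sc_uniq sc) //; last first.
  move=> L1; rewrite big1 // => b _.
  have [->|/(sc_supp sc)[_ _ _ _]] := eqVneq (cf i b one z) 0.
    by rewrite mulr0.
  by rewrite -!(sc_mem sc) (negbTE L1) andbF.
under eq_bigr => a _.
  have -> : scoef x a * cf i a one z = (a == z)%:R * scoef x a.
    have [->|/scoef_supp[ax _]] := eqVneq (scoef x a) 0; first by rewrite mul0r mulr0.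
    by rewrite (sc_unitr sc) ?ax // mulrC.
  over.
by rewrite sum_delta ?(sc_uniq sc) ?(sc_mem sc).
Qed.

(** In an iterated composite the intermediate monomials are factors of [z]; all
    sums can therefore be taken over the same list, and be exchanged. *)
Lemma scoef_comp_left m n p q r (d e f g h : int) (hp : (m + n = p.+1)%N)
    (hf : d + e = f) (hq : (p + q = r.+1)%N) (hg : f + g = h) i j
    (x : ser m d) (y : ser n e) (w : ser q g) z :
  scoef (series_comp cf hq hg j (series_comp cf hp hf i x y) w) z
    = \sum_(a <- lst (sz z)) \sum_(b <- lst (sz z)) \sum_(c <- lst (sz z))
        scoef x a * scoef y b * scoef w c *
        \sum_(s <- lst (sz z)) cf i a b s * cf j s c z.
Proof.
rewrite (scoef_comp _ _ _ _ _ (leqnn (sz z))) -triple_sum_left.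
rewrite big_seq [RHS]big_seq; apply: eq_bigr => s.
rewrite (sc_mem sc) => sz_s; apply: eq_bigr => c _.
by rewrite (scoef_comp _ _ _ _ _ sz_s).
Qed.

Lemma scoef_comp_right m n p q r (d e f g h : int) (hp : (m + n = p.+1)%N)
    (hf : d + e = f) (hq : (q + p = r.+1)%N) (hg : g + f = h) i j
    (w : ser q g) (x : ser m d) (y : ser n e) z :
  scoef (series_comp cf hq hg j w (series_comp cf hp hf i x y)) z
    = \sum_(a <- lst (sz z)) \sum_(b <- lst (sz z)) \sum_(c <- lst (sz z))
        scoef w a * scoef x b * scoef y c *
        \sum_(s <- lst (sz z)) cf i b c s * cf j a s z.
Proof.
rewrite (scoef_comp _ _ _ _ _ (leqnn (sz z))) -triple_sum_right.
apply: eq_bigr => a _; rewrite big_seq [RHS]big_seq; apply: eq_bigr => s.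
by rewrite (sc_mem sc) => sz_s; rewrite (scoef_comp _ _ _ _ _ sz_s).
Qed.

Lemma eq_triple_sum (A B C : X -> K) (F G : X -> X -> X -> K) (L : seq X) :
  (forall a b c, A a != 0 -> B b != 0 -> C c != 0 -> F a b c = G a b c) ->
  \sum_(a <- L) \sum_(b <- L) \sum_(c <- L) A a * B b * C c * F a b c
  = \sum_(a <- L) \sum_(b <- L) \sum_(c <- L) A a * B b * C c * G a b c.
Proof.
move=> FG; apply: eq_bigr => a _; apply: eq_bigr => b _; apply: eq_bigr => c _.
have [->|ha] := eqVneq (A a) 0; first by rewrite !mul0r.
have [->|hb] := eqVneq (B b) 0; first by rewrite mulr0 !mul0r.
have [->|hc] := eqVneq (C c) 0; first by rewrite mulr0 !mul0r.
by rewrite FG.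
Qed.

Lemma series_sequential : comp_sequential P.
Proof.
move=> l m n p q r a b c ab bc abc hp hq hr hq' hab habc hbc habc' i j x y w il jm.
apply: series_ext => z; rewrite scoef_comp_left scoef_comp_right.
apply: eq_triple_sum => u v t /scoef_supp[ul _] /scoef_supp[vm _] _.
by apply: (sc_seq sc) => //; rewrite ?ul ?vm.
Qed.

Lemma series_parallel : comp_parallel P.
Proof.
move=> l m n p q r a b c ab ac abc hp hq hr hq' hab habc hac habc' i j x y w ij jl.
apply: series_ext => z; rewrite scoefZ !scoef_comp_left mulr_sumr.
under [RHS]eq_bigr do rewrite exchange_big mulr_sumr /=.
under [RHS]eq_bigr do under eq_bigr do rewrite mulr_sumr /=.
have -> : \sum_(i0 <- lst (sz z)) \sum_(i1 <- lst (sz z)) \sum_(i2 <- lst (sz z))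
     (-1) ^+ (`|b| * `|c|)%N * (scoef x i0 * scoef w i2 * scoef y i1 *
        \sum_(s <- lst (sz z)) cf j i0 i2 s * cf i s i1 z)
  = \sum_(u <- lst (sz z)) \sum_(v <- lst (sz z)) \sum_(t <- lst (sz z))
     scoef x u * scoef y v * scoef w t * ((-1) ^+ (`|b| * `|c|)%N *
        \sum_(s <- lst (sz z)) cf j u t s * cf i s v z).
  by do 3!(apply: eq_bigr => ? _); ring.
apply: eq_triple_sum => u v t /scoef_supp[ul _] /scoef_supp[vm dv] /scoef_supp[_ dt].
rewrite -{1}vm -dv -dt.
by apply: (sc_par sc) => //; rewrite ?ul.
Qed.

(** Each operadic axiom is linear in its arguments and only involves finitely
    many coefficients at a time, hence follows from its instances on monomials. *)
Theorem series_operad_complete : is_complete_operad P.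
Proof.
split.
- exact: series_filtration.
- exact: series_bilinear.
- exact: series_filtered.
- exact: series_unital.
- exact: series_sequential.
- exact: series_parallel.
Qed.

End SeriesOperad.

Section SeriesDgOperad.
Variables (K : fieldType) (X : choiceType) (ar : X -> nat) (dg : X -> int).
Variables (wt : X -> nat) (one : X) (cf : nat -> X -> X -> X -> K).
Variables (sz : X -> nat) (lst : nat -> seq X).
Variables (dcf : X -> X -> K) (fin : forall z, finite_set [set x | dcf x z != 0]).
Hypothesis sc : structure_constants ar dg wt one cf sz lst.

Record differential_constants : Prop := DifferentialConstants {
  dc_supp : forall x z, dcf x z != 0 ->
    [/\ ar x = ar z, dg x = dg z + 1, wt z = (wt x).+1 & (sz x <= sz z)%N];
  dc_square : forall x z N, (sz z <= N)%N ->
    \sum_(p <- lst N) dcf x p * dcf p z = 0;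
  dc_derivation : forall i x y z N, (i < ar x)%N -> (sz z <= N)%N ->
    \sum_(p <- lst N) cf i x y p * dcf p z
      = \sum_(p <- lst N) dcf x p * cf i p y z
        + (-1) ^+ `|dg x|%N * \sum_(p <- lst N) dcf y p * cf i x p z }.

Hypothesis dc : differential_constants.

Local Notation P := (series_dgoperad ar dg wt one cf fin).
Local Notation ser := (series K ar dg).

Lemma scoef_diff n d e (x : ser n d) z N : e + 1 = d -> (sz z <= N)%N ->
  scoef (series_diff dcf x : ser n e) z
    = \sum_(a <- lst N) scoef x a * dcf a z.
Proof.
move=> de zN.
rewrite {1}/scoef; case: insubP => [z' _ zz|nz] /=.
  rewrite /series_diff (sum_monomials (L := lst N)) ?(sc_uniq sc) //.
    apply: eq_bigr => a _; rewrite zz /scoef.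
    by case: insubP => [u _ <-|_] //=; rewrite mul0r.
  move=> u; rewrite mulf_eq0 negb_or => /andP[_ /(dc_supp dc)[_ _ _]].
  by rewrite (sc_mem sc) zz => /leq_trans; apply.
rewrite big1 // => a _.
have [->|xa] := eqVneq (scoef x a) 0; first by rewrite !mul0r.
have [->|/(dc_supp dc)[az dz _ _]] := eqVneq (dcf a z) 0.
  by rewrite mulr0.
have [ax dx] := scoef_supp xa; case/negP: nz.
by rewrite -az ax eqxx /= -(inj_eq (addIr 1)) -dz dx de.
Qed.

Lemma double_sum_comp (T : Type) (L : seq T) (A : T -> K) (F G : T -> T -> K) z :
  \sum_(a <- L) (\sum_(b <- L) A b * F b a) * G a z
  = \sum_(b <- L) A b * \sum_(a <- L) F b a * G a z.
Proof.
under eq_bigr do rewrite mulr_suml.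
rewrite exchange_big; apply: eq_bigr => b _; rewrite mulr_sumr.
by apply: eq_bigr => a _; rewrite mulrA.
Qed.

Theorem series_dgoperad_complete : is_complete_dgoperad P.
Proof.
split; first exact: (series_operad_complete sc).
- move=> n d e h k x /filP xk; apply/filP => z zk.
  rewrite (scoef_diff _ h (leqnn _)) big1 // => a _.
  have [->|/(dc_supp dc)[_ _ wz _]] := eqVneq (dcf a z) 0; first by rewrite mulr0.
  by rewrite xk ?mul0r // -ltnS -wz ltnW.
- move=> n d e f h h' x; apply: series_ext => z.
  rewrite scoef0 (scoef_diff _ h' (leqnn _)).
  transitivity (\sum_(a <- lst (sz z)) (\sum_(b <- lst (sz z)) scoef x b * dcf b a) * dcf a z).
    rewrite big_seq [RHS]big_seq; apply: eq_bigr => a; rewrite (sc_mem sc) => az.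
    by rewrite (scoef_diff _ h az).
  rewrite double_sum_comp big1 // => b _.
  by rewrite (dc_square dc) ?mulr0.
move=> m n p d e f d' e' f' hp hf hd he hf1 hf2 hf3 i x y im.
apply: series_ext => z; rewrite scoefD scoefZ (scoef_diff _ hf1 (leqnn _)).
rewrite !(scoef_comp sc _ _ _ _ _ (leqnn _)).
set L := lst (sz z).
transitivity (\sum_(s <- L) (\sum_(a <- L) \sum_(b <- L) scoef x a * scoef y b * cf i a b s) * dcf s z).
  rewrite big_seq [RHS]big_seq; apply: eq_bigr => s; rewrite (sc_mem sc) => sz_s.
  by rewrite (scoef_comp sc _ _ _ _ _ sz_s).
transitivity (\sum_(a <- L) \sum_(b <- L) scoef x a * scoef y b * \sum_(s <- L) cf i a b s * dcf s z).
  under eq_bigr do rewrite mulr_suml.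
  rewrite exchange_big; apply: eq_bigr => a _.
  under eq_bigr do rewrite mulr_suml.
  rewrite exchange_big; apply: eq_bigr => b _ /=; rewrite mulr_sumr.
  by apply: eq_bigr => s _; rewrite mulrA.
have -> : \sum_(a <- L) \sum_(b <- L) scoef (series_diff dcf x : ser m d') a * scoef y b * cf i a b z
   = \sum_(a <- L) \sum_(b <- L) scoef x a * scoef y b * \sum_(s <- L) dcf a s * cf i s b z.
  transitivity (\sum_(s <- L) (\sum_(a <- L) scoef x a * dcf a s) * (\sum_(b <- L) scoef y b * cf i s b z)).
    rewrite big_seq [RHS]big_seq; apply: eq_bigr => s; rewrite (sc_mem sc) => sz_s.
    rewrite (scoef_diff _ hd sz_s) mulr_sumr; apply: eq_bigr => b _; ring.
  rewrite (double_sum_comp L (scoef x) dcf (fun s _ => \sum_(b <- L) scoef y b * cf i s b z) z).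
  apply: eq_bigr => a _; rewrite mulr_sumr.
  under eq_bigr do rewrite !mulr_sumr.
  rewrite exchange_big; apply: eq_bigr => b _; rewrite mulr_sumr.
  by apply: eq_bigr => s _; ring.
have -> : \sum_(a <- L) \sum_(b <- L) scoef x a * scoef (series_diff dcf y : ser n e') b * cf i a b z
   = \sum_(a <- L) \sum_(b <- L) scoef x a * scoef y b * \sum_(s <- L) dcf b s * cf i a s z.
  apply: eq_bigr => a _.
  transitivity (scoef x a * \sum_(s <- L) (\sum_(b <- L) scoef y b * dcf b s) * cf i a s z).
    rewrite mulr_sumr big_seq [RHS]big_seq; apply: eq_bigr => s; rewrite (sc_mem sc) => sz_s.
    by rewrite (scoef_diff _ he sz_s) mulrA.
  rewrite (double_sum_comp L (scoef y) dcf (fun s z => cf i a s z) z) mulr_sumr.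
  by apply: eq_bigr => b _; rewrite mulrA.
rewrite mulr_sumr -big_split; apply: eq_bigr => a _ /=.
rewrite mulr_sumr -big_split; apply: eq_bigr => b _ /=.
have [->|/scoef_supp[xa da]] := eqVneq (scoef x a) 0; first by rewrite !mul0r mulr0 addr0.
rewrite (dc_derivation dc) ?xa //; rewrite da; ring.
Qed.

End SeriesDgOperad.

(** * Morphisms between operads of formal series *)

Lemma double_sum_product (K : fieldType) (T U : Type) (L : seq T) (M : seq U)
    (A B : T -> K) (F G : T -> U -> K) (C : U -> U -> K) :
  \sum_(a <- L) \sum_(b <- L) \sum_(s <- M) \sum_(t <- M)
     A a * B b * (F a s * G b t * C s t)
  = \sum_(s <- M) \sum_(t <- M)
     (\sum_(a <- L) A a * F a s) * (\sum_(b <- L) B b * G b t) * C s t.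
Proof.
transitivity (\sum_(a <- L) \sum_(s <- M) \sum_(b <- L) \sum_(t <- M)
     A a * B b * (F a s * G b t * C s t)).
  by apply: eq_bigr => a _; rewrite exchange_big.
rewrite exchange_big; apply: eq_bigr => s _ /=.
transitivity (\sum_(a <- L) \sum_(t <- M) \sum_(b <- L)
     A a * B b * (F a s * G b t * C s t)).
  by apply: eq_bigr => a _; rewrite exchange_big.
rewrite exchange_big; apply: eq_bigr => t _ /=.
rewrite -mulrA mulr_suml; apply: eq_bigr => a _; rewrite mulr_suml mulr_sumr.
apply: eq_bigr => b _; ring.
Qed.

Section SeriesMorphism.
Variables (K : fieldType).
Variables (X : choiceType) (arX : X -> nat) (dgX : X -> int) (wtX : X -> nat).
Variables (oneX : X) (cfX : nat -> X -> X -> X -> K).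
Variables (szX : X -> nat) (lstX : nat -> seq X).
Variables (Y : choiceType) (arY : Y -> nat) (dgY : Y -> int) (wtY : Y -> nat).
Variables (oneY : Y) (cfY : nat -> Y -> Y -> Y -> K).
Variables (szY : Y -> nat) (lstY : nat -> seq Y).
Hypothesis scX : structure_constants arX dgX wtX oneX cfX szX lstX.
Hypothesis scY : structure_constants arY dgY wtY oneY cfY szY lstY.
Variable phi : X -> Y -> K.

(** A morphism between operads of series is given by a matrix [phi], whose column
    at [z] is finite because of the comparison of the sizes. *)
Record kernel_morphism : Prop := KernelMorphism {
  km_supp : forall x z, phi x z != 0 ->
    [/\ arX x = arY z, dgX x = dgY z, (wtX x <= wtY z)%N & (szX x <= szY z)%N];
  km_one : forall z, phi oneX z = (z == oneY)%:R;
  km_comp : forall i x y z N, (i < arX x)%N -> (szY z <= N)%N ->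
    \sum_(u <- lstX N) cfX i x y u * phi u z
      = \sum_(p <- lstY N) \sum_(q <- lstY N) phi x p * phi y q * cfY i p q z }.

Hypothesis km : kernel_morphism.

Local Notation P := (series_operad arX dgX wtX oneX cfX).
Local Notation Q := (series_operad arY dgY wtY oneY cfY).

Definition series_map n d (f : series K arX dgX n d) : series K arY dgY n d :=
  ser_of arY dgY n d (fun z => \sum_(x <- lstX (szY z)) scoef f x * phi x z).

Lemma scoef_series_map n d (f : series K arX dgX n d) z N : (szY z <= N)%N ->
  scoef (series_map f) z = \sum_(x <- lstX N) scoef f x * phi x z.
Proof.
move=> zN; rewrite scoef_ser_of.
  have sub M : (szY z <= M)%N -> \sum_(x <- lstX M) scoef f x * phi x z
      = \sum_(x <- lstX M | (szX x <= szY z)%N) scoef f x * phi x z.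
    move=> zM; rewrite [RHS]big_mkcond; apply: eq_bigr => x _; case: ifP => // nx.
    have [->|/(km_supp km)[_ _ _]] := eqVneq (phi x z) 0; first by rewrite mulr0.
    by rewrite nx.
  rewrite sub // [RHS]sub // -big_filter -[RHS]big_filter; apply: perm_big; apply: uniq_perm.
  - by rewrite filter_uniq ?(sc_uniq scX).
  - by rewrite filter_uniq ?(sc_uniq scX).
  move=> x; rewrite !mem_filter !(sc_mem scX); case: leqP => //= xz.
  by rewrite (leq_trans xz).
apply: contraNP => H; rewrite big1 // => x _.
have [->|/scoef_supp[xn xd]] := eqVneq (scoef f x) 0; first by rewrite mul0r.
have [->|/(km_supp km)[an ad _ _]] := eqVneq (phi x z) 0; first by rewrite mulr0.
by case: H; rewrite -an -ad.
Qed.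

Lemma series_map_morphism : @is_morphism K P Q series_map.
Proof.
split.
- move=> n d a x y; apply: series_ext => z.
  rewrite scoefP !(scoef_series_map _ (leqnn _)) mulr_sumr -big_split.
  by apply: eq_bigr => u _; rewrite scoefP /=; ring.
- move=> n d k x /filP xk; apply/filP => z zk.
  rewrite (scoef_series_map _ (leqnn _)) big1 // => u _.
  have [->|/(km_supp km)[_ _ uz _]] := eqVneq (phi u z) 0; first by rewrite mulr0.
  by rewrite xk ?mul0r // (leq_ltn_trans uz).
- apply: series_ext => z; rewrite (scoef_one scY) (scoef_series_map _ (leqnn _)).
  under eq_bigr do rewrite (scoef_one scX).
  rewrite sum_delta0 ?(sc_uniq scX) ?(km_one km) // => nX.
  apply/eqP; apply: contraNT nX.
  by rewrite -(km_one km) (sc_mem scX) => /(km_supp km)[].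
move=> m n p d e r hp hr i x y im; apply: series_ext => z.
rewrite (scoef_series_map _ (leqnn _)) (scoef_comp scY _ _ _ _ _ (leqnn _)).
set LX := lstX (szY z); set LY := lstY (szY z).
transitivity (\sum_(a <- LX) \sum_(b <- LX) scoef x a * scoef y b *
    \sum_(u <- LX) cfX i a b u * phi u z).
  transitivity (\sum_(u <- LX) (\sum_(a <- LX) \sum_(b <- LX)
      scoef x a * scoef y b * cfX i a b u) * phi u z).
    rewrite big_seq [RHS]big_seq; apply: eq_bigr => u; rewrite (sc_mem scX) => uz.
    by rewrite (scoef_comp scX _ _ _ _ _ uz).
  under eq_bigr do rewrite mulr_suml.
  rewrite exchange_big; apply: eq_bigr => a _ /=.
  under eq_bigr do rewrite mulr_suml.
  rewrite exchange_big; apply: eq_bigr => b _ /=.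
  by rewrite mulr_sumr; apply: eq_bigr => u _; rewrite mulrA.
transitivity (\sum_(a <- LX) \sum_(b <- LX) \sum_(s <- LY) \sum_(t <- LY)
    scoef x a * scoef y b * (phi a s * phi b t * cfY i s t z)).
  apply: eq_bigr => a _; apply: eq_bigr => b _.
  have [->|/scoef_supp[xa _]] := eqVneq (scoef x a) 0.
    by rewrite !mul0r big1 // => s _; rewrite big1 // => t _; rewrite !mul0r.
  rewrite (km_comp km) ?xa // mulr_sumr; apply: eq_bigr => s _.
  by rewrite mulr_sumr.
rewrite double_sum_product.
rewrite big_seq [RHS]big_seq; apply: eq_bigr => s; rewrite (sc_mem scY) => sz_s.
rewrite big_seq [RHS]big_seq; apply: eq_bigr => t; rewrite (sc_mem scY) => sz_t.
by rewrite !(scoef_series_map _ _ (N := szY z)).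
Qed.

End SeriesMorphism.

(** * Quotients of complete operads *)

Section Bilinearity.
Variables (K : fieldType) (P : operad K).
Hypothesis bil : comp_bilinear P.
Variables (m n p : nat) (d e f : int) (hp : (m + n = p.+1)%N) (hf : d + e = f).
Variables (i : nat).
Hypothesis im : (i < m)%N.
Implicit Types (x : P m d) (y : P n e).

Lemma comp_linl a x x' y :
  op_comp hp hf i (a *: x + x') y = a *: op_comp hp hf i x y + op_comp hp hf i x' y.
Proof. by have [] := bil hp hf a x x' y y im. Qed.

Lemma comp_linr a x y y' :
  op_comp hp hf i x (a *: y + y') = a *: op_comp hp hf i x y + op_comp hp hf i x y'.
Proof. by have [] := bil hp hf a x x y y' im. Qed.

Lemma comp0l y : op_comp hp hf i 0 y = 0.
Proof.
have := comp_linl (-1) 0 0 y; rewrite scaler0 addr0 scaleN1r => h.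
by rewrite {1}h addNr.
Qed.

Lemma comp0r x : op_comp hp hf i x 0 = 0.
Proof.
have := comp_linr (-1) x 0 0; rewrite scaler0 addr0 scaleN1r => h.
by rewrite {1}h addNr.
Qed.

Lemma compZl a x y : op_comp hp hf i (a *: x) y = a *: op_comp hp hf i x y.
Proof. by have := comp_linl a x 0 y; rewrite comp0l !addr0. Qed.

Lemma compZr a x y : op_comp hp hf i x (a *: y) = a *: op_comp hp hf i x y.
Proof. by have := comp_linr a x y 0; rewrite comp0r !addr0. Qed.

Lemma compDl x x' y :
  op_comp hp hf i (x + x') y = op_comp hp hf i x y + op_comp hp hf i x' y.
Proof. by have := comp_linl 1 x x' y; rewrite !scale1r. Qed.

Lemma compDr x y y' :
  op_comp hp hf i x (y + y') = op_comp hp hf i x y + op_comp hp hf i x y'.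
Proof. by have := comp_linr 1 x y y'; rewrite !scale1r. Qed.

Lemma compBl x x' y :
  op_comp hp hf i (x - x') y = op_comp hp hf i x y - op_comp hp hf i x' y.
Proof. by rewrite -[- x']scaleN1r compDl compZl scaleN1r. Qed.

Lemma compBr x y y' :
  op_comp hp hf i x (y - y') = op_comp hp hf i x y - op_comp hp hf i x y'.
Proof. by rewrite -[- y']scaleN1r compDr compZr scaleN1r. Qed.

End Bilinearity.

Section Filtration.
Variables (K : fieldType) (P : operad K).
Hypothesis cP : complete_filtration P.
Variables (n : nat) (d : int).
Implicit Types (x y : P n d).

Lemma fil_top x : op_fil 0 x.
Proof. by have [h _ _ _ _] := cP n d; exact: h. Qed.

Lemma filS k x : op_fil k.+1 x -> op_fil k x.
Proof. by have [_ h _ _ _] := cP n d; exact: h. Qed.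

Lemma fil0 k : op_fil k (0 : P n d).
Proof. by have [_ _ h _ _] := cP n d; case: (h k). Qed.

Lemma fil_lin k a x y : op_fil k x -> op_fil k y -> op_fil k (a *: x + y).
Proof. by have [_ _ h _ _] := cP n d; case: (h k) => _; apply. Qed.

Lemma fil_separated x : (forall k, op_fil k x) -> x = 0.
Proof. by have [_ _ _ h _] := cP n d; exact: h. Qed.

Lemma fil_limit (u : nat -> P n d) : (forall k, op_fil k (u k.+1 - u k)) ->
  exists l, forall k, op_fil k (l - u k).
Proof. by have [_ _ _ _ h] := cP n d; exact: h. Qed.

Lemma filB k x y : op_fil k x -> op_fil k y -> op_fil k (x - y).
Proof. by move=> h h'; rewrite -[- y]scaleN1r addrC; apply: fil_lin. Qed.

End Filtration.

Section LinearQuotient.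
Variables (K : fieldType) (V : lmodType K) (S : subspace V).

Lemma lquot_pi_lin a x y :
  lquot_pi S (a *: x + y) = a *: lquot_pi S x + lquot_pi S y.
Proof. by rewrite lquot_piD -lquot_scale_pi. Qed.

Lemma lquot_piZ a x : lquot_pi S (a *: x) = a *: lquot_pi S x.
Proof. by rewrite -lquot_scale_pi. Qed.

Lemma lquot_pi0 : lquot_pi S 0 = 0.
Proof. by rewrite -(scale0r (0 : V)) lquot_piZ scale0r. Qed.

Lemma lquot_piB x y : lquot_pi S (x - y) = lquot_pi S x - lquot_pi S y.
Proof. by rewrite -[- y]scaleN1r lquot_piD lquot_piZ scaleN1r. Qed.

Lemma lquot_pi_eq0 x : lquot_pi S x = 0 <-> x \in subspace_pred S.
Proof. by rewrite -lquot_pi0 lquot_piP subr0. Qed.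

Lemma lquot_ind (T : lquot S -> Prop) :
  (forall x, T (lquot_pi S x)) -> forall q, T q.
Proof. by move=> h q; rewrite -[q]lquot_reprK. Qed.

End LinearQuotient.

Section Quotient.
Variables (K : fieldType) (P : operad K) (R : forall n d, P n d -> Prop).

Local Notation J := (closed_ideal R).
Local Notation S := (ideal_subspace R).

(** The closedness of the ideal makes the filtration of the quotient separated. *)
Lemma closed_ideal_closed : is_closed_ideal (@closed_ideal K P R).
Proof.
split.
- by move=> n d I idI _; exact: ideal0.
- move=> n d a x y hx hy I idI RI.
  by apply: ideal_linear => //; [exact: hx|exact: hy].
- by move=> m n p d e f hp hf i x y im hx I idI RI; apply: ideal_compl => //; exact: hx.
- by move=> m n p d e f hp hf i x y im hx I idI RI; apply: ideal_compr => //; exact: hx.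
- move=> n d x h I idI RI; apply: ideal_closed => // k.
  by have [y Jy xy] := h k; exists y => //; exact: Jy.
Qed.

Lemma closed_ideal_sub n d (x : P n d) : R x -> J x.
Proof. by move=> Rx I _; exact. Qed.

Lemma mem_ideal n d (x : P n d) : (x \in subspace_pred (S n d)) <-> J x.
Proof. by split=> [/asboolP|h]; last exact/asboolP. Qed.

Lemma op_projP n d (x y : P n d) :
  op_proj R x = op_proj R y <-> J (x - y).
Proof. by rewrite /op_proj lquot_piP mem_ideal. Qed.

Lemma quotient_ind n d (T : quotient_operad R n d -> Prop) :
  (forall x, T (op_proj R x)) -> forall q, T q.
Proof. exact: lquot_ind. Qed.

Hypothesis cP : is_complete_operad P.

Lemma op_proj_comp m n p d e f (hp : (m + n = p.+1)%N) (hf : d + e = f) i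
    (x : P m d) (y : P n e) : (i < m)%N ->
  op_comp hp hf i (op_proj R x : quotient_operad R m d) (op_proj R y : quotient_operad R n e)
    = op_proj R (op_comp hp hf i x y).
Proof.
move=> im; apply/op_projP.
set x' := lquot_repr _; set y' := lquot_repr _.
have bil := cop_bilinear cP; have idJ := closed_ideal_closed.
have hx : J (x' - x) by apply/op_projP; rewrite /op_proj lquot_reprK.
have hy : J (y' - y) by apply/op_projP; rewrite /op_proj lquot_reprK.
have -> : op_comp hp hf i x' y' - op_comp hp hf i x y
   = 1 *: op_comp hp hf i (x' - x) y' + op_comp hp hf i x (y' - y).
  by rewrite scale1r compBl // compBr // addrA subrK.
apply: (ideal_linear idJ).
  exact: (ideal_compl idJ).
exact: (ideal_compr idJ).
Qed.

Lemma op_proj_lin n d a (x y : P n d) :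
  (op_proj R (a *: x + y) : quotient_operad R n d) = a *: op_proj R x + op_proj R y.
Proof. exact: lquot_pi_lin. Qed.

(** A Cauchy sequence of the quotient is lifted step by step: its successive
    differences have representatives in the filtration of the operad. *)
Lemma quotient_filtration : complete_filtration (quotient_operad R).
Proof.
have cf := cop_filtration cP.
move=> n d; split=> [q|k q [x xk <-]|k|q h|u h].
- by exists (lquot_repr q); [exact: fil_top|exact: lquot_reprK].
- by exists x => //; exact: filS xk.
- split; first by exists 0; [exact: fil0|exact: lquot_pi0].
  move=> a _ _ [x xk <-] [y yk <-]; exists (a *: x + y); first exact: fil_lin.
  exact: lquot_pi_lin.
- move: q h; apply: lquot_ind => x h.
  apply/lquot_pi_eq0/mem_ideal; apply: (ideal_closed closed_ideal_closed).
  move=> k; have [y yk /esym/op_projP xy] := h k.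
  by exists (x - y) => //; rewrite subKr.
have /choice[v hv] : forall k, exists v : P n d, op_fil k v /\ op_proj R v = u k.+1 - u k.
  by move=> k; have [v vk e] := h k; exists v.
pose w k := lquot_repr (u 0%N) + \sum_(j < k) v j.
have hw k : op_proj R (w k) = u k.
  elim: k => [|k IH]; first by rewrite /w big_ord0 addr0 /op_proj lquot_reprK.
  rewrite /w big_ord_recr addrA -/(w k) /op_proj lquot_piD -/(op_proj R _) IH /=.
  by have [_ e] := hv k; rewrite -/(op_proj R _) e addrC subrK.
have [l hl] : exists l, forall k, op_fil k (l - w k).
  apply: fil_limit => // k; rewrite /w big_ord_recr /= addrA [_ - _]addrC addKr.
  by have [] := hv k.
exists (op_proj R l) => k; exists (l - w k) => //.
by rewrite -hw [LHS]lquot_piB.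
Qed.

Theorem quotient_complete : is_complete_operad (quotient_operad R).
Proof.
have bil := cop_bilinear cP.
split; first exact: quotient_filtration.
- move=> m n p d e f hp hf i a + + + + im.
  do 4!apply: quotient_ind => ?.
  by split; rewrite -op_proj_lin !op_proj_comp // -op_proj_lin ?comp_linl ?comp_linr.
- move=> m n p d e f hp hf i _ _ k l im [x xk <-] [y yl <-].
  by rewrite op_proj_comp //; exists (op_comp hp hf i x y) => //; apply: (cop_filtered cP).
- move=> n d; apply: quotient_ind => x; have [ul ur] := cop_unital cP x; split.
    by move=> hp hf; rewrite op_proj_comp // ul.
  by move=> hp hf i im; rewrite op_proj_comp // ur.
- move=> l m n p q r a b c ab bc abc hp hq hr hq' hab habc hbc habc' i j + + + il jm.
  do 3!apply: quotient_ind => ?.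
  rewrite !op_proj_comp //; last by lia.
  by congr op_proj; apply: (cop_sequential cP).
move=> l m n p q r a b c ab ac abc hp hq hr hq' hab habc hac habc' i j + + + ij jl.
do 3!apply: quotient_ind => ?.
rewrite !op_proj_comp //; try lia.
by rewrite -[RHS]lquot_piZ; congr op_proj; apply: (cop_parallel cP).
Qed.

Lemma op_proj_morphism : @is_morphism K P (quotient_operad R) (@op_proj K P R).
Proof.
split=> //.
- exact: op_proj_lin.
- by move=> n d k x xk; exists x.
by move=> m n p d e r hp hr i x y im; rewrite op_proj_comp.
Qed.

End Quotient.

Section Kernel.
Variables (K : fieldType) (P Q : operad K) (f : forall n d, P n d -> Q n d).
Hypotheses (cP : is_complete_operad P) (cQ : is_complete_operad Q).
Hypothesis mf : is_morphism f.

Lemma mor0 n d : f (0 : P n d) = 0.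
Proof.
have := mor_linear mf (-1) (0 : P n d) 0; rewrite scaler0 addr0 scaleN1r => h.
by rewrite {1}h addNr.
Qed.

Lemma morB n d (x y : P n d) : f (x - y) = f x - f y.
Proof.
by rewrite -[- y]scaleN1r addrC (mor_linear mf) scaleN1r addrC.
Qed.

(** The kernel is closed because the target is separated; hence it contains the
    closed ideal generated by any family of relations which holds in the target. *)
Lemma kernel_closed_ideal : is_closed_ideal (fun n d (x : P n d) => f x = 0).
Proof.
have bil := cop_bilinear cQ.
split.
- by move=> n d; exact: mor0.
- by move=> n d a x y fx fy; rewrite (mor_linear mf) fx fy scaler0 addr0.
- by move=> m n p d e g hp hg i x y im fx; rewrite (mor_comp mf) // fx comp0l.
- by move=> m n p d e g hp hg i x y im fy; rewrite (mor_comp mf) // fy comp0r.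
move=> n d x h; apply: (fil_separated (cop_filtration cQ)) => k.
have [y fy xy] := h k; rewrite -[f x]subr0 -fy -morB.
exact: (mor_filtered mf).
Qed.

Variable R : forall n d, P n d -> Prop.
Hypothesis Rf : forall n d (x : P n d), R x -> f x = 0.

Definition quotient_lift n d (q : quotient_operad R n d) : Q n d :=
  f (lquot_repr q).

Lemma quotient_liftE n d (x : P n d) : quotient_lift (op_proj R x) = f x.
Proof.
rewrite /quotient_lift; apply/eqP; rewrite -subr_eq0 -morB; apply/eqP.
have : closed_ideal R (lquot_repr (op_proj R x) - x).
  by apply/op_projP; rewrite /op_proj lquot_reprK.
by move=> h; apply: (h _ kernel_closed_ideal Rf).
Qed.

Lemma quotient_lift_morphism : is_morphism quotient_lift.
Proof.
split.
- move=> n d a; apply: quotient_ind => x; apply: quotient_ind => y.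
  by rewrite -op_proj_lin !quotient_liftE (mor_linear mf).
- move=> n d k _ [x xk <-]; rewrite quotient_liftE; exact: (mor_filtered mf).
- by rewrite quotient_liftE (mor_id mf).
move=> m n p d e r hp hr i + + im.
apply: quotient_ind => x; apply: quotient_ind => y.
by rewrite op_proj_comp // !quotient_liftE (mor_comp mf).
Qed.

End Kernel.

(** * Homology of complete dg operads *)

Section HomologyOperad.
Variables (K : fieldType) (P : dgoperad K).
Hypothesis cP : is_complete_dgoperad P.

Let bil := cop_bilinear (cdg_operad cP).
Let fil := cop_filtration (cdg_operad cP).

Lemma cycle_diff n d e (h : e + 1 = d) (x : P n d) : is_cycle x -> dg_diff h x = 0.
Proof.
rewrite /is_cycle => /eqP dx.
have e_d : d - 1 = e by rewrite -h addrK.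
case: e / e_d h => h; by rewrite (eq_irrelevance h (subrK 1 d)).
Qed.

Lemma cycleP n d (x : P n d) : (forall e (h : e + 1 = d), dg_diff h x = 0) <-> is_cycle x.
Proof. by split=> [h|cx e h]; [exact/eqP/h|exact: cycle_diff]. Qed.

Lemma boundary_cycle n d (x : P n d) : is_boundary x -> is_cycle x.
Proof. by case=> y <-; apply/cycleP => e h; exact: (cdg_square cP). Qed.

Lemma cycle_lin n d a (x y : P n d) : is_cycle x -> is_cycle y -> is_cycle (a *: x + y).
Proof. by move=> cx cy; apply/cycleP => e h; rewrite linearP !cycle_diff // scaler0 addr0. Qed.

Lemma cycle0 n d : is_cycle (0 : P n d).
Proof. by apply/cycleP => e h; rewrite linear0. Qed.

Lemma cycleB n d (x y : P n d) : is_cycle x -> is_cycle y -> is_cycle (x - y).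
Proof. by move=> cx cy; rewrite -[- y]scaleN1r addrC; exact: cycle_lin. Qed.

Lemma boundary_lin n d a (x y : P n d) :
  is_boundary x -> is_boundary y -> is_boundary (a *: x + y).
Proof. by move=> [x' <-] [y' <-]; exists (a *: x' + y'); rewrite linearP. Qed.

Lemma boundary0 n d : is_boundary (0 : P n d).
Proof. by exists 0; rewrite linear0. Qed.

Lemma val_insubd_cycle n d (x : P n d) : is_cycle x ->
  val (insubd (0 : submodule (cycles P n d)) x) = x.
Proof. by move=> cx; rewrite val_insubd; case: ifP => //; rewrite inE cx. Qed.

Lemma mem_boundaries n d (x : submodule (cycles P n d)) :
  (x \in subspace_pred (boundaries P n d)) <-> is_boundary (val x).
Proof. by split=> [/asboolP|h]; last exact/asboolP. Qed.

Lemma hclassP n d (x y : P n d) : is_cycle x -> is_cycle y ->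
  hclass x = hclass y <-> is_boundary (x - y).
Proof.
by move=> cx cy; rewrite /hclass lquot_piP mem_boundaries linearB /= !val_insubd_cycle.
Qed.

Lemma hclass_lin n d a (x y : P n d) : is_cycle x -> is_cycle y ->
  hclass (a *: x + y) = a *: hclass x + hclass y.
Proof.
move=> cx cy; rewrite /hclass -lquot_pi_lin; congr lquot_pi; apply: val_inj.
by rewrite linearP /= !val_insubd_cycle // cycle_lin.
Qed.

Lemma hclass0 n d : hclass (0 : P n d) = 0.
Proof.
apply/lquot_pi_eq0/mem_boundaries; rewrite val_insubd_cycle ?cycle0 //.
exact: boundary0.
Qed.

Lemma hclass_eq0 n d (x : P n d) : is_cycle x -> hclass x = 0 <-> is_boundary x.
Proof. by move=> cx; rewrite -hclass0 hclassP ?subr0 // cycle0. Qed.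

Lemma hclassB n d (x y : P n d) : is_cycle x -> is_cycle y ->
  hclass (x - y) = hclass x - hclass y.
Proof.
by move=> cx cy; rewrite -[- y]scaleN1r addrC hclass_lin // scaleN1r addrC.
Qed.

Lemma hrepr_cycle n d (h : homology P n d) : is_cycle (hrepr h).
Proof. by have := valP (lquot_repr h); rewrite inE. Qed.

Lemma hreprK n d (h : homology P n d) : hclass (hrepr h) = h.
Proof.
rewrite -[RHS]lquot_reprK /hclass; congr lquot_pi; apply: val_inj.
by rewrite val_insubd_cycle // hrepr_cycle.
Qed.

Lemma homology_ind n d (T : homology P n d -> Prop) :
  (forall x, is_cycle x -> T (hclass x)) -> forall h, T h.
Proof. by move=> Tx h; rewrite -[h]hreprK; apply: Tx; exact: hrepr_cycle. Qed.

Section Composition.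
Variables (m n p : nat) (d e f : int) (hp : (m + n = p.+1)%N) (hf : d + e = f).
Variable i : nat.
Hypothesis im : (i < m)%N.
Implicit Types (x : P m d) (y : P n e).

Lemma comp_cycle x y : is_cycle x -> is_cycle y -> is_cycle (op_comp hp hf i x y).
Proof.
move=> cx cy; apply/eqP.
have hf2 : d - 1 + e = f - 1 by rewrite -hf; ring.
have hf3 : d + (e - 1) = f - 1 by rewrite -hf; ring.
rewrite (cdg_derivation cP _ _ (subrK 1 d) (subrK 1 e) _ hf2 hf3) //.
by rewrite !cycle_diff // comp0l // comp0r // scaler0 addr0.
Qed.

Lemma comp_boundaryl x y : is_boundary x -> is_cycle y -> is_boundary (op_comp hp hf i x y).
Proof.
move=> [x' <-] cy.
have hf1 : d + 1 + e = f + 1 by rewrite -hf; ring.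
have hf3 : d + 1 + (e - 1) = f by rewrite -hf; ring.
exists (op_comp hp hf1 i x' y).
rewrite (cdg_derivation cP _ _ (erefl (d + 1)) (subrK 1 e) _ hf hf3) //.
by rewrite (cycle_diff _ cy) // comp0r // scaler0 addr0.
Qed.

Lemma comp_boundaryr x y : is_cycle x -> is_boundary y -> is_boundary (op_comp hp hf i x y).
Proof.
move=> cx [y' <-].
have hf1 : d + (e + 1) = f + 1 by rewrite -hf; ring.
have hf2 : d - 1 + (e + 1) = f by rewrite -hf; ring.
exists ((-1) ^+ `|d|%N *: op_comp hp hf1 i x y').
rewrite linearZ /= (cdg_derivation cP _ _ (subrK 1 d) (erefl (e + 1)) _ hf2 hf) //.
rewrite (cycle_diff _ cx) // comp0l // add0r scalerA -exprD addnn.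
by rewrite -muln2 exprM sqrr_sign scale1r.
Qed.

Lemma hclass_comp x y : is_cycle x -> is_cycle y ->
  op_comp hp hf i (hclass x : homology P m d) (hclass y : homology P n e)
    = hclass (op_comp hp hf i x y).
Proof.
move=> cx cy; set h := hclass x; set h' := hclass y.
have cx' := hrepr_cycle h; have cy' := hrepr_cycle h'.
apply/hclassP; [exact: comp_cycle|exact: comp_cycle|].
have -> : op_comp hp hf i (hrepr h) (hrepr h') - op_comp hp hf i x y
   = 1 *: op_comp hp hf i (hrepr h - x) (hrepr h') + op_comp hp hf i x (hrepr h' - y).
  by rewrite scale1r compBl // compBr // addrA subrK.
have bx : is_boundary (hrepr h - x) by apply/hclassP; rewrite ?hreprK.
have b_y : is_boundary (hrepr h' - y) by apply/hclassP; rewrite ?hreprK.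
by apply: boundary_lin; [exact: comp_boundaryl|exact: comp_boundaryr].
Qed.

End Composition.

(** The derivation rule gives d(id) = d(id) + d(id) for id o id = id. *)
Lemma id_cycle : is_cycle (op_id P).
Proof.
apply/eqP; set di := dg_diff _ _.
have hf2 : 0 - 1 + 0 = 0 - 1 :> int by [].
have hf3 : 0 + (0 - 1) = 0 - 1 :> int by [].
have [ul _] := cop_unital (cdg_operad cP) (op_id P).
have [ul1 _] := cop_unital (cdg_operad cP) di.
have [_ ur] := cop_unital (cdg_operad cP) di.
have := cdg_derivation cP (erefl 2%N : (1 + 1 = 2)%N) (add0r 0) (subrK 1 0) (subrK 1 0) (subrK 1 0)
   hf2 hf3 (op_id P) (op_id P) (ltn0Sn 0).
rewrite ul ur // ul1 expr0 scale1r -/di => h.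
by apply: (addrI di); rewrite addr0 -h.
Qed.

(** The boundaries need not be closed for the topology of the filtration; when
    they are, the filtration of the homology is separated. *)
Hypothesis closed_boundaries : forall n d (x : P n d), is_cycle x ->
  (forall k, exists2 y, is_boundary y & op_fil k (x - y)) -> is_boundary x.

(** The limit of the lifted Cauchy sequence of cycles is a cycle since the
    differential preserves the filtration and the operad is separated. *)
Lemma homology_filtration : complete_filtration (homology P).
Proof.
move=> n d; split=> [q|k q [x [cx xk] <-]|k|q h|u h].
- move: q; apply: homology_ind => x cx; exists x => //; split=> //; exact: fil_top.
- exists x => //; split=> //; exact: filS xk.
- split; first by exists 0; [split; [exact: cycle0|exact: fil0]|exact: hclass0].
  move=> a _ _ [x [cx xk] <-] [y [cy yk] <-]; exists (a *: x + y).
    by split; [exact: cycle_lin|exact: fil_lin].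
  exact: hclass_lin.
- move: q h; apply: homology_ind => x cx h; apply/hclass_eq0 => //.
  apply: closed_boundaries => // k; have [y [cy yk] /esym/hclassP xy] := h k.
  by exists (x - y); [exact: xy|rewrite subKr].
have /choice[v hv] : forall k, exists v : P n d,
    [/\ is_cycle v, op_fil k v & hclass v = u k.+1 - u k].
  by move=> k; have [v [cv vk] e] := h k; exists v.
pose w := fix w k := if k is j.+1 then w j + v j else hrepr (u 0%N).
have cw k : is_cycle (w k).
  elim: k => [|k IH] /=; first exact: hrepr_cycle.
  by have [cv _ _] := hv k; rewrite -[w k]scale1r; exact: cycle_lin.
have hw k : hclass (w k) = u k.
  elim: k => [|k IH] /=; first exact: hreprK.
  have [cv _ e] := hv k; rewrite -[w k]scale1r hclass_lin // scale1r IH e.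
  by rewrite addrC subrK.
have [l hl] : exists l, forall k, op_fil k (l - w k).
  by apply: fil_limit => // k; rewrite /= addrC addKr; have [] := hv k.
have cl : is_cycle l.
  apply/cycleP => e he; apply: (fil_separated fil) => k.
  have -> : dg_diff he l = dg_diff he (l - w k).
    by rewrite linearB /= (cycle_diff he (cw k)) subr0.
  exact: (cdg_filtered cP).
exists (hclass l) => k; exists (l - w k); first by split=> //; exact: cycleB.
by rewrite hclassB // hw.
Qed.

Theorem homology_complete : is_complete_operad (homology P).
Proof.
split; first exact: homology_filtration.
- move=> m n p d e f hp hf i a + + + + im.
  do 4!(apply: homology_ind => ? ?).
  split; rewrite -hclass_lin // !hclass_comp // -?hclass_lin ?comp_cycle ?cycle_lin //.
    by rewrite comp_linl.
  by rewrite comp_linr.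
- move=> m n p d e f hp hf i _ _ k l im [x [cx xk] <-] [y [cy yl] <-].
  rewrite hclass_comp //; exists (op_comp hp hf i x y) => //; split.
    exact: comp_cycle.
  exact: (cop_filtered (cdg_operad cP)).
- move=> n d; apply: homology_ind => x cx.
  have [ul ur] := cop_unital (cdg_operad cP) x; split.
    by move=> hp hf; rewrite hclass_comp ?id_cycle // ul.
  by move=> hp hf i im; rewrite hclass_comp ?id_cycle // ur.
- move=> l m n p q r a b c ab bc abc hp hq hr hq' hab habc hbc habc' i j + + + il jm.
  do 3!(apply: homology_ind => ? ?).
  rewrite !hclass_comp ?comp_cycle //; try lia.
  by rewrite (cop_sequential (cdg_operad cP) hp hq hr hq' hab habc hbc habc').
move=> l m n p q r a b c ab ac abc hp hq hr hq' hab habc hac habc' i j + + + ij jl.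
have il := ltn_trans ij jl.
do 3!(apply: homology_ind => ? ?).
rewrite !hclass_comp ?comp_cycle //; try lia.
rewrite (cop_parallel (cdg_operad cP) hp hq hr hq' hab habc hac habc') //.
set z := op_comp hq' habc' _ _ _.
rewrite -[_ *: z]addr0 hclass_lin ?cycle0 ?hclass0 ?addr0 //.
by apply: comp_cycle; rewrite ?comp_cycle //; lia.
Qed.

Lemma hclass_morphism (A : operad K) (f : forall n d, A n d -> P n d) :
  is_morphism f -> (forall n d (x : A n d), is_cycle (f n d x)) ->
  @is_morphism K A (homology P) (fun n d x => hclass (f n d x)).
Proof.
move=> mf cf; split.
- by move=> n d a x y; rewrite (mor_linear mf) hclass_lin.
- move=> n d k x xk; exists (f n d x) => //; split=> //; exact: (mor_filtered mf).
- by rewrite (mor_id mf).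
by move=> m n p d e r hp hr i x y im; rewrite (mor_comp mf) // hclass_comp.
Qed.

End HomologyOperad.

(** * The operad of trees *)

Section Trees.
Implicit Types t s u l r : tree.

Fixpoint leaves t : nat :=
  if t is Node l r then (leaves l + leaves r)%N else 1%N.

(** A tree has at least as many leaves as levels, so that the trees with at most
   [N] leaves are found among those with at most [N] levels. *)
Fixpoint trees_of_height (h : nat) : seq tree :=
  if h is h'.+1 then
    [:: Input; Gamma; Zeta]
      ++ [seq Node l r | l <- trees_of_height h', r <- trees_of_height h']
  else [::].

Definition tree_list N : seq tree :=
  undup [seq t <- trees_of_height N | (leaves t <= N)%N].

Lemma leaves_gt0 t : (0 < leaves t)%N.
Proof. by elim: t => //= l hl r hr; rewrite addn_gt0 hl. Qed.

Lemma mem_trees_of_height h t : (leaves t <= h)%N -> t \in trees_of_height h.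
Proof.
elim: t h => [||| l IHl r IHr] [|h] //=.
  by have := leaves_gt0 l; lia.
move=> lrh; rewrite !inE; apply/orP; right; apply/orP; right; apply/orP; right.
have := leaves_gt0 l; have := leaves_gt0 r => r0 l0.
by apply/allpairsP; exists (l, r); split=> //; [apply: IHl|apply: IHr]; lia.
Qed.

Lemma mem_tree_list N t : (t \in tree_list N) = (leaves t <= N)%N.
Proof.
rewrite mem_undup mem_filter; apply: andb_idr; exact: mem_trees_of_height.
Qed.

Lemma inputs_graft t i s : (i < inputs t)%N ->
  (inputs (graft t i s)).+1 = (inputs t + inputs s)%N.
Proof.
elim: t i => [|||l IHl r IHr] i //= ilr; case: ltnP => il /=.
  by rewrite -addSn IHl // addnAC.
by rewrite -addnS IHr ?ltn_subLR // addnA.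
Qed.

Lemma leaves_graft t i s : (i < inputs t)%N ->
  (leaves (graft t i s)).+1 = (leaves t + leaves s)%N.
Proof.
elim: t i => [|||l IHl r IHr] i //= ilr; case: ltnP => il /=.
  by rewrite -addSn IHl // addnAC.
by rewrite -addnS IHr ?ltn_subLR // addnA.
Qed.

Lemma degree_graft t i s : (i < inputs t)%N ->
  tree_degree (graft t i s) = tree_degree t + tree_degree s.
Proof.
elim: t i => [|||l IHl r IHr] i //=; first by rewrite add0r.
move=> ilr; case: ltnP => il /=.
  by rewrite IHl // -!addrA [_ + tree_degree s]addrC.
by rewrite IHr ?ltn_subLR // !addrA.
Qed.

Lemma weight_graft w t i s : (i < inputs t)%N ->
  tree_weight w (graft t i s) = (tree_weight w t + tree_weight w s)%N.
Proof.
elim: t i => [|||l IHl r IHr] i //= ilr; case: ltnP => il /=.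
  by rewrite IHl // addnAC.
by rewrite IHr ?ltn_subLR // addnA.
Qed.

Lemma odd_generators_graft t i s : (i < inputs t)%N ->
  odd_generators (graft t i s) = (odd_generators t + odd_generators s)%N.
Proof.
elim: t i => [|||l IHl r IHr] i //= ilr; case: ltnP => il /=.
  by rewrite IHl // addSn addnAC.
by rewrite IHr ?ltn_subLR // addSn addnA.
Qed.

Lemma graft_input t i : graft t i Input = t.
Proof. by elim: t i => //= l IHl r IHr i; case: ltnP; rewrite ?IHl ?IHr. Qed.

Lemma graft_sequential t i s j u : (i < inputs t)%N -> (j < inputs s)%N ->
  graft (graft t i s) (i + j) u = graft t i (graft s j u).
Proof.
elim: t i => [|||l IHl r IHr] i //=.
  by rewrite ltnS leqn0 => /eqP ->.
move=> ilr js; have [il|il] := ltnP i (inputs l) => /=.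
  have := inputs_graft s il => e.
  by rewrite ifT ?IHl //; lia.
rewrite ifF; last by lia.
by rewrite -addnBAC // IHr ?ltn_subLR.
Qed.

Lemma graft_parallel t i s j u : (i < j)%N -> (j < inputs t)%N ->
  graft (graft t i s) (j + inputs s).-1 u = graft (graft t j u) i s.
Proof.
elim: t i j => [|||l IHl r IHr] i j //=; first by lia.
move=> ij jlr; have [jl|jl] := ltnP j (inputs l) => /=.
  have il := ltn_trans ij jl; rewrite il /=.
  have := inputs_graft s il; have := inputs_graft u jl => e e'.
  by rewrite !ifT ?IHl //; lia.
have [il|il] := ltnP i (inputs l) => /=.
  have := inputs_graft s il => e.
  by rewrite ifF; [congr (Node _ (graft _ _ _)); lia|lia].
rewrite ifF; last by lia.
have h1 : (i - inputs l < j - inputs l)%N by lia.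
have h2 : (j - inputs l < inputs r)%N by lia.
rewrite -IHr //.
by congr (Node _ (graft _ _ _)); lia.
Qed.

(** The next three lemmas compute the generators crossed in an iterated grafting;
    in the parallel case, grafting on the left input second crosses the generators
    grafted first, which gives the sign of the parallel axiom. *)
Lemma after_sequential t i s j : (i < inputs t)%N -> (j < inputs s)%N ->
  odd_generators_after (graft t i s) (i + j)
    = (odd_generators_after s j + odd_generators_after t i)%N.
Proof.
elim: t i => [|||l IHl r IHr] i //=.
  by rewrite ltnS leqn0 => /eqP -> _; rewrite addn0.
move=> ilr js; have [il|il] := ltnP i (inputs l) => /=.
  have := inputs_graft s il => e.
  by rewrite ifT ?IHl ?addnA //; lia.
rewrite ifF; last by lia.
by rewrite -addnBAC // IHr ?ltn_subLR.
Qed.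

Lemma after_parallel_right t i s j : (i < j)%N -> (j < inputs t)%N ->
  odd_generators_after (graft t i s) (j + inputs s).-1 = odd_generators_after t j.
Proof.
elim: t i j => [|||l IHl r IHr] i j //=; first by lia.
move=> ij jlr; have [jl|jl] := ltnP j (inputs l) => /=.
  have il := ltn_trans ij jl; rewrite il /=.
  have := inputs_graft s il => e.
  by rewrite !ifT ?IHl //; lia.
have [il|il] := ltnP i (inputs l) => /=.
  have := inputs_graft s il => e.
  by rewrite ifF; [congr odd_generators_after; lia|lia].
rewrite ifF; last by lia.
have h1 : (i - inputs l < j - inputs l)%N by lia.
have h2 : (j - inputs l < inputs r)%N by lia.
rewrite -(IHr (i - inputs l)%N) //.
by congr odd_generators_after; lia.
Qed.

Lemma after_parallel_left t i j u : (i < j)%N -> (j < inputs t)%N ->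
  odd_generators_after (graft t j u) i
    = (odd_generators_after t i + odd_generators u)%N.
Proof.
elim: t i j => [|||l IHl r IHr] i j //=; first by lia.
move=> ij jlr; have [jl|jl] := ltnP j (inputs l) => /=.
  have il := ltn_trans ij jl; rewrite il /=.
  have := inputs_graft u jl => e.
  rewrite ifT; last by lia.
  by rewrite (IHl i j) // addnAC.
have [il|il] := ltnP i (inputs l) => /=.
  by rewrite odd_generators_graft ?addnA ?ltn_subLR.
by rewrite IHr //; lia.
Qed.

Lemma odd_tree_degree t : odd `|tree_degree t|%N = odd (odd_generators t).
Proof. elim: t => //= l IHl r IHr; lia. Qed.

End Trees.

Section TreeOperad.
Variables (K : fieldType) (w : nat).

Lemma tree_coef_supp i t s u : tree_coef K i t s u != 0 ->
  (i < inputs t)%N /\ u = graft t i s.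
Proof. by rewrite /tree_coef; case: ifP => [/andP[-> /eqP]|]; rewrite ?eqxx. Qed.

Lemma tree_coef_graft i t s : (i < inputs t)%N ->
  tree_coef K i t s (graft t i s)
    = (-1) ^+ (odd_generators_after t i * odd_generators s)%N.
Proof. by rewrite /tree_coef eqxx => ->. Qed.

Lemma sum_tree_coef (L : seq tree) i t s (F : tree -> K) : uniq L ->
  (i < inputs t)%N -> (graft t i s \notin L -> F (graft t i s) = 0) ->
  \sum_(u <- L) tree_coef K i t s u * F u
    = (-1) ^+ (odd_generators_after t i * odd_generators s)%N * F (graft t i s).
Proof.
move=> uL it h; rewrite -(tree_coef_graft s it).
have [gL|/[dup] gL /h ->] := boolP (graft t i s \in L).
  rewrite (bigD1_seq (graft t i s)) //= big1 ?addr0 // => u.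
  by rewrite /tree_coef => /negbTE->; rewrite andbF mul0r.
rewrite mulr0 big_seq big1 // => u uL'.
have [->|/tree_coef_supp[_ uE]] := eqVneq (tree_coef K i t s u) 0.
  by rewrite mul0r.
by rewrite uE (negbTE gL) in uL'.
Qed.

Lemma tree_structure : structure_constants inputs tree_degree (tree_weight w)
  Input (@tree_coef K) leaves tree_list.
Proof.
split.
- by move=> N; exact: undup_uniq.
- exact: mem_tree_list.
- move=> i x y z /tree_coef_supp[ix ->].
  have := leaves_graft y ix; have := leaves_gt0 x; have := leaves_gt0 y => x0 y0 e.
  split=> //.
  + by rewrite -(inputs_graft y ix).
  + by rewrite degree_graft.
  + by rewrite weight_graft.
  + by apply/andP; split; lia.
- by [].
- by move=> y z; rewrite /tree_coef /= mul0n expr0 eq_sym; case: eqP.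
- move=> i x z ix; rewrite /tree_coef ix graft_input muln0 expr0 eq_sym.
  by case: eqP.
- move=> i j a b c z N ia jb zN.
  have large (t : tree) k s : (k < inputs t)%N -> tree_coef K k t s z != 0 ->
      t \in tree_list N /\ s \in tree_list N.
    move=> kt /tree_coef_supp[_ zE]; rewrite !mem_tree_list.
    have := leaves_graft s kt; rewrite -zE => e.
    have := leaves_gt0 t; have := leaves_gt0 s; lia.
  rewrite !sum_tree_coef ?undup_uniq //; first last.
  + move=> nL; have [//|/large h] := eqVneq (tree_coef K (i + j) (graft a i b) c z) 0.
    have ij : (i + j < inputs (graft a i b))%N by have := inputs_graft b ia; lia.
    by have [h' _] := h ij; rewrite h' in nL.
  + move=> nL; have [//|/large h] := eqVneq (tree_coef K i a (graft b j c) z) 0.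
    by have [_ h'] := h ia; rewrite h' in nL.
  rewrite /tree_coef ia graft_sequential // after_sequential // odd_generators_graft //.
  have -> : (i + j < inputs (graft a i b))%N by have := inputs_graft b ia; lia.
  case: eqP => //= _; rewrite ?mulr0 // -!exprD; congr (_ ^+ _); lia.
- move=> i j a b c z N ij ja zN.
  have ia := ltn_trans ij ja.
  have large (t : tree) k s : (k < inputs t)%N -> tree_coef K k t s z != 0 ->
      t \in tree_list N /\ s \in tree_list N.
    move=> kt /tree_coef_supp[_ zE]; rewrite !mem_tree_list.
    have := leaves_graft s kt; rewrite -zE => e.
    have := leaves_gt0 t; have := leaves_gt0 s; lia.
  have h1 : ((j + inputs b).-1 < inputs (graft a i b))%N.
    by have := inputs_graft b ia; lia.
  have h2 : (i < inputs (graft a j c))%N by have := inputs_graft c ja; lia.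
  rewrite !sum_tree_coef ?undup_uniq //; first last.
  + move=> nL; have [//|/large h] := eqVneq (tree_coef K (j + inputs b).-1 (graft a i b) c z) 0.
    by have [h' _] := h h1; rewrite h' in nL.
  + move=> nL; have [//|/large h] := eqVneq (tree_coef K i (graft a j c) b z) 0.
    by have [h' _] := h h2; rewrite h' in nL.
  rewrite /tree_coef h1 h2 graft_parallel // after_parallel_right //.
  rewrite after_parallel_left //; case: eqP => //= _; rewrite ?mulr0 // -!exprD.
  rewrite -signr_odd -[RHS]signr_odd; congr (_ ^+ _); congr nat_of_bool.
  rewrite !oddD !oddM !oddD !odd_tree_degree.
  by case: (odd (odd_generators_after a i)); case: (odd (odd_generators_after a j));
    case: (odd (odd_generators b)); case: (odd (odd_generators c)).
Qed.

End TreeOperad.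

(** * Alternating functions of words *)

Section Alternating.
Variable K : fieldType.

(** Reordering a word of cells produces the sign of the permutation, and a
    repeated cell gives zero.  Taking this as a property of functions of words
    gives an exterior algebra without constructing it; the second condition does
    not follow from the first in characteristic two. *)
Definition alternating (T : Type) (F : seq T -> K) : Prop :=
  (forall r1 a b r2, F (r1 ++ a :: b :: r2) = - F (r1 ++ b :: a :: r2)) /\
  (forall r1 a r2, F (r1 ++ a :: a :: r2) = 0).

Lemma alternating_cons T (F : seq T -> K) a :
  alternating F -> alternating (fun r => F (a :: r)).
Proof.
by move=> [h1 h2]; split=> [r1 b c r2|r1 b r2]; [apply: (h1 (a :: r1))|apply: (h2 (a :: r1))].
Qed.

Lemma alternating_prefix T (F : seq T -> K) s :
  alternating F -> alternating (fun r => F (s ++ r)).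
Proof.
elim: s F => //= a s IH F hF; exact: (IH (fun r => F (a :: r)) (alternating_cons a hF)).
Qed.

Lemma alternating_suffix T (F : seq T -> K) s :
  alternating F -> alternating (fun r => F (r ++ s)).
Proof.
move=> [h1 h2]; split=> [r1 b c r2|r1 b r2]; rewrite -!catA /=.
  exact: h1.
exact: h2.
Qed.

Lemma alternating_map T U (f : U -> T) (F : seq T -> K) :
  alternating F -> alternating (fun r => F (map f r)).
Proof.
by move=> [h1 h2]; split=> [r1 b c r2|r1 b r2]; rewrite !map_cat /=; [apply: h1|apply: h2].
Qed.

Lemma alternating_move T (F : seq T -> K) r1 s a r2 : alternating F ->
  F (r1 ++ s ++ a :: r2) = (-1) ^+ size s * F (r1 ++ a :: s ++ r2).
Proof.
move=> hF; elim: s r1 => [|b s IH] r1 /=; first by rewrite mul1r.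
have := IH (rcons r1 b); rewrite !cat_rcons => ->.
by rewrite hF.1 exprS mulN1r mulrN mulNr.
Qed.

Lemma alternating_swap T (F : seq T -> K) r s t : alternating F ->
  F (r ++ s ++ t) = (-1) ^+ (size s * size t) * F (r ++ t ++ s).
Proof.
move=> hF; elim: t r s => [|a t IH] r s; first by rewrite cats0 muln0 mul1r.
rewrite alternating_move // -cat_rcons IH // mulrA -exprD cat_rcons.
by rewrite mulnS.
Qed.

Lemma swap_invariant (T : eqType) (A : Type) (G : seq T -> A) :
  (forall r1 a b r2, G (r1 ++ a :: b :: r2) = G (r1 ++ b :: a :: r2)) ->
  forall r s, perm_eq r s -> G r = G s.
Proof.
move=> hG r; elim: r G hG => [|a r IH] G hG s.
  by move=> /perm_size /esym/size0nil ->.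
move=> ars; have as_ : a \in s by rewrite -(perm_mem ars) mem_head.
case/splitPr: as_ ars => s1 s2 ars.
have mv t1 : G (t1 ++ s1 ++ a :: s2) = G (t1 ++ a :: s1 ++ s2).
  elim: s1 t1 {ars} => //= b s1 IHs t1.
  by have := IHs (rcons t1 b); rewrite !cat_rcons => ->.
rewrite (mv [::]) /=; apply: (IH (fun r => G (a :: r))) => [r1 b c r2|].
  exact: (hG (a :: r1)).
by rewrite -(perm_cons a) (perm_trans ars) // -cat1s perm_catCA.
Qed.

End Alternating.

Section Inversions.
Implicit Types (r s : seq cell) (c : cell).

Lemma cell_lt_addb c c' : cell_lt c c' (+) cell_lt c' c = (c != c').
Proof.
case: c c' => [i|i] [j|j] //=.
  by case: ltngtP => [ij|ij|->]; rewrite ?eqxx //=; apply/esym/eqP => -[e]; rewrite e ltnn in ij.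
by case: ltngtP => [ij|ij|->]; rewrite ?eqxx //=; apply/esym/eqP => -[e]; rewrite e ltnn in ij.
Qed.

Lemma odd_inversions_swap r s c c' : c != c' ->
  odd (inversions (r ++ c :: c' :: s)) = ~~ odd (inversions (r ++ c' :: c :: s)).
Proof.
move=> cc'; elim: r => [|a r IH] /=.
  have := cell_lt_addb c c'; rewrite cc' !oddD !oddb.
  case: (cell_lt c c'); case: (cell_lt c' c) => //= _;
  by case: (odd (count _ _)); case: (odd (count _ _)); case: (odd (inversions s)).
rewrite !oddD IH !count_cat /= addbN; congr (~~ (odd _ (+) _)); lia.
Qed.

Lemma inversions_sorted r : pairwise cell_lt r -> inversions r = 0%N.
Proof.
elim: r => //= a r IH /andP[/allP ar /IH ->]; rewrite addn0.
apply/eqP; rewrite -leqn0 leqNgt -has_count; apply/hasPn => c /ar.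
have := cell_lt_addb a c; case: eqP => [<-|_].
  by case: (a) => i /=; rewrite ltnn.
by case: (cell_lt a c); case: (cell_lt c a).
Qed.

End Inversions.

Section AlternatingCells.
Variable K : fieldType.
Implicit Types (F : seq cell -> K) (r s : seq cell) (z : bamboo).

(** An alternating function is determined by its values on increasing words. *)
Lemma alternating_perm F r s : alternating F -> perm_eq r s ->
  (-1) ^+ inversions r * F r = (-1) ^+ inversions s * F s.
Proof.
move=> hF; move: r s.
apply: (swap_invariant (G := fun r => (-1) ^+ inversions r * F r)) => r1 a b r2.
have [->//|ab] := eqVneq a b.
rewrite hF.1 -signr_odd odd_inversions_swap // -[in RHS]signr_odd.
by case: odd => /=; rewrite ?expr0 ?expr1 ?mul1r ?mulN1r ?opprK.
Qed.

Lemma alternating_dup F r : alternating F -> ~~ uniq r -> F r = 0.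
Proof.
move=> hF; elim: r F hF => //= a r IH F hF.
rewrite negb_and negbK => /orP[ar|/(IH _ (alternating_cons a hF)) //].
case/splitPr: ar => r1 r2.
have /= -> := alternating_move [:: a] r1 a r2 hF.
by rewrite (hF.2 [::]) mulr0.
Qed.

Lemma uniq_cells z : pairwise cell_lt (cells z) /\ uniq (cells z).
Proof.
have hp : pairwise cell_lt (cells z).
  rewrite /cells pairwise_cat !pairwise_map; apply/and3P; split.
  - by apply/allrelP => _ _ /mapP[i _ ->] /mapP[j _ ->].
  - by rewrite -sorted_pairwise ?sorted_filter ?iota_ltn_sorted //; exact: ltn_trans.
  - by rewrite -sorted_pairwise ?sorted_filter ?iota_ltn_sorted //; exact: ltn_trans.
split=> //; apply: pairwise_uniq hp => -[i|i] /=; exact: ltnn.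
Qed.

Lemma inversions_cells z : inversions (cells z) = 0%N.
Proof. by apply: inversions_sorted; have [] := uniq_cells z. Qed.

Lemma word_coef_alternating z : alternating (fun r => word_coef r z : K).
Proof.
split=> [r1 a b r2|r1 a r2]; rewrite /word_coef; last first.
  case: ifP => // /perm_uniq; have [_ ->] := uniq_cells z.
  by rewrite cat_uniq /= mem_head /= !andbF.
have e : perm_eq (r1 ++ b :: a :: r2) (r1 ++ a :: b :: r2).
  by rewrite perm_cat2l; apply/permPl; exact: (perm_catCA [:: b] [:: a] r2).
rewrite (permPl e).
have [ab|ab] := eqVneq a b.
  subst b; case: ifP => [/perm_uniq|]; rewrite ?oppr0 //.
  have [_ ->] := uniq_cells z.
  by rewrite cat_uniq /= mem_head /= !andbF.
case: ifP => _; rewrite ?oppr0 // -signr_odd odd_inversions_swap //.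
by rewrite -[in RHS]signr_odd; case: odd => /=; rewrite ?expr0 ?expr1 ?opprK.
Qed.

End AlternatingCells.

(** * Products of linear forms and bamboos *)

Section Forms.
Variable K : fieldType.
Implicit Types (F : seq cell -> K) (ss tt : seq (seq cell)) (s : seq cell).

(** The value of the linear extension of [F] on the product of the linear forms
    [ss], each list of cells standing for their sum. *)
Definition form_value F ss : K := \sum_(r <- choices ss) F r.

Definition singles s : seq (seq cell) := [seq [:: c] | c <- s].

Lemma form_value_nil F : form_value F [::] = F [::].
Proof. by rewrite /form_value /= big_seq1. Qed.

Lemma form_value_cons F s ss :
  form_value F (s :: ss) = \sum_(c <- s) form_value (fun r => F (c :: r)) ss.
Proof. by rewrite /form_value /= big_allpairs_dep. Qed.

Lemma eq_form_value F G ss : F =1 G -> form_value F ss = form_value G ss.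
Proof. by move=> FG; apply: eq_bigr => r _. Qed.

Lemma form_valueN F ss : form_value (fun r => - F r) ss = - form_value F ss.
Proof. by rewrite /form_value sumrN. Qed.

Lemma form_value0 ss : form_value (fun=> 0) ss = 0.
Proof. by rewrite /form_value big1. Qed.

Lemma form_value_sum (I : Type) (r : seq I) (F : I -> seq cell -> K) ss :
  form_value (fun q => \sum_(i <- r) F i q) ss = \sum_(i <- r) form_value (F i) ss.
Proof. by rewrite /form_value exchange_big. Qed.

Lemma form_value_cat F ss tt :
  form_value F (ss ++ tt)
    = form_value (fun r => form_value (fun q => F (r ++ q)) tt) ss.
Proof.
elim: ss F => [|s ss IH] F /=; first by rewrite form_value_nil.
by rewrite !form_value_cons; apply: eq_bigr => c _; rewrite IH.
Qed.

Lemma form_value_singles F s : form_value F (singles s) = F s.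
Proof.
elim: s F => [|c s IH] F /=; first by rewrite form_value_nil.
by rewrite form_value_cons big_seq1 IH.
Qed.

Lemma sum_antisymmetric (T : Type) (a : seq T) (G : T -> T -> K) :
  (forall c c', G c c' = - G c' c) -> (forall c, G c c = 0) ->
  \sum_(c <- a) \sum_(c' <- a) G c c' = 0.
Proof.
move=> h1 h2; elim: a => [|b a IH]; first by rewrite big_nil.
rewrite big_cons big_cons h2 add0r.
under [X in _ + X]eq_bigr do rewrite big_cons.
rewrite big_split /= IH addr0 -big_split big1 //= => c _.
by rewrite h1 addNr.
Qed.

(** Products of linear forms anticommute because products of cells do. *)
Lemma form_value_alternating F : alternating F -> alternating (form_value F).
Proof.
move=> hF; split=> [ss a b tt|ss a tt].
  elim: ss F hF => [|s ss IH] F hF /=.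
    rewrite !form_value_cons.
    under eq_bigr do rewrite form_value_cons.
    under [in RHS]eq_bigr do rewrite form_value_cons.
    rewrite exchange_big -sumrN; apply: eq_bigr => c _.
    rewrite -sumrN; apply: eq_bigr => c' _; rewrite -form_valueN.
    by apply: eq_form_value => r; exact: (hF.1 [::]).
  rewrite !form_value_cons -sumrN; apply: eq_bigr => c _.
  by apply: IH; exact: alternating_cons.
elim: ss F hF => [|s ss IH] F hF /=; last first.
  rewrite !form_value_cons big1 // => c _; apply: IH; exact: alternating_cons.
rewrite form_value_cons; under eq_bigr do rewrite form_value_cons.
apply: sum_antisymmetric => [c c'|c].
  by rewrite -form_valueN; apply: eq_form_value => r; exact: (hF.1 [::]).
rewrite -[RHS](form_value0 tt); apply: eq_form_value => r; exact: (hF.2 [::]).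
Qed.

Lemma form_value_substl F (f : cell -> seq cell) ss tt :
  form_value (fun r => form_value F (map f r ++ tt)) ss
    = form_value F ([seq flatten (map f s) | s <- ss] ++ tt).
Proof.
elim: ss F => [|s ss IH] F /=; first by rewrite form_value_nil.
rewrite !form_value_cons big_flatten big_map; apply: eq_bigr => c _.
under eq_form_value do rewrite form_value_cons.
by rewrite form_value_sum; apply: eq_bigr => c' _; rewrite -IH.
Qed.

Lemma form_value_substr F (f : cell -> seq cell) ss tt :
  form_value (fun r => form_value F (tt ++ map f r)) ss
    = form_value F (tt ++ [seq flatten (map f s) | s <- ss]).
Proof.
elim: tt F => [|s tt IH] F.
  rewrite /= -[in RHS](cats0 (map _ ss)) -form_value_substl.
  by under [RHS]eq_form_value do rewrite cats0.
rewrite /= form_value_cons; under eq_form_value do rewrite form_value_cons.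
by rewrite form_value_sum; apply: eq_bigr => c _; rewrite -IH.
Qed.

Lemma form_value_perm F ss tt :
  all2 perm_eq ss tt -> form_value F ss = form_value F tt.
Proof.
elim: ss tt F => [|s ss IH] [|t tt] F //= /andP[st sstt].
rewrite !form_value_cons (perm_big _ st); apply: eq_bigr => c _; exact: IH.
Qed.

Lemma mem_choices r ss : r \in choices ss -> all2 (fun c s => c \in s) r ss.
Proof.
elim: ss r => [|s ss IH] r /=; first by rewrite inE => /eqP->.
by case/allpairsP => -[c q] /= [cs /IH qs ->] /=; rewrite cs.
Qed.

End Forms.

Section Bamboos.
Implicit Types (x y z : bamboo) (cs : seq bool) (r : seq cell).

Definition bamboo_list N : seq bamboo :=
  if N is k.+1 then
    [seq (p.1, val p.2) | p <- enum {: vertex * k.-bseq (bool * vertex)}]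
  else [::].

Lemma uniq_bamboo_list N : uniq (bamboo_list N).
Proof.
case: N => //= k; rewrite map_inj_uniq ?enum_uniq // => -[v s] [v' s'] /= [-> e].
by congr pair; apply: val_inj.
Qed.

Lemma mem_bamboo_list N x : (x \in bamboo_list N) = (nvertices x <= N)%N.
Proof.
case: N => [|k] //=; apply/mapP/idP => [[[v s] _ ->]|h].
  exact: size_bseq.
by case: x h => v s h; exists (v, Bseq (h : (size s <= k)%N)); rewrite ?mem_enum.
Qed.

Definition valid N (c : cell) : bool :=
  match c with inl j => (j.+1 < N)%N | inr j => (j < N)%N end.

Lemma mem_cells x c : (c \in cells x) =
  valid (nvertices x) c
    && match c with inl j => joined x j | inr j => has_tadpole x j end.
Proof.
rewrite mem_cat; case: c => j.
  have -> : (inl j \in [seq tadpole v | v <- iota 0 (nvertices x) & has_tadpole x v]) = false.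
    by apply/mapP => -[].
  rewrite orbF /valid; apply/mapP/idP => [[v + [->]]|/andP[jx h]].
    by rewrite mem_filter mem_iota add0n andbC.
  by exists j => //; rewrite mem_filter h mem_iota.
have -> : (inr j \in [seq edge v | v <- iota 0 (size x.2) & joined x v]) = false.
  by apply/mapP => -[].
rewrite orFb /valid; apply/mapP/idP => [[v + [->]]|/andP[jx h]].
  by rewrite mem_filter mem_iota add0n andbC.
by exists j => //; rewrite mem_filter h mem_iota.
Qed.

Lemma valid_cells x : all (valid (nvertices x)) (cells x).
Proof. by apply/allP => c; rewrite mem_cells => /andP[]. Qed.

Lemma cells_inj x y : colours x = colours y -> cells x =i cells y -> x = y.
Proof.
move=> cxy exy.
have sxy : size x.2 = size y.2.
  by have := congr1 size cxy; rewrite !size_colours => -[].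
have tad j : (j < nvertices x)%N -> has_tadpole x j = has_tadpole y j.
  by move=> jx; have := exy (inr j); rewrite !mem_cells /= /nvertices -sxy -/(nvertices x) jx.
have jnd j : (j < size x.2)%N -> joined x j = joined y j.
  by move=> jx; have := exy (inl j); rewrite !mem_cells /= /nvertices -sxy ltnS jx.
case: x y {exy} cxy sxy tad jnd => [[b t] s] [[b' t'] s'].
rewrite /colours /has_tadpole /joined /nvertices /= => -[-> cs] ss tad jnd.
congr (_, _, _); first exact: (tad 0%N).
have d : bool * vertex := (false, (false, false)).
apply: (@eq_from_nth _ (false, (false, false))) => // j js; have js' := js; rewrite ss in js'.
have := jnd j js; have := tad j.+1 js; have := congr1 (nth false ^~ j) cs.
rewrite /= -!map_comp !(nth_map (false, (false, false))) //=.
by case: (nth _ s j) => [? [? ?]]; case: (nth _ s' j) => [? [? ?]] /= -> -> ->.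
Qed.

(** A bamboo is determined by its colours and by its set of cells. *)
Definition build_bamboo cs r : bamboo :=
  ((nth false cs 0, inr 0%N \in r),
   mkseq (fun j => (inl j \in r, (nth false cs j.+1, inr j.+1 \in r))) (size cs).-1).

Lemma nvertices_build cs r : (0 < size cs)%N -> nvertices (build_bamboo cs r) = size cs.
Proof. by rewrite /nvertices /= size_mkseq => /prednK. Qed.

Lemma colours_build cs r : (0 < size cs)%N -> colours (build_bamboo cs r) = cs.
Proof.
case: cs => // b cs _; rewrite /colours /= -!map_comp; congr cons.
by rewrite -[RHS](mkseq_nth false); apply: eq_map.
Qed.

Lemma mem_cells_build cs r c : (0 < size cs)%N ->
  (c \in cells (build_bamboo cs r)) = valid (size cs) c && (c \in r).
Proof.
move=> cs0; rewrite mem_cells nvertices_build //; case: c => j /=.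
  have [jc|//] := ltnP; rewrite /joined /= -map_comp (nth_map 0%N) ?size_iota ?nth_iota //; lia.
have [jc|//] := ltnP; case: j jc => // j jc.
rewrite /has_tadpole /= -!map_comp (nth_map 0%N) ?size_iota ?nth_iota //; lia.
Qed.

End Bamboos.

Section Expansion.
Variable K : fieldType.
Implicit Types (x y z : bamboo) (cs : seq bool) (r : seq cell) (F : seq cell -> K).

(** Up to sign the bamboo with colours [cs] and cells [r], or zero: this extends
    the basis of bamboos to unordered words with possible repetitions. *)
Definition word_vector cs r z : K := if colours z == cs then word_coef r z else 0.

Lemma word_vector_supp cs r z : word_vector cs r z != 0 ->
  colours z = cs /\ perm_eq r (cells z).
Proof.
rewrite /word_vector /word_coef; case: (colours z =P cs) => [->|]; rewrite ?eqxx //.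
by case: ifP => // _; rewrite eqxx.
Qed.

Lemma word_vector_perm cs r x : colours x = cs -> perm_eq r (cells x) ->
  forall z, word_vector cs r z = (-1) ^+ inversions r * (z == x)%:R.
Proof.
move=> cx rx z; have [->|zx] := eqVneq z x.
  by rewrite /word_vector /word_coef cx eqxx rx mulr1.
rewrite mulr0; apply/eqP; apply: contraNT zx => /word_vector_supp[cz rz].
apply/eqP/cells_inj; first by rewrite cz.
by apply: perm_mem; rewrite perm_sym in rz; exact: perm_trans rx.
Qed.

(** The bamboos spelled by a word form a dual basis: an alternating function of
    the cells is evaluated on a word by expanding that word into bamboos. *)
Lemma sum_word_vector cs r F (L : seq bamboo) : uniq L ->
  (forall z, colours z = cs -> z \in L) -> (0 < size cs)%N ->
  all (valid (size cs)) r -> alternating F ->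
  \sum_(z <- L) word_vector cs r z * F (cells z) = F r.
Proof.
move=> uL csL cs0 vr hF.
have [ur|nur] := boolP (uniq r); last first.
  rewrite (alternating_dup hF nur) big1 // => z _.
  have [->|/word_vector_supp[_ /perm_uniq e]] := eqVneq (word_vector cs r z) 0.
    by rewrite mul0r.
  by rewrite e (uniq_cells z).2 in nur.
pose x := build_bamboo cs r.
have cx : colours x = cs by exact: colours_build.
have rx : perm_eq r (cells x).
  apply: uniq_perm; rewrite ?(uniq_cells x).2 // => c.
  by rewrite mem_cells_build //; case rc: (c \in r); rewrite ?andbF ?andbT ?(allP vr).
rewrite (eq_bigr (fun z => (z == x)%:R * ((-1) ^+ inversions r * F (cells z)))).
  have := alternating_perm hF rx; rewrite inversions_cells expr0 mul1r => h.
  by rewrite sum_delta ?csL // -h mulrA -exprD addnn -muln2 exprM sqrr_sign mul1r.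
by move=> z _; rewrite (word_vector_perm cx rx); ring.
Qed.

End Expansion.

(** * Blowing up the cells of a bamboo *)

Section CellMaps.
Implicit Types (c : cell) (v u k n : nat).

Lemma flatten_map_eq (s : seq cell) (f : cell -> seq cell) (g : cell -> cell) :
  {in s, forall c, f c = [:: g c]} -> flatten (map f s) = map g s.
Proof.
elim: s => //= c s IH h; rewrite h ?mem_head //= IH // => d ds.
by rewrite h // inE ds orbT.
Qed.

Let T a n : seq cell := map tadpole (iota a n).
Let E a n : seq cell := map edge (iota a n).

Lemma tadpoles_cat a n n' : T a (n + n') = T a n ++ T (a + n) n'.
Proof. by rewrite /T iotaD map_cat. Qed.

Lemma edges_cat a n n' : E a (n + n') = E a n ++ E (a + n) n'.
Proof. by rewrite /E iotaD map_cat. Qed.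

Lemma blow_up_tadpole v k : blow_up v k (inr v) = T v k ++ E v k.-1.
Proof. by rewrite /= ltnn. Qed.

Lemma blow_up_tadpoles_before w k a n : (a + n <= w)%N ->
  flatten (map (blow_up w k) (T a n)) = T a n.
Proof.
move=> h; rewrite (@flatten_map_eq _ _ id) ?map_id // => c /mapP[j].
by rewrite mem_iota => hj -> /=; rewrite ifT //; lia.
Qed.

Lemma blow_up_edges_before w k a n : (a + n <= w)%N ->
  flatten (map (blow_up w k) (E a n)) = E a n.
Proof.
move=> h; rewrite (@flatten_map_eq _ _ id) ?map_id // => c /mapP[j].
by rewrite mem_iota => hj -> /=; rewrite ifT //; lia.
Qed.

Lemma blow_up_tadpoles_after w k a n : (w < a)%N ->
  flatten (map (blow_up w k) (T a n)) = T (a + k).-1 n.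
Proof.
move=> h; rewrite (@flatten_map_eq _ _ (fun c => if c is inr j then inr (j + k).-1 else c)).
  rewrite /T -map_comp; elim: n a h => //= n IH a h; rewrite IH //; last by lia.
  by congr (_ :: [seq tadpole _ | _ <- iota _ _]); lia.
move=> c /mapP[j]; rewrite mem_iota => hj -> /=.
by rewrite ifF ?ifT //; lia.
Qed.

Lemma blow_up_edges_after w k a n : (w <= a)%N -> (0 < k)%N ->
  flatten (map (blow_up w k) (E a n)) = E (a + k).-1 n.
Proof.
move=> h k0; rewrite (@flatten_map_eq _ _ (fun c => if c is inl j then inl (j + k).-1 else c)).
  rewrite /E -map_comp; elim: n a h => //= n IH a h; rewrite IH //; last by lia.
  by congr (_ :: [seq edge _ | _ <- iota _ _]); lia.
move=> c /mapP[j]; rewrite mem_iota => hj -> /=.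
by rewrite ifF //; lia.
Qed.

Lemma blow_up_shift v u k c : (0 < k)%N ->
  blow_up (v + u) k (shift_cell v c) = map (shift_cell v) (blow_up u k c).
Proof.
move=> k0; case: c => j.
  rewrite /= ltn_add2l; case: ifP => //= _; congr [:: edge _]; lia.
rewrite /= !ltn_add2l; case: ltngtP => //= uj; first by congr [:: tadpole _]; lia.
by rewrite map_cat !iotaDl -!map_comp.
Qed.

(** Distributing a tadpole over the vertices and edges of a bamboo, then blowing up
    one of these vertices, amounts to distributing it over the larger bamboo: the
    tadpole at the vertex which is blown up accounts for the new places. *)
Lemma blow_up_blow_up v u n k c : (u < n)%N -> (0 < k)%N ->
  perm_eq (flatten (map (blow_up (v + u) k) (blow_up v n c))) (blow_up v (n + k).-1 c).
Proof.
move=> un k0; have [->|cv] := eqVneq c (inr v); last first.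
  suff -> : flatten (map (blow_up (v + u) k) (blow_up v n c)) = blow_up v (n + k).-1 c by [].
  case: c cv => j cv.
    rewrite /=; case: ltnP => jv /=.
      by rewrite ifT //; lia.
    by rewrite ifF; [congr [:: edge _]; lia|lia].
  rewrite /=; case: ltngtP cv => [jv|jv|->] cv /=; last by rewrite eqxx in cv.
    by rewrite ifT //; lia.
  by rewrite ifF ?ifT; [congr [:: tadpole _]; lia|lia|lia].
rewrite !blow_up_tadpole map_cat flatten_cat.
have -> : T v n = T v u ++ [:: inr (v + u)%N] ++ T (v + u + 1) (n - u.+1).
  rewrite -[[:: inr _]]/(T (v + u) 1) -!tadpoles_cat; congr (T v _); lia.
have -> : E v n.-1 = E v u ++ E (v + u) (n - u.+1).
  rewrite -edges_cat; congr (E v _); lia.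
have -> : T v (n + k).-1 = T v u ++ T (v + u) k ++ T (v + u + 1 + k).-1 (n - u.+1).
  rewrite (_ : (v + u + 1 + k).-1 = v + u + k)%N; last by lia.
  rewrite -!tadpoles_cat; congr (T v _); lia.
have -> : E v (n + k).-1.-1 = E v u ++ E (v + u) k.-1 ++ E (v + u + k).-1 (n - u.+1).
  rewrite (_ : (v + u + k).-1 = v + u + k.-1)%N; last by lia.
  rewrite -!edges_cat; congr (E v _); lia.
rewrite !map_cat !flatten_cat blow_up_tadpoles_before // blow_up_edges_before //.
have h1 : (v + u < v + u + 1)%N by rewrite addn1.
rewrite blow_up_tadpoles_after // blow_up_edges_after //.
rewrite [flatten (map _ [:: _])]/= cats0 -/(blow_up _ _ (inr _)) blow_up_tadpole.
apply/permP => P; rewrite !count_cat; lia.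
Qed.

Lemma blow_up_parallel_source v v' n k c : (v < v')%N -> (0 < n)%N -> (0 < k)%N ->
  flatten (map (blow_up (v' + n).-1 k) (blow_up v n c))
    = flatten (map (blow_up v n) (blow_up v' k c)).
Proof.
move=> vv n0 k0; case: c => j.
  rewrite /=; case: (ltnP j v) => jv /=.
    by rewrite !ifT /= ?ifT //; lia.
  case: (ltnP j v') => jv' /=.
    by rewrite ifT /= ?ifF //; lia.
  by rewrite !ifF /=; [congr [:: edge _]; lia|lia|lia].
have [->|jv] := eqVneq j v.
  rewrite blow_up_tadpole [blow_up v' k _]/= vv /= cats0 -/(blow_up _ _ (inr _)).
  rewrite blow_up_tadpole map_cat flatten_cat.
  rewrite blow_up_tadpoles_before ?blow_up_edges_before //; lia.
have [->|jv'] := eqVneq j v'.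
  rewrite blow_up_tadpole [blow_up v n _]/= ltnNge (ltnW vv) /= vv /= cats0.
  rewrite -/(blow_up _ _ (inr _)) blow_up_tadpole map_cat flatten_cat.
  by rewrite blow_up_tadpoles_after ?blow_up_edges_after // ltnW.
rewrite /=; case: (ltngtP j v) jv => // jlv _; case: (ltngtP j v') jv' => //= jlv' _.
- by rewrite !ifT //; lia.
- by lia.
- rewrite ifT; last by lia.
  rewrite ifF; last by lia.
  by rewrite jlv.
rewrite ifF; last by lia.
rewrite ifT; last by lia.
rewrite ifF; last by lia.
by rewrite ifT; [congr [:: tadpole _]; lia|lia].
Qed.

Lemma blow_up_parallel_left v v' n k c : (v < v')%N -> valid n c ->
  blow_up (v' + n).-1 k (shift_cell v c) = [:: shift_cell v c].
Proof. by case: c => j /= vv jn; rewrite ifT //; lia. Qed.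

Lemma blow_up_parallel_right v v' n c : (v < v')%N -> (0 < n)%N ->
  blow_up v n (shift_cell v' c) = [:: shift_cell (v' + n).-1 c].
Proof.
case: c => j /= vv n0; first by rewrite ifF; [congr [:: edge _]; lia|lia].
by rewrite ifF ?ifT; [congr [:: tadpole _]; lia|lia|lia].
Qed.

Lemma shift_shift v u c : shift_cell v (shift_cell u c) = shift_cell (v + u) c.
Proof. by case: c => j /=; rewrite addnA. Qed.

Lemma valid_blow_up v k n c c' : (v < n)%N -> (0 < k)%N -> valid n c ->
  c' \in blow_up v k c -> valid (n + k).-1 c'.
Proof.
move=> vn k0; case: c => j /= jn.
  by case: ifP => jv; rewrite inE => /eqP -> /=; lia.
case: ltngtP => jv; rewrite ?inE.
- by move=> /eqP -> /=; lia.
- by move=> /eqP -> /=; lia.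
rewrite mem_cat => /orP[] /mapP[i]; rewrite mem_iota => hi -> /=; lia.
Qed.

Lemma valid_shift v k n c : (v < n)%N -> valid k c -> valid (n + k).-1 (shift_cell v c).
Proof. by case: c => j /=; lia. Qed.

End CellMaps.

(** * Associativity of the insertion of bamboos *)

Section InsertColours.
Variable T : Type.
Implicit Types a b c : seq T.

Definition substitute v a b : seq T := take v a ++ b ++ drop v.+1 a.

Lemma substitute_cat a1 x a2 b : substitute (size a1) (a1 ++ x :: a2) b = a1 ++ b ++ a2.
Proof. by rewrite /substitute take_size_cat // -cat_rcons -(size_rcons a1 x) drop_size_cat. Qed.

Lemma split_nth v a : (v < size a)%N -> exists a1 x a2, a = a1 ++ x :: a2 /\ v = size a1.
Proof.
elim: a v => // x a IH [|v] /= h; first by exists [::], x, a.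
by have [a1 [y [a2 [-> ->]]]] := IH v h; exists (x :: a1), y, a2.
Qed.

Lemma size_substitute v a b : (v < size a)%N ->
  size (substitute v a b) = (size a + size b).-1.
Proof.
move=> /split_nth[a1 [x [a2 [-> ->]]]]; rewrite substitute_cat !size_cat /=; lia.
Qed.

Lemma substitute_sequential v u a b c : (v < size a)%N -> (u < size b)%N ->
  substitute (v + u) (substitute v a b) c = substitute v a (substitute u b c).
Proof.
move=> /split_nth[a1 [x [a2 [-> ->]]]] /split_nth[b1 [y [b2 [-> ->]]]].
rewrite !substitute_cat -!catA cat_cons [a1 ++ b1 ++ _]catA -size_cat.
by rewrite substitute_cat -!catA.
Qed.

Lemma substitute_parallel v v' a b c : (v < v')%N -> (v' < size a)%N ->
  substitute (v' + size b).-1 (substitute v a b) c = substitute v (substitute v' a c) b.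
Proof.
move=> vv' va; have [a1 [x [a2 [ea ev]]]] := split_nth (ltn_trans vv' va).
have h : (v' - v.+1 < size a2)%N by move: va; rewrite ea size_cat /= -ev; lia.
have [a3 [y [a4 [ea2 ev2]]]] := split_nth h.
have -> : v' = size (a1 ++ x :: a3) by rewrite size_cat /=; lia.
rewrite ea ea2 ev substitute_cat -[_ :: a3 ++ _]cat_cons [a1 ++ (_ :: a3) ++ _]catA.
rewrite substitute_cat [a1 ++ b ++ _]catA [(a1 ++ b) ++ a3 ++ _]catA.
have -> : ((size (a1 ++ x :: a3) + size b).-1 = size ((a1 ++ b) ++ a3))%N.
  by rewrite !size_cat /=; lia.
by rewrite substitute_cat -!catA /= substitute_cat.
Qed.

End InsertColours.

Lemma all2_map (A B : Type) (f g : A -> B) (R : rel B) (s : seq A) :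
  all (fun a => R (f a) (g a)) s -> all2 R (map f s) (map g s).
Proof. by elim: s => //= a s IH /andP[-> /IH]. Qed.

Lemma all2_cat (B : Type) (R : rel B) (s t s' t' : seq B) :
  all2 R s t -> all2 R s' t' -> all2 R (s ++ s') (t ++ t').
Proof. by elim: s t => [|b s IH] [|c t] //= /andP[-> /IH h] /h ->. Qed.

Section Insertion.
Variable K : fieldType.
Implicit Types (x y z c p : bamboo) (cs : seq bool) (r : seq cell).

Local Notation ins := (@insertion K).

Lemma insertion_coloursE v x y :
  insertion_colours v x y = substitute v (colours x) (colours y).
Proof. by []. Qed.

(** In the exterior algebra on the cells, inserting [y] at [v] multiplies the
    linear forms in which the cells of [x] are blown up with the cells of [y]. *)
Definition insertion_forms v x y : seq (seq cell) :=
  map (blow_up v (nvertices y)) (cells x) ++ singles (map (shift_cell v) (cells y)).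

Lemma sum_insertion_words v x y (F : seq cell -> K) :
  \sum_(r <- insertion_words v x y) F r = form_value F (insertion_forms v x y).
Proof.
rewrite form_value_cat /insertion_words big_map; apply: eq_bigr => r _.
by rewrite form_value_singles.
Qed.

Lemma insertionE v x y z : ins v x y z =
  if colours z == insertion_colours v x y
  then form_value (fun r => word_coef r z) (insertion_forms v x y) else 0.
Proof. by rewrite /insertion sum_insertion_words. Qed.

Lemma insertion_supp v x y z : ins v x y z != 0 ->
  colours z = insertion_colours v x y /\
  exists2 r, r \in insertion_words v x y & perm_eq r (cells z).
Proof.
rewrite /insertion; case: (colours z =P _) => [-> h|]; last by rewrite eqxx.
split=> //; apply/hasP; apply: contraNT h => /hasPn h.
rewrite big_seq big1 // => r /h; rewrite /word_coef => /negbTE -> //.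
Qed.

Lemma insertion_nvertices v x y z : (v < nvertices x)%N -> ins v x y z != 0 ->
  nvertices z = (nvertices x + nvertices y).-1.
Proof.
move=> vx /insertion_supp[cz _]; rewrite -!size_colours cz size_substitute ?size_colours //.
Qed.

Lemma insertion_size_cells v x y z : ins v x y z != 0 ->
  size (cells z) = (size (cells x) + size (cells y))%N.
Proof.
move=> /insertion_supp[_ [r + /perm_size <-]].
case/mapP => q /mem_choices h ->; rewrite size_cat size_map.
by congr addn; move: h; elim: (cells x) q => [|a s IH] [|b q] //= /andP[_ /IH ->].
Qed.

Lemma insertion_words_valid v x y r : (v < nvertices x)%N ->
  r \in insertion_words v x y -> all (valid (nvertices x + nvertices y).-1) r.
Proof.
move=> vx /mapP[q /mem_choices h ->]; rewrite all_cat; apply/andP; split.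
  have := valid_cells x; move: h.
  elim: (cells x) q => [|a s IH] [|b q] //= /andP[ba /IH h] /andP[va /h ->].
  by rewrite (valid_blow_up vx _ va ba).
rewrite all_map; apply/allP => c cy; apply: valid_shift => //.
exact: (allP (valid_cells y)).
Qed.

(** Evaluating on the bamboos of an insertion is evaluating on its product of
    linear forms; this turns iterated insertions into substitutions of forms. *)
Lemma insertion_expand v x y N (G : seq bool -> seq cell -> K) :
  (v < nvertices x)%N -> ((nvertices x + nvertices y).-1 <= N)%N ->
  alternating (G (insertion_colours v x y)) ->
  \sum_(p <- bamboo_list N) ins v x y p * G (colours p) (cells p)
    = form_value (G (insertion_colours v x y)) (insertion_forms v x y).
Proof.
move=> vx nN hG; set cs := insertion_colours v x y in hG *.
have scs : size cs = (nvertices x + nvertices y).-1.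
  by rewrite size_substitute ?size_colours.
transitivity (\sum_(p <- bamboo_list N) \sum_(r <- insertion_words v x y)
    word_vector K cs r p * G cs (cells p)).
  apply: eq_bigr => p _; rewrite -mulr_suml.
  have [cp|cp] := eqVneq (colours p) cs.
    by rewrite cp; congr (_ * _); rewrite /insertion /word_vector cp eqxx.
  rewrite /insertion (negbTE cp) mul0r big1 ?mul0r // => r _.
  by rewrite /word_vector (negbTE cp).
rewrite exchange_big -sum_insertion_words big_seq [RHS]big_seq.
apply: eq_bigr => r rw; apply: sum_word_vector => //.
- exact: uniq_bamboo_list.
- by move=> z cz; rewrite mem_bamboo_list -size_colours cz scs.
- by rewrite scs /nvertices addSn addnS.
rewrite scs; exact: (insertion_words_valid vx rw).
Qed.

Lemma insertion_then_left v v' x y c z N :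
  (v < nvertices x)%N -> ((nvertices x + nvertices y).-1 <= N)%N ->
  \sum_(p <- bamboo_list N) ins v x y p * ins v' p c z
   = if colours z == substitute v' (insertion_colours v x y) (colours c)
     then form_value (fun r => word_coef r z)
       ([seq flatten (map (blow_up v' (nvertices c)) s) | s <- insertion_forms v x y]
          ++ singles (map (shift_cell v') (cells c)))
     else 0.
Proof.
move=> vx nN.
pose G cs r := if colours z == substitute v' cs (colours c) then
  form_value (fun q => word_coef q z : K)
    (map (blow_up v' (nvertices c)) r ++ singles (map (shift_cell v') (cells c))) else 0.
rewrite (eq_bigr (fun p => ins v x y p * G (colours p) (cells p))); last first.
  by move=> p _; congr (_ * _); rewrite insertionE.
rewrite insertion_expand //; last first.
  rewrite /G; case: (colours z == _); last by split=> *; rewrite ?oppr0.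
  apply: (@alternating_map K _ _ _ (fun ss => form_value _ (ss ++ _))).
  apply: alternating_suffix; apply: form_value_alternating; exact: word_coef_alternating.
rewrite /G; case: (colours z == _); last exact: form_value0.
exact: form_value_substl.
Qed.

Lemma insertion_then_right v u x y c z N :
  (u < nvertices y)%N -> ((nvertices y + nvertices c).-1 <= N)%N ->
  \sum_(p <- bamboo_list N) ins u y c p * ins v x p z
   = if colours z == substitute v (colours x) (insertion_colours u y c)
     then form_value (fun r => word_coef r z)
       (map (blow_up v (nvertices y + nvertices c).-1) (cells x) ++
        [seq flatten [seq [:: shift_cell v d] | d <- s] | s <- insertion_forms u y c])
     else 0.
Proof.
move=> uy nN.
pose G cs r := if colours z == substitute v (colours x) cs then
  form_value (fun q => word_coef q z : K)
    (map (blow_up v (size cs)) (cells x) ++ map (fun d => [:: shift_cell v d]) r) else 0.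
rewrite (eq_bigr (fun p => ins u y c p * G (colours p) (cells p))); last first.
  by move=> p _; congr (_ * _); rewrite insertionE /G size_colours /insertion_forms /singles -map_comp.
rewrite insertion_expand //; last first.
  rewrite /G; case: (colours z == _); last by split=> *; rewrite ?oppr0.
  apply: (@alternating_map K _ _ _ (fun ss => form_value _ (_ ++ ss))).
  apply: alternating_prefix; apply: form_value_alternating; exact: word_coef_alternating.
rewrite /G; case: (colours z == _); last exact: form_value0.
by rewrite form_value_substr size_substitute ?size_colours.
Qed.

(** Both sides are the same product of linear forms, up to the order of the terms
    of each form. *)
Theorem insertion_sequential v u x y c z N :
  (v < nvertices x)%N -> (u < nvertices y)%N -> (nvertices z <= N)%N ->
  \sum_(p <- bamboo_list N) ins v x y p * ins (v + u) p c z
    = \sum_(p <- bamboo_list N) ins u y c p * ins v x p z.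
Proof.
move=> vx uy zN.
have x0 : (0 < nvertices x)%N by []; have y0 : (0 < nvertices y)%N by [].
have c0 : (0 < nvertices c)%N by [].
have [ez|nz] := eqVneq (nvertices z) (nvertices x + (nvertices y + nvertices c).-1).-1; last first.
  rewrite big1; last first.
    move=> p _; have [->|h1] := eqVneq (ins v x y p) 0; first by rewrite mul0r.
    have [->|h2] := eqVneq (ins (v + u) p c z) 0; first by rewrite mulr0.
    case/eqP: nz; have := insertion_nvertices vx h1 => e1.
    rewrite (insertion_nvertices _ h2) e1; lia.
  rewrite big1 // => p _; have [->|h1] := eqVneq (ins u y c p) 0; first by rewrite mul0r.
  have [->|h2] := eqVneq (ins v x p z) 0; first by rewrite mulr0.
  by case/eqP: nz; rewrite (insertion_nvertices vx h2) (insertion_nvertices uy h1).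
rewrite insertion_then_left ?insertion_then_right //; try lia.
rewrite !insertion_coloursE substitute_sequential ?size_colours //.
case: ifP => // _; apply: form_value_perm.
rewrite /insertion_forms !(map_cat _ (map _ (cells _))) -!catA; apply: all2_cat.
  rewrite -!map_comp; apply: all2_map; apply/allP => d _ /=.
  exact: (blow_up_blow_up v d uy c0).
apply: all2_cat; last first.
  rewrite /singles -!map_comp; apply: all2_map; apply/allP => d _ /=.
  by rewrite shift_shift.
rewrite /singles -!map_comp; apply: all2_map; apply/allP => d _ /=.
rewrite cats0 blow_up_shift //.
by rewrite (@flatten_map_eq _ _ (shift_cell v)).
Qed.

(** Both sides are the same product of linear forms, up to exchanging the factors
    coming from [y] and from [c]. *)
Theorem insertion_parallel v v' x y c z N :
  (v < v')%N -> (v' < nvertices x)%N -> (nvertices z <= N)%N ->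
  \sum_(p <- bamboo_list N) ins v x y p * ins (v' + nvertices y).-1 p c z
    = (-1) ^+ (size (cells y) * size (cells c)) *
      \sum_(p <- bamboo_list N) ins v' x c p * ins v p y z.
Proof.
move=> vv' vx' zN; have vx := ltn_trans vv' vx'.
have x0 : (0 < nvertices x)%N by []; have y0 : (0 < nvertices y)%N by [].
have c0 : (0 < nvertices c)%N by [].
have [ez|nz] := eqVneq (nvertices z) (nvertices x + (nvertices y + nvertices c).-1).-1; last first.
  rewrite big1; last first.
    move=> p _; have [->|h1] := eqVneq (ins v x y p) 0; first by rewrite mul0r.
    have [->|h2] := eqVneq (ins (v' + nvertices y).-1 p c z) 0; first by rewrite mulr0.
    case/eqP: nz; have := insertion_nvertices vx h1 => e1.
    rewrite (insertion_nvertices _ h2) e1; lia.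
  rewrite big1 ?mulr0 // => p _.
  have [->|h1] := eqVneq (ins v' x c p) 0; first by rewrite mul0r.
  have [->|h2] := eqVneq (ins v p y z) 0; first by rewrite mulr0.
  case/eqP: nz; have := insertion_nvertices vx' h1 => e1.
  rewrite (insertion_nvertices _ h2) e1; lia.
rewrite !insertion_then_left //; try lia.
rewrite !insertion_coloursE -(size_colours y) substitute_parallel ?size_colours //.
case: ifP => // _; last by rewrite mulr0.
rewrite /insertion_forms !(map_cat _ (map _ (cells _))) -!catA.
rewrite alternating_swap; last by apply: form_value_alternating; exact: word_coef_alternating.
rewrite /singles !size_map; congr (_ * form_value _ _).
congr (_ ++ _).
  rewrite -!map_comp; apply: eq_map => d /=; exact: (blow_up_parallel_source d vv' y0 c0).
congr (_ ++ _); rewrite -!map_comp; apply/eq_in_map => d dd /=.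
  by rewrite cats0 blow_up_parallel_right.
by rewrite cats0 blow_up_parallel_left ?(allP (valid_cells y)).
Qed.

End Insertion.

(** * The operad of bamboos *)

Section WhitePositions.
Implicit Types (cs : seq bool).

Definition white_positions cs : seq nat :=
  [seq v <- iota 0%N (size cs) | ~~ nth false cs v].

Lemma white_positions_cons b cs : white_positions (b :: cs) =
  if b then map S (white_positions cs) else 0%N :: map S (white_positions cs).
Proof.
rewrite /white_positions /= -(addn0 1%N) iotaDl filter_map.
by case: b; congr (_ :: map _ _) || congr (map _ _); apply: eq_filter.
Qed.

Lemma size_white_positions cs : size (white_positions cs) = count negb cs.
Proof.
elim: cs => // b cs IH; rewrite white_positions_cons /= -IH.
by case: b; rewrite /= size_map.
Qed.

Lemma nth_white_positions a b :
  nth 0%N (white_positions (a ++ false :: b)) (count negb a) = size a.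
Proof.
elim: a => [|c a IH]; first by rewrite white_positions_cons.
rewrite cat_cons white_positions_cons; case: c => /=;
rewrite (nth_map 0%N) ?size_white_positions ?count_cat /= ?IH //; lia.
Qed.

Lemma white_position_split i cs : (i < count negb cs)%N ->
  exists a b, [/\ cs = a ++ false :: b, count negb a = i
     & nth 0%N (white_positions cs) i = size a].
Proof.
move=> h; suff [a [b [e ea]]] : exists a b, cs = a ++ false :: b /\ count negb a = i.
  by exists a, b; split=> //; rewrite e -ea nth_white_positions.
elim: cs i h => //= -[] cs IH i h.
  by have [a [b [-> <-]]] := IH i h; exists (true :: a), b.
case: i h => [|i] h; first by exists [::], cs.
by have [a [b [-> <-]]] := IH i h; exists (false :: a), b.
Qed.

End WhitePositions.

Section BambooOperad.
Variable K : fieldType.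
Implicit Types (x y z c p : bamboo).

Local Notation ins := (@insertion K).

Definition white x i : nat := nth 0%N (white_positions (colours x)) i.

Lemma whitesE x : whites x = white_positions (colours x).
Proof. by rewrite /whites /white_positions size_colours. Qed.

Lemma arityE x : bamboo_arity x = count negb (colours x).
Proof. by rewrite /bamboo_arity whitesE size_white_positions. Qed.

Lemma weightE x : bamboo_weight x = count id (colours x).
Proof.
rewrite /bamboo_weight /blacks /black -size_colours size_filter.
rewrite -[in RHS](mkseq_nth false (colours x)) count_map.
by apply: eq_count.
Qed.

Lemma degreeE x : bamboo_degree x = (size (cells x))%:Z - (count id (colours x)).*2%:Z.
Proof. by rewrite /bamboo_degree -weightE. Qed.

Lemma bamboo_coefE i x y z : (i < bamboo_arity x)%N ->
  bamboo_coef K i x y z = ins (white x i) x y z.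
Proof. by rewrite /bamboo_coef /white -whitesE => ->. Qed.

Lemma white_split x i : (i < bamboo_arity x)%N -> exists a b,
  [/\ colours x = a ++ false :: b, count negb a = i & white x i = size a].
Proof. by rewrite arityE => /white_position_split. Qed.

Lemma white_lt x i : (i < bamboo_arity x)%N -> (white x i < nvertices x)%N.
Proof.
move=> /white_split[a [b [e _ ->]]]; rewrite -size_colours e size_cat /=; lia.
Qed.

Lemma white_inserted i j x y p : (i < bamboo_arity x)%N -> (j < bamboo_arity y)%N ->
  colours p = insertion_colours (white x i) x y ->
  (i + j < bamboo_arity p)%N /\ white p (i + j) = (white x i + white y j)%N.
Proof.
move=> /white_split[a [b [ex <- ->]]] /white_split[a' [b' [ey <- ->]]] cp.
rewrite arityE /white cp insertion_coloursE ex ey substitute_cat.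
rewrite -catA cat_cons catA -count_cat -size_cat nth_white_positions; split=> //.
by rewrite [X in (_ < X)%N]count_cat /=; lia.
Qed.

Lemma white_split2 x i j : (i < j)%N -> (j < bamboo_arity x)%N ->
  exists a d b, [/\ colours x = a ++ false :: d ++ false :: b,
    count negb a = i, count negb (a ++ false :: d) = j,
    white x i = size a & white x j = size (a ++ false :: d)].
Proof.
move=> ij jx; have [a [b0 [ex ea ev]]] := white_split (ltn_trans ij jx).
have h : (j - i.+1 < count negb b0)%N.
  by move: jx; rewrite arityE ex count_cat /= ea; lia.
have [d [b [eb ed _]]] := white_position_split h.
have ej : count negb (a ++ false :: d) = j by rewrite count_cat /= ea ed; lia.
exists a, d, b; split=> //; first by rewrite ex eb.
by rewrite /white ex eb -cat_cons catA -ej nth_white_positions.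
Qed.

Lemma white_after i j x y p : (i < j)%N -> (j < bamboo_arity x)%N ->
  colours p = insertion_colours (white x i) x y ->
  ((j + bamboo_arity y).-1 < bamboo_arity p)%N /\
  white p (j + bamboo_arity y).-1 = (white x j + nvertices y).-1.
Proof.
move=> ij jx cp; have [a [d [b [ex ea ed ev ev']]]] := white_split2 ij jx.
rewrite ev' !arityE /white cp insertion_coloursE ev ex substitute_cat.
rewrite [colours y ++ _]catA catA.
have -> : (j + count negb (colours y)).-1 = count negb (a ++ colours y ++ d).
  by rewrite -ed !count_cat /=; lia.
rewrite nth_white_positions; split; first by rewrite [X in (_ < X)%N]count_cat /=; lia.
by rewrite !size_cat size_colours /=; lia.
Qed.

Lemma white_before i j x c p : (i < j)%N -> (j < bamboo_arity x)%N ->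
  colours p = insertion_colours (white x j) x c ->
  (i < bamboo_arity p)%N /\ white p i = white x i.
Proof.
move=> ij jx cp; have [a [d [b [ex ea ed ev ev']]]] := white_split2 ij jx.
rewrite ev arityE /white cp insertion_coloursE ev' ex.
rewrite -[_ :: d ++ _]cat_cons [a ++ _ ++ _]catA substitute_cat -catA cat_cons.
by rewrite -ea nth_white_positions count_cat /=; split=> //; lia.
Qed.

Lemma arity_insertion i x y z : (i < bamboo_arity x)%N ->
  colours z = insertion_colours (white x i) x y ->
  (bamboo_arity x + bamboo_arity y)%N = (bamboo_arity z).+1 /\
  count id (colours z) = (count id (colours x) + count id (colours y))%N.
Proof.
move=> /white_split[a [b [ex _ ev]]]; rewrite ev insertion_coloursE !arityE ex.
by rewrite substitute_cat => ->; rewrite !count_cat /=; lia.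
Qed.

(** The black vertices have even degree: only cells contribute to signs. *)
Lemma degree_parity x : odd `|bamboo_degree x|%N = odd (size (cells x)).
Proof. rewrite degreeE; lia. Qed.

Lemma insertion_white y z : ins 0 white_vertex y z = (y == z)%:R.
Proof.
rewrite /insertion /insertion_words big_seq1.
have -> : map (shift_cell 0) (cells y) = cells y.
  by rewrite -[RHS]map_id; apply: eq_map => -[].
have := word_vector_perm K (erefl (colours y)) (perm_refl _) z.
rewrite inversions_cells expr0 mul1r /word_vector /insertion_colours /= cats0 => ->.
by rewrite eq_sym.
Qed.

Lemma insertion_white_at i x z : (i < bamboo_arity x)%N ->
  ins (white x i) x white_vertex z = (x == z)%:R.
Proof.
move=> ix; have [a [b [ex _ ev]]] := white_split ix.
rewrite insertionE insertion_coloursE.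
have -> : substitute (white x i) (colours x) (colours white_vertex) = colours x.
  by rewrite ev ex substitute_cat.
have -> : insertion_forms (white x i) x white_vertex = singles (cells x).
  rewrite /insertion_forms cats0; apply: eq_map => -[] j /=.
    by rewrite addn1 if_same.
  by case: ltngtP => //=; rewrite ?addn1 // => ->.
rewrite form_value_singles.
have := word_vector_perm K (erefl (colours x)) (perm_refl _) z.
by rewrite inversions_cells expr0 mul1r /word_vector => ->; rewrite eq_sym.
Qed.

Theorem bamboo_structure : structure_constants bamboo_arity bamboo_degree
  bamboo_weight white_vertex (@bamboo_coef K) nvertices bamboo_list.
Proof.
split.
- exact: uniq_bamboo_list.
- exact: mem_bamboo_list.
- move=> i x y z; have [ix|] := ltnP i (bamboo_arity x); last first.
    by rewrite /bamboo_coef ltnNge => ->; rewrite eqxx.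
  rewrite bamboo_coefE // => h; have vx := white_lt ix.
  have ez := insertion_nvertices vx h; have es := insertion_size_cells h.
  have [cz _] := insertion_supp h; have [e1 e2] := arity_insertion ix cz.
  split=> //.
  + rewrite !degreeE es e2; lia.
  + by rewrite !weightE e2.
  + rewrite ez /nvertices; lia.
- by [].
- by move=> y z; rewrite bamboo_coefE // insertion_white.
- by move=> i x z ix; rewrite bamboo_coefE // insertion_white_at.
- move=> i j a b c z N ia jb zN.
  transitivity (\sum_(p <- bamboo_list N) ins (white a i) a b p * ins (white a i + white b j) p c z).
    apply: eq_bigr => p _; rewrite bamboo_coefE //.
    have [->|/insertion_supp[cp _]] := eqVneq (ins (white a i) a b p) 0; first by rewrite !mul0r.
    have [ijp e] := white_inserted ia jb cp.
    by rewrite bamboo_coefE // e.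
  rewrite insertion_sequential ?white_lt //.
  by apply: eq_bigr => p _; rewrite !bamboo_coefE.
move=> i j a b c z N ij ja zN; have ia := ltn_trans ij ja.
transitivity (\sum_(p <- bamboo_list N) ins (white a i) a b p * ins (white a j + nvertices b).-1 p c z).
  apply: eq_bigr => p _; rewrite bamboo_coefE //.
  have [->|/insertion_supp[cp _]] := eqVneq (ins (white a i) a b p) 0; first by rewrite !mul0r.
  have [ijp e] := white_after ij ja cp.
  by rewrite bamboo_coefE // e.
have [d [f [g [_ _ _ e e']]]] := white_split2 ij ja.
rewrite insertion_parallel ?white_lt //; last first.
  by rewrite e e' size_cat /=; lia.
congr (_ * _).
  rewrite -signr_odd oddM -!degree_parity -oddM signr_odd //.
apply: eq_bigr => p _; rewrite bamboo_coefE //.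
have [->|/insertion_supp[cp _]] := eqVneq (ins (white a j) a c p) 0; first by rewrite !mul0r.
have [ijp ep] := white_before ij ja cp.
by rewrite bamboo_coefE // ep.
Qed.

End BambooOperad.

(** * The differential is a derivation *)

Section Derivation.
Variable K : fieldType.
Implicit Types (x y z p l : bamboo).

Local Notation ins := (@insertion K).
Local Notation sg x := ((-1) ^+ size (cells x) : K).

(** A white vertex is split by nu * mu alone; for a black vertex, the differential
    of alpha cancels one of the two copies of its splitting. *)
Definition splittings (black : bool) : seq bamboo :=
  if black then [:: link true true] else [:: link true false; link false true].

Lemma splittingsP b l : l \in splittings b ->
  [/\ nvertices l = 2, size (cells l) = 1%N, size (colours l) = 2
    & count negb (colours l) = count negb [:: b]].
Proof. by case: b; rewrite !inE; [move=> /eqP->|move=> /orP[]/eqP->]. Qed.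

Lemma bamboo_diffE x z : bamboo_diff K x z =
  ins 1 (link true false) x z + ins 0 (link false true) x z
  - sg x * \sum_(v <- iota 0%N (nvertices x)) \sum_(l <- splittings (black x v)) ins v x l z.
Proof.
rewrite /bamboo_diff -addrA; congr (_ + _); rewrite -mulrN -mulrDr -mulrN; congr (_ * _).
rewrite /blacks big_filter [X in _ + X]big_mkcond /= -sumrN -[RHS]sumrN -big_split.
apply: eq_bigr => v _ /=.
case: (black x v); rewrite ?big_cons big_nil; ring.
Qed.

Lemma iota_split n a b : (a + b <= n)%N ->
  iota 0 n = iota 0 a ++ iota a b ++ iota (a + b) (n - (a + b)).
Proof. by move=> h; rewrite -{1}(subnKC h) -addnA !iotaD add0n. Qed.

Lemma white_left_of_split x i u l p : (i < bamboo_arity x)%N -> (u < white x i)%N ->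
  l \in splittings (black x u) -> colours p = insertion_colours u x l ->
  (i < bamboo_arity p)%N /\ white p i = (white x i).+1.
Proof.
move=> /white_split[a [b [ex ea ev]]] uv /splittingsP[_ _ sl cl] cp.
have ua : (u < size a)%N by rewrite -ev.
have [a1 [c [a2 [e eu]]]] := split_nth ua.
have bc : black x u = c.
  by rewrite /black ex e -catA nth_cat -eu ltnn subnn.
rewrite ev arityE /white cp insertion_coloursE ex e -catA cat_cons eu substitute_cat.
have ei : count negb (a1 ++ colours l ++ a2) = i.
  by rewrite -ea e !count_cat cl bc /=; lia.
rewrite !catA -[(a1 ++ _) ++ a2]catA; split; first by rewrite count_cat ei /=; lia.
by rewrite -[X in nth _ _ X]ei nth_white_positions !size_cat sl /=; lia.
Qed.

Lemma white_right_of_split x i u l p : (i < bamboo_arity x)%N -> (white x i < u)%N ->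
  (u < nvertices x)%N -> colours p = insertion_colours u x l ->
  (i < bamboo_arity p)%N /\ white p i = white x i.
Proof.
move=> /white_split[a [b [ex ea ev]]] vu ux cp.
have ub : (u - (size a).+1 < size b)%N.
  by move: ux; rewrite -size_colours ex size_cat /= -ev; lia.
have [b1 [c [b2 [e eu]]]] := split_nth ub.
rewrite arityE ev /white cp insertion_coloursE ex e.
have -> : u = size (a ++ false :: b1) by rewrite size_cat /=; lia.
rewrite -cat_cons catA substitute_cat -catA cat_cons -ea; split.
  by rewrite count_cat /=; lia.
by rewrite nth_white_positions.
Qed.

Lemma white_of_split x i l p j : (i < bamboo_arity x)%N ->
  colours l = (if j is 0 then [:: false; true] else [:: true; false]) -> (j <= 1)%N ->
  colours p = insertion_colours (white x i) x l ->
  (i < bamboo_arity p)%N /\ white p i = (white x i + j)%N.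
Proof.
move=> ix cl j1 cp.
have l0 : (0 < bamboo_arity l)%N by rewrite arityE cl; case: (j).
have [h1 h2] := white_inserted ix l0 cp; rewrite addn0 in h1 h2.
by split=> //; rewrite h2 /white cl; case: j cl j1 h1 h2 => [|[|j]].
Qed.

Lemma nth_substitute (cs cs' : seq bool) v u : (v < size cs)%N ->
  nth false (substitute v cs cs') u =
    if (u < v)%N then nth false cs u
    else if (u < v + size cs')%N then nth false cs' (u - v)
    else nth false cs (u - size cs').+1.
Proof.
move=> /split_nth[a [c [b [-> ->]]]]; rewrite substitute_cat !nth_cat.
case: ltnP => // ua; rewrite ltn_subLR //; case: ltnP => // ub.
rewrite ltnNge; have -> : (size a <= (u - size cs').+1)%N by lia.
by have -> : ((u - size cs').+1 - size a = (u - size a - size cs').+1)%N by lia.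
Qed.

Section Terms.
Variables (i : nat) (x y z : bamboo) (N : nat).
Hypotheses (ix : (i < bamboo_arity x)%N) (zN : (nvertices z <= N)%N).
Let v := white x i.
Let vx : (v < nvertices x)%N := white_lt ix.
Local Notation L := (bamboo_list N).

(* The terms of the three sides of the derivation rule, according to the place
   of the vertex which is split: in [x] to the left of the insertion, in [y], in
   [x] to the right of the insertion, at the ends of [x], at the ends of [y].  The
   last ones cancel: a black vertex joined to the left (or right) end of [y] is
   also obtained by splitting the white vertex of [x] before inserting [y]. *)
Let left_terms := \sum_(u <- iota 0 v) \sum_(l <- splittings (black x u))
   \sum_(p <- L) ins u x l p * ins v.+1 p y z.
Let middle_terms := \sum_(u <- iota 0 (nvertices y)) \sum_(l <- splittings (black y u))
   \sum_(p <- L) ins u y l p * ins v x p z.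
Let right_terms := \sum_(u <- iota v.+1 (nvertices x - v.+1)) \sum_(l <- splittings (black x u))
   \sum_(p <- L) ins u x l p * ins v p y z.
Let outer_terms :=
  \sum_(p <- L) ins 1 (link true false) x p * ins v.+1 p y z
  + \sum_(p <- L) ins 0 (link false true) x p * ins v p y z.
Let inner_terms :=
  \sum_(p <- L) ins 1 (link true false) y p * ins v x p z
  + \sum_(p <- L) ins 0 (link false true) y p * ins v x p z.

Lemma diff_of_composite :
  \sum_(p <- L) ins v x y p * bamboo_diff K p z
    = outer_terms - sg x * (left_terms + sg y * middle_terms + right_terms).
Proof.
transitivity (\sum_(p <- L) (ins v x y p * ins 1 (link true false) p z
    + ins v x y p * ins 0 (link false true) p z
    - sg x * sg y * \sum_(u <- iota 0 (nvertices x + nvertices y).-1)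
        \sum_(l <- splittings (nth false (insertion_colours v x y) u))
           ins v x y p * ins u p l z)).
  apply: eq_bigr => p _; have [->|h] := eqVneq (ins v x y p) 0.
    rewrite !mul0r add0r big1 ?mulr0 ?subr0 // => u _.
    by rewrite big1 // => l _; rewrite mul0r.
  have [cp _] := insertion_supp h.
  rewrite bamboo_diffE mulrBr mulrDr; congr (_ - _).
  rewrite (insertion_nvertices vx h) (insertion_size_cells h) exprD.
  rewrite mulrCA; congr (_ * _); rewrite mulr_sumr; apply: eq_bigr => u _.
  by rewrite mulr_sumr /black cp.
rewrite sumrB big_split /=; congr (_ + _ - _).
- by rewrite (@insertion_sequential K 1 v (link true false) x y z N).
- by rewrite (@insertion_sequential K 0 v (link false true) x y z N).
rewrite -mulr_sumr exchange_big /=.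
under eq_bigr do rewrite exchange_big /=.
have x0 : (0 < nvertices x)%N by []; have y0 : (0 < nvertices y)%N by [].
have vx' : (v < nvertices x)%N := vx.
rewrite (@iota_split (nvertices x + nvertices y).-1 v (nvertices y)); last first.
  lia.
rewrite !big_cat -mulrA; congr (_ * _).
have sy2 : sg y * sg y = 1 by rewrite -exprD addnn -muln2 exprM sqrr_sign.
pose W u := \sum_(l <- splittings (nth false (insertion_colours v x y) u))
  \sum_(p <- L) ins v x y p * ins u p l z.
transitivity (sg y * (\sum_(u <- iota 0 v) W u + (\sum_(u <- iota v (nvertices y)) W u
  + \sum_(u <- iota (v + nvertices y) ((nvertices x + nvertices y).-1 - (v + nvertices y))) W u)));
  first by [].
rewrite /W.
rewrite !mulrDr addrA; congr (_ + _ + _).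
- rewrite mulr_sumr big_seq [RHS]big_seq; apply: eq_bigr => u.
  rewrite mem_iota add0n => /andP[_ uv].
  rewrite nth_substitute ?size_colours // uv mulr_sumr -/(black x u).
  rewrite big_seq [RHS]big_seq; apply: eq_bigr => l /splittingsP[nl sl _ _].
  have := @insertion_parallel K u v x l y z N uv vx zN.
  by rewrite nl addn2 /= sl mul1n => ->.
- have -> : iota v (nvertices y) = map (addn v) (iota 0 (nvertices y)) by rewrite -iotaDl addn0.
  rewrite big_map; congr (_ * _).
  rewrite big_seq [RHS]big_seq; apply: eq_bigr => u.
  rewrite mem_iota add0n => /andP[_ uy].
  rewrite nth_substitute ?size_colours // ltnNge leq_addr /= ltn_add2l uy addKn.
  by apply: eq_bigr => l _; rewrite insertion_sequential.
have -> : iota (v + nvertices y) ((nvertices x + nvertices y).-1 - (v + nvertices y))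
   = map (addn (nvertices y).-1) (iota v.+1 (nvertices x - v.+1)).
  rewrite -iotaDl; congr iota; lia.
rewrite big_map mulr_sumr big_seq [RHS]big_seq; apply: eq_bigr => u.
rewrite mem_iota => /andP[vu ux].
have ux' : (u < nvertices x)%N by lia.
rewrite nth_substitute ?size_colours // ifF ?ifF; [|lia|lia].
have -> : ((nvertices y).-1 + u - nvertices y).+1 = u by lia.
rewrite mulr_sumr -/(black x u) big_seq [RHS]big_seq.
apply: eq_bigr => l /splittingsP[nl sl _ _].
have := @insertion_parallel K v u x y l z N vu ux' zN.
have -> : ((nvertices y).-1 + u)%N = (u + nvertices y).-1 by lia.
by rewrite sl muln1 => ->; rewrite mulrA sy2 mul1r.
Qed.

Lemma composite_of_diff :
  \sum_(p <- L) bamboo_diff K x p * bamboo_coef K i p y z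
    = outer_terms - sg x * (left_terms + inner_terms + right_terms).
Proof.
have vx' : (v < nvertices x)%N := vx.
pose R := iota v.+1 (nvertices x - v.+1).
have eR : iota 0 (nvertices x) = iota 0 v ++ v :: R.
  by rewrite (@iota_split (nvertices x) v 1) addn1.
transitivity (\sum_(p <- L) (ins 1 (link true false) x p * bamboo_coef K i p y z
    + ins 0 (link false true) x p * bamboo_coef K i p y z
    - sg x * \sum_(u <- iota 0 v ++ v :: R) \sum_(l <- splittings (black x u))
           ins u x l p * bamboo_coef K i p y z)).
  apply: eq_bigr => p _; rewrite bamboo_diffE mulrBl mulrDl; congr (_ - _).
  rewrite eR -mulrA mulr_suml; congr (_ * _); apply: eq_bigr => u _.
  by rewrite mulr_suml.
rewrite sumrB big_split /=; congr (_ + _ - _).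
- apply: eq_bigr => p _; have [->|/insertion_supp[cp _]] := eqVneq (ins 1 (link true false) x p) 0.
    by rewrite !mul0r.
  have [h1 h2] := @white_inserted 0 i (link true false) x p isT ix cp.
  by rewrite bamboo_coefE // h2.
- apply: eq_bigr => p _; have [->|/insertion_supp[cp _]] := eqVneq (ins 0 (link false true) x p) 0.
    by rewrite !mul0r.
  have [h1 h2] := @white_inserted 0 i (link false true) x p isT ix cp.
  by rewrite bamboo_coefE // h2.
rewrite -mulr_sumr exchange_big /=; congr (_ * _).
under eq_bigr do rewrite exchange_big /=.
rewrite big_cat big_cons /= addrA; congr (_ + _ + _).
- rewrite big_seq [RHS]big_seq; apply: eq_bigr => u.
  rewrite mem_iota add0n => /andP[_ uv].
  rewrite big_seq [RHS]big_seq; apply: eq_bigr => l lu; apply: eq_bigr => p _.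
  have [->|/insertion_supp[cp _]] := eqVneq (ins u x l p) 0; first by rewrite !mul0r.
  have [h1 h2] := white_left_of_split ix uv lu cp.
  by rewrite bamboo_coefE // h2.
- have -> : black x v = false.
    have [a [b [ex _ ev]]] := white_split ix.
    by rewrite /black ex /v ev nth_cat ltnn subnn.
  rewrite !big_cons big_nil addr0; congr (_ + _).
    rewrite -insertion_sequential //; apply: eq_bigr => p _.
    have [->|/insertion_supp[cp _]] := eqVneq (ins v x (link true false) p) 0.
      by rewrite !mul0r.
    have [h1 h2] := @white_of_split x i (link true false) p 1 ix erefl isT cp.
    by rewrite bamboo_coefE // h2.
  rewrite -insertion_sequential //; apply: eq_bigr => p _.
  have [->|/insertion_supp[cp _]] := eqVneq (ins v x (link false true) p) 0.
    by rewrite !mul0r.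
  have [h1 h2] := @white_of_split x i (link false true) p 0 ix erefl isT cp.
  by rewrite bamboo_coefE // h2.
rewrite big_seq [RHS]big_seq; apply: eq_bigr => u.
rewrite mem_iota => /andP[vu ux].
have ux' : (u < nvertices x)%N by lia.
apply: eq_bigr => l _; apply: eq_bigr => p _.
have [->|/insertion_supp[cp _]] := eqVneq (ins u x l p) 0; first by rewrite !mul0r.
have [h1 h2] := white_right_of_split ix vu ux' cp.
by rewrite bamboo_coefE // h2.
Qed.

Lemma composite_with_diff :
  \sum_(p <- L) bamboo_diff K y p * bamboo_coef K i x p z
    = inner_terms - sg y * middle_terms.
Proof.
transitivity (\sum_(p <- L) (ins 1 (link true false) y p * ins v x p z
    + ins 0 (link false true) y p * ins v x p z
    - sg y * \sum_(u <- iota 0 (nvertices y)) \sum_(l <- splittings (black y u))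
           ins u y l p * ins v x p z)).
  apply: eq_bigr => p _; rewrite bamboo_coefE // bamboo_diffE mulrBl mulrDl; congr (_ - _).
  rewrite -mulrA mulr_suml; congr (_ * _); apply: eq_bigr => u _.
  by rewrite mulr_suml.
rewrite sumrB big_split /=; congr (_ - _).
rewrite -mulr_sumr exchange_big /=; congr (_ * _).
by apply: eq_bigr => u _; rewrite exchange_big.
Qed.

Theorem bamboo_derivation :
  \sum_(p <- L) bamboo_coef K i x y p * bamboo_diff K p z
    = \sum_(p <- L) bamboo_diff K x p * bamboo_coef K i p y z
      + (-1) ^+ `|bamboo_degree x|%N *
        \sum_(p <- L) bamboo_diff K y p * bamboo_coef K i x p z.
Proof.
have -> : (-1) ^+ `|bamboo_degree x|%N = sg x.
  by rewrite -signr_odd degree_parity signr_odd.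
rewrite composite_of_diff composite_with_diff.
transitivity (\sum_(p <- L) ins v x y p * bamboo_diff K p z).
  by apply: eq_bigr => p _; rewrite bamboo_coefE.
rewrite diff_of_composite; ring.
Qed.

End Terms.

Lemma bamboo_diff_supp x z : bamboo_diff K x z != 0 ->
  [/\ bamboo_arity x = bamboo_arity z, bamboo_degree x = bamboo_degree z + 1,
      bamboo_weight z = (bamboo_weight x).+1 & nvertices z = (nvertices x).+1].
Proof.
have conclude : nvertices z = (nvertices x).+1 ->
    size (cells z) = (size (cells x)).+1 ->
    count id (colours z) = (count id (colours x)).+1 ->
    count negb (colours z) = count negb (colours x) ->
  [/\ bamboo_arity x = bamboo_arity z, bamboo_degree x = bamboo_degree z + 1,
      bamboo_weight z = (bamboo_weight x).+1 & nvertices z = (nvertices x).+1].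
  move=> nz sz bz wz; rewrite !arityE !degreeE !weightE wz bz sz; split=> //; lia.
rewrite bamboo_diffE => h.
have [h1|h1] := eqVneq (ins 1 (link true false) x z) 0; last first.
  have [cz _] := insertion_supp h1; apply: conclude.
  - by rewrite (insertion_nvertices _ h1).
  - by rewrite (insertion_size_cells h1).
  - by rewrite cz !count_cat /=; lia.
  - by rewrite cz !count_cat /=; lia.
have [h2|h2] := eqVneq (ins 0 (link false true) x z) 0; last first.
  have [cz _] := insertion_supp h2; apply: conclude.
  - by rewrite (insertion_nvertices _ h2).
  - by rewrite (insertion_size_cells h2).
  - by rewrite cz !count_cat /=; lia.
  - by rewrite cz !count_cat /=; lia.
have [u ux [l lu h3]] : exists2 u, (u < nvertices x)%N &
    exists2 l, l \in splittings (black x u) & ins u x l z != 0.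
  have /hasP[u] : has (fun u => has (fun l => ins u x l z != 0) (splittings (black x u)))
      (iota 0 (nvertices x)).
    apply: contraNT h => /hasPn h; rewrite h1 h2 add0r big_seq big1 ?mulr0 ?subr0 //.
    move=> u /h /hasPn h'; rewrite big_seq big1 // => l /h'.
    by rewrite negbK => /eqP.
  by rewrite mem_iota => /andP[_ ux] /hasP[l lu h3]; exists u => //; exists l.
have [nl sl cl wl] := splittingsP lu; have [cz _] := insertion_supp h3.
apply: conclude.
- by rewrite (insertion_nvertices ux h3) nl addn2.
- by rewrite (insertion_size_cells h3) sl addn1.
- move: wl; rewrite cz insertion_coloursE; move: ux lu; rewrite -size_colours /black.
  case/split_nth => a [c [b [-> ->]]]; rewrite substitute_cat nth_cat ltnn subnn => lu wl.
  have := count_predC id (colours l).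
  have -> : count (predC id) (colours l) = count negb (colours l) by exact: eq_count.
  rewrite wl cl.
  rewrite !count_cat; move: (count id (colours l)); case: (c) => /= k; lia.
move: wl; rewrite cz insertion_coloursE; move: ux lu; rewrite -size_colours /black.
case/split_nth => a [c [b [-> ->]]]; rewrite substitute_cat nth_cat ltnn subnn => lu wl.
by rewrite !count_cat wl /=; lia.
Qed.

End Derivation.

(** * Words of items *)

(** An item is a vertex with the flag telling whether it is joined to its
    predecessor. *)
Notation item := (bool * vertex)%type.

Section InterleavedWords.
Implicit Types (x : bamboo) (l : seq item) (k : nat).

(** The first vertex is flagged as joined to a virtual predecessor, so that no
    break is created in front of the word. *)
Definition items x : seq item := (true, x.1) :: x.2.

Definition of_items l : bamboo := ((head (true, (false, false)) l).2, behead l).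

Lemma itemsK : cancel items of_items.
Proof. by case. Qed.

Lemma of_itemsK v l : items (of_items ((true, v) :: l)) = (true, v) :: l.
Proof. by []. Qed.

Lemma size_items x : size (items x) = nvertices x.
Proof. by []. Qed.

(** The cells from left to right, an edge coming before the tadpole of its right
    end.  In this order inserting a vertex only affects the cells locally, so that
    no sign depends on the tadpoles of remote vertices. *)
Fixpoint interleaved k l : seq cell :=
  if l is (j, (_, t)) :: l' then
    nseq j (edge k.-1) ++ nseq t (tadpole k) ++ interleaved k.+1 l'
  else [::].

Definition interleaved_word x : seq cell :=
  nseq x.1.2 (tadpole 0) ++ interleaved 1 x.2.

Fixpoint edges_from k l : seq cell :=
  if l is (j, _) :: l' then nseq j (edge k.-1) ++ edges_from k.+1 l' else [::].

Fixpoint tadpoles_from k (vs : seq vertex) : seq cell :=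
  if vs is (_, t) :: vs' then nseq t (tadpole k) ++ tadpoles_from k.+1 vs' else [::].

Lemma edges_fromE k l : edges_from k.+1 l =
  [seq edge (k + v) | v <- iota 0 (size l) & nth false [seq p.1 | p <- l] v].
Proof.
elim: l k => //= -[j v] l IH k; rewrite IH.
have -> : [seq edge (k.+1 + u) | u <- iota 0 (size l) & nth false [seq p.1 | p <- l] u]
  = [seq edge (k + u) | u <- iota 1 (size l) & nth false (j :: [seq p.1 | p <- l]) u].
  rewrite -(addn0 1%N) iotaDl filter_map -map_comp.
  by apply: eq_map => u /=; rewrite add1n addnS.
by case: (j); rewrite /= ?addn0.
Qed.

Lemma tadpoles_fromE k vs : tadpoles_from k vs =
  [seq tadpole (k + v) | v <- iota 0 (size vs) & nth false [seq p.2 | p <- vs] v].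
Proof.
elim: vs k => //= -[c t] l IH k; rewrite IH.
have -> : [seq tadpole (k.+1 + u) | u <- iota 0 (size l) & nth false [seq p.2 | p <- l] u]
  = [seq tadpole (k + u) | u <- iota 1 (size l) & nth false (t :: [seq p.2 | p <- l]) u].
  rewrite -(addn0 1%N) iotaDl filter_map -map_comp.
  by apply: eq_map => u /=; rewrite add1n addnS.
by case: (t); rewrite /= ?addn0.
Qed.

Lemma perm_interleaved k l :
  perm_eq (interleaved k l) (edges_from k l ++ tadpoles_from k [seq p.2 | p <- l]).
Proof.
apply/permP => P; elim: l k => //= -[j [c t]] l IH k.
rewrite !count_cat IH count_cat; lia.
Qed.

Lemma perm_interleaved_word x : perm_eq (interleaved_word x) (cells x).
Proof.
case: x => -[c t] l; rewrite /interleaved_word /cells /joined /has_tadpole /vertices.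
rewrite -(@edges_fromE 0 l).
have := tadpoles_fromE 0 ((c, t) :: [seq p.2 | p <- l]).
rewrite [size _]/= size_map => <- /=.
apply/permP => P; rewrite !count_cat (permP (perm_interleaved 1 l)) count_cat; lia.
Qed.

Lemma interleaved_cat k l l' :
  interleaved k (l ++ l') = interleaved k l ++ interleaved (k + size l) l'.
Proof.
elim: l k => [|[j [c t]] l IH] k /=; first by rewrite addn0.
by rewrite IH -!catA addnS addSn.
Qed.

Lemma shift_interleaved u k l : (0 < k)%N ->
  map (shift_cell u) (interleaved k l) = interleaved (u + k) l.
Proof.
elim: l k => //= -[j [c t]] l IH k k0; rewrite !map_cat IH // addnS !map_nseq /=.
by congr (nseq j (edge _) ++ _); lia.
Qed.

Lemma blow_up_interleaved_after v k l : (v < k)%N ->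
  map (blow_up v 2) (interleaved k l) = singles (interleaved k.+1 l).
Proof.
rewrite /singles; elim: l k => //= -[j [c t]] l IH k vk; rewrite !map_cat !map_nseq IH /=; last by lia.
congr (_ ++ _ ++ _).
  by case: j => //=; rewrite ifF; [congr [:: [:: edge _]]; lia|lia].
by case: t => //=; rewrite ifF ?ifT; [congr [:: [:: tadpole _]]; lia|lia|lia].
Qed.

Lemma blow_up_interleaved_before v k l : (0 < k)%N -> (k + size l <= v)%N ->
  map (blow_up v 2) (interleaved k l) = singles (interleaved k l).
Proof.
rewrite /singles; elim: l k => //= -[j [c t]] l IH k k0 vk; rewrite !map_cat !map_nseq IH /=; [|lia..].
congr (_ ++ _ ++ _); first by case: j => //=; rewrite ifT //; lia.
by case: t => //=; rewrite ifT //; lia.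
Qed.

End InterleavedWords.

Section Derivation.
Variable K : fieldType.
Implicit Types (f g : seq item -> K) (l : seq item).


(** The derivation of the words of items, evaluated at the linear extension of
    [f].  In terms of letters, the break before an unjoined vertex is a letter
    with image (black, break) + (break, black), a black vertex without tadpole is
    mapped to its square and a white vertex with a tadpole to the commutator of
    the black vertex with a tadpole and the white vertex.  The sign in front of an
    item counts the cells of the previous ones; the edges having degree one,
    the letters are shifted: a break and a vertex without tadpole are odd. *)
Fixpoint derivation l f : K :=
  if l is (j, (c, t)) :: l' then
    (if j then 0
     else f ((true, (true, false)) :: (false, (c, t)) :: l')
          + f ((false, (true, false)) :: (true, (c, t)) :: l'))
    + (-1) ^+ (~~ j) *
       ((if c && ~~ t then f ((j, (true, false)) :: (true, (true, false)) :: l') else 0)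
        + (if ~~ c && t then f ((j, (true, true)) :: (true, (false, false)) :: l')
                            - f ((j, (false, false)) :: (true, (true, true)) :: l')
           else 0))
    + (-1) ^+ (j + t) * derivation l' (fun l'' => f ((j, (c, t)) :: l''))
  else 0.

Lemma derivation_ext l f g : (forall m, size m = (size l).+1 -> f m = g m) ->
  derivation l f = derivation l g.
Proof.
elim: l f g => //= -[j [c t]] l IH f g fg.
rewrite !fg //= (IH _ (fun l'' => g ((j, (c, t)) :: l''))) // => m sm.
by rewrite fg //= sm.
Qed.

Lemma derivation_ext_head v l f g :
  (forall w m, size m = (size l).+1 -> f ((true, w) :: m) = g ((true, w) :: m)) ->
  derivation ((true, v) :: l) f = derivation ((true, v) :: l) g.
Proof.
case: v => c t fg /=; rewrite !fg // (@derivation_ext l _ (fun l'' => g ((true, (c, t)) :: l''))) //.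
by move=> m sm; rewrite fg.
Qed.

Lemma derivationD l f g : derivation l (fun m => f m + g m) = derivation l f + derivation l g.
Proof.
elim: l f g => [|[j [c t]] l IH] f g /=; first by rewrite addr0.
rewrite IH; case: j; case: c; case: t => /=; ring.
Qed.

Lemma derivationZ l a f : derivation l (fun m => a * f m) = a * derivation l f.
Proof.
elim: l f => [|[j [c t]] l IH] f /=; first by rewrite mulr0.
rewrite IH; case: j; case: c; case: t => /=; ring.
Qed.

Lemma derivation0 l f : (forall m, size m = (size l).+1 -> f m = 0) -> derivation l f = 0.
Proof.
move=> f0; rewrite (@derivation_ext l f (fun m => 0 * f m)); first by rewrite derivationZ mul0r.
by move=> m sm; rewrite f0 // mul0r.
Qed.

Lemma derivation_const0 l : derivation l (fun=> 0) = 0.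
Proof. exact: derivation0. Qed.

Lemma derivationN l f : derivation l (fun m => - f m) = - derivation l f.
Proof.
rewrite -mulN1r -derivationZ; apply: derivation_ext => m _; by rewrite mulN1r.
Qed.

Lemma derivation_sum (I : Type) (r : seq I) (F : I -> seq item -> K) l :
  derivation l (fun m => \sum_(i <- r) F i m) = \sum_(i <- r) derivation l (F i).
Proof.
elim: r => [|i r IH]; first by rewrite big_nil derivation0 // => m _; rewrite big_nil.
rewrite big_cons -IH -derivationD; apply: derivation_ext => m _; exact: big_cons.
Qed.

(** A derivation whose square vanishes on the letters has square zero. *)
Theorem derivation_square l f : derivation l (fun m => derivation m f) = 0.
Proof.
elim: l f => [//|[j [c t]] l IH] f.
(* Only the terms in which both derivations do not act on the tail remain. *)
rewrite [LHS]/= -/derivation.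
have E : derivation l (fun l'' => derivation ((j, (c, t)) :: l'') f) =
  derivation l (fun l'' => (if j then 0
     else f ((true, (true, false)) :: (false, (c, t)) :: l'')
          + f ((false, (true, false)) :: (true, (c, t)) :: l''))
    + (-1) ^+ (~~ j) *
       ((if c && ~~ t then f ((j, (true, false)) :: (true, (true, false)) :: l'') else 0)
        + (if ~~ c && t then f ((j, (true, true)) :: (true, (false, false)) :: l'')
                            - f ((j, (false, false)) :: (true, (true, true)) :: l'')
           else 0))).
  rewrite [LHS](_ : _ = derivation l (fun l'' => (if j then 0
     else f ((true, (true, false)) :: (false, (c, t)) :: l'')
          + f ((false, (true, false)) :: (true, (c, t)) :: l''))
    + (-1) ^+ (~~ j) *
       ((if c && ~~ t then f ((j, (true, false)) :: (true, (true, false)) :: l'') else 0)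
        + (if ~~ c && t then f ((j, (true, true)) :: (true, (false, false)) :: l'')
                            - f ((j, (false, false)) :: (true, (true, true)) :: l'')
           else 0)))
     + (-1) ^+ (j + t) * derivation l (fun m => derivation m (fun l'' => f ((j, (c, t)) :: l'')))).
    by rewrite IH mulr0 addr0.
  by rewrite -derivationZ -derivationD.
rewrite E {E IH}; case: j; case: c; case: t => /=;
  rewrite ?(derivationD, derivationZ, derivationN, derivation_const0); ring.
Qed.

End Derivation.

(** * The differential of bamboos as a derivation of words *)

Section WordDifferential.
Variable K : fieldType.
Implicit Types (x z : bamboo) (l m pre post : seq item) (f : seq item -> K).

Local Notation ins := (@insertion K).
Local Notation sg x := ((-1) ^+ size (cells x) : K).

(** The sign relating the interleaved word of [x] with its word in the order of
    the cells. *)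
Definition word_sign x : K := (-1) ^+ inversions (interleaved_word x).

Lemma word_sign_sqr x : word_sign x * word_sign x = 1.
Proof. by rewrite /word_sign -exprD addnn -muln2 exprM sqrr_sign. Qed.

Definition item_vector z l : K :=
  word_vector K (colours (of_items l)) (interleaved_word (of_items l)) z.

Lemma item_vectorE z x : item_vector z (items x) = word_sign x * (z == x)%:R.
Proof.
rewrite /item_vector itemsK (word_vector_perm K erefl (perm_interleaved_word x)) //.
Qed.

Lemma interleaved_word_eval x (F : seq cell -> K) : alternating F ->
  F (cells x) = word_sign x * F (interleaved_word x).
Proof.
move=> hF; have := alternating_perm hF (perm_interleaved_word x).
by rewrite inversions_cells expr0 mul1r.
Qed.

Lemma colours_of_items i l : colours (of_items (i :: l)) = [seq p.2.1 | p <- i :: l].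
Proof. by rewrite /colours /= -map_comp. Qed.

Fixpoint ncells l : nat := if l is (j, (_, t)) :: l' then (j + t + ncells l')%N else 0%N.

Lemma size_interleaved k l : size (interleaved k l) = ncells l.
Proof.
by elim: l k => //= -[j [c t]] l IH k; rewrite !size_cat !size_nseq IH addnA.
Qed.

Lemma ncells_items x : ncells (items x) = (size (cells x)).+1.
Proof.
rewrite -(perm_size (perm_interleaved_word x)) /interleaved_word size_cat size_nseq.
by rewrite size_interleaved; case: x => -[c t] l.
Qed.

(** When a vertex is split, the cells before its tadpole are not changed. *)
Lemma interleaved_prefix pre j : (if pre is (j', _) :: _ then j' else j) = true ->
  exists A, (forall c t m, interleaved_word (of_items (pre ++ (j, (c, t)) :: m))
       = A ++ nseq t (tadpole (size pre)) ++ interleaved (size pre).+1 m)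
    /\ map (blow_up (size pre) 2) A = singles A.
Proof.
case: pre => [|[j' [c' t']] pre] hj; first by exists [::].
exists (nseq t' (tadpole 0) ++ interleaved 1 pre ++ nseq j (edge (size pre))); split.
  move=> c t m; rewrite /interleaved_word /= interleaved_cat /= add1n.
  by rewrite -!catA.
rewrite !map_cat blow_up_interleaved_before // /singles !map_cat !map_nseq /=.
by rewrite leqnn.
Qed.

Lemma form_value_middle (F : seq cell -> K) A s B :
  form_value F (singles A ++ s :: singles B) = \sum_(c <- s) F (A ++ c :: B).
Proof.
rewrite form_value_cat form_value_singles form_value_cons.
by apply: eq_bigr => c _; rewrite form_value_singles.
Qed.

(** The tadpole of a vertex which is split into two joined vertices goes to one of
    them; turning it into an edge gives zero, that edge being already present. *)
Definition split_term j t (p : bool * bool) l f : K :=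
  if t then f ((j, (p.1, true)) :: (true, (p.2, false)) :: l)
            - f ((j, (p.1, false)) :: (true, (p.2, true)) :: l)
  else f ((j, (p.1, false)) :: (true, (p.2, false)) :: l).

Lemma insertion_split x z pre j c t post p : items x = pre ++ (j, (c, t)) :: post ->
  ins (size pre) x (link p.1 p.2) z
    = word_sign x * ((-1) ^+ ncells post
        * split_term j t p post (fun m => item_vector z (pre ++ m))).
Proof.
move=> ex; set v := size pre.
have [A [eA bA]] : exists A, (forall c t m, interleaved_word (of_items (pre ++ (j, (c, t)) :: m))
       = A ++ nseq t (tadpole v) ++ interleaved v.+1 m)
    /\ map (blow_up v 2) A = singles A.
  by apply: interleaved_prefix; case: (pre) ex => [|[j' w] pre'] [].
have cE c1 t1 c2 t2 : colours (of_items (pre ++ (j, (c1, t1)) :: (true, (c2, t2)) :: post))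
    = substitute v (colours x) [:: c1; c2].
  have -> : colours x = [seq q.2.1 | q <- items x] by rewrite -(colours_of_items _ x.2); case: (x).
  rewrite ex map_cat /= /v -(size_map (fun q : item => q.2.1) pre) substitute_cat.
  by case: (pre) => [|i pre']; rewrite ?cat_cons colours_of_items // map_cons map_cat.
have fE c1 t1 c2 t2 : item_vector z (pre ++ (j, (c1, t1)) :: (true, (c2, t2)) :: post)
  = if colours z == substitute v (colours x) [:: c1; c2]
    then word_coef (A ++ nseq t1 (tadpole v) ++ edge v :: nseq t2 (tadpole v.+1) ++
                    interleaved v.+2 post) z else 0.
  by rewrite /item_vector /word_vector cE eA.
rewrite insertionE insertion_coloursE /split_term !fE.
have -> : colours (link p.1 p.2) = [:: p.1; p.2] by [].
case: (colours z == _); last by case: (t); rewrite ?subr0 !mulr0.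
have hw := word_coef_alternating K z.
have -> : form_value ((word_coef (K:=K))^~ z) (insertion_forms v x (link p.1 p.2))
  = word_sign x * form_value ((word_coef (K:=K))^~ z)
      (map (blow_up v 2) (interleaved_word x) ++ singles [:: edge v]).
  rewrite -(@interleaved_word_eval x (fun r => form_value ((word_coef (K:=K))^~ z)
      (map (blow_up v 2) r ++ singles [:: edge v]))); last first.
    apply: (@alternating_map K _ _ _ (fun ss => form_value _ (ss ++ _))).
    by apply: alternating_suffix; apply: form_value_alternating.
  by rewrite /insertion_forms /= addn0.
congr (_ * _).
have -> : interleaved_word x = A ++ nseq t (tadpole v) ++ interleaved v.+1 post.
  by rewrite -(eA c) -ex itemsK.
rewrite !map_cat bA blow_up_interleaved_after // -!catA.
have -> : singles (interleaved v.+2 post) ++ singles [:: edge v]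
   = singles (interleaved v.+2 post ++ [:: edge v]) by rewrite /singles map_cat.
case: (t).
  rewrite [nseq true _]/= map_cons [map _ [::]]/= cat1s form_value_middle blow_up_tadpole.
  rewrite /= !big_cons big_nil addr0.
  (* The edge of the link comes last; it is moved next to the vertex. *)
  have mv d : word_coef (A ++ d :: interleaved v.+2 post ++ [:: edge v]) z
     = (-1) ^+ ncells post * word_coef (A ++ d :: edge v :: interleaved v.+2 post) z :> K.
    have := alternating_move (rcons A d) (interleaved v.+2 post) (edge v) [::] hw.
    by rewrite !cat_rcons cats0 size_interleaved.
  rewrite !mv (hw.2 A) mulr0 addr0 -mulrDr (hw.1 A (edge v)) opprK //.
rewrite /= -/(singles _) /singles -map_cat -/(singles _) form_value_singles.
have := alternating_move A (interleaved v.+2 post) (edge v) [::] hw.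
by rewrite cats0 size_interleaved.
Qed.

Definition splitting_colours (c : bool) : seq (bool * bool) :=
  if c then [:: (true, true)] else [:: (true, false); (false, true)].

Lemma splittingsE c : splittings c = [seq link p.1 p.2 | p <- splitting_colours c].
Proof. by case: c. Qed.

(** The contribution of nu * mu and of the differential of alpha, in which a black
    vertex inserted between joined neighbours still appears twice. *)
Fixpoint raw_splitting l f : K :=
  if l is (j, (c, t)) :: l' then
    (-1) ^+ (j + t) * (raw_splitting l' (fun m => f ((j, (c, t)) :: m))
       - \sum_(p <- splitting_colours c) split_term j t p l' f)
  else 0.

(** Splitting two joined neighbours u and v creates the same word u, black, v
    twice, with opposite signs: only the ends and the breaks contribute. *)
Lemma raw_splittingE l f : raw_splitting l f
  = f ((true, (true, false)) :: l) - derivation l f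
    - (-1) ^+ ncells l * f (rcons l (true, (true, false))).
Proof.
elim: l f => [|[j [c t]] l IH] f; first by rewrite /= mul1r subr0 subrr.
rewrite /= IH !exprD; case: j; case: c; case: t;
  rewrite /split_term /= ?big_cons ?big_nil /=; ring.
Qed.

Lemma sum_splittings x z pre l : items x = pre ++ l ->
  \sum_(v <- iota (size pre) (size l)) \sum_(y <- splittings (black x v)) ins v x y z
   = - (word_sign x * ((-1) ^+ ncells l * raw_splitting l (fun m => item_vector z (pre ++ m)))).
Proof.
elim: l pre => [|[j [c t]] l IH] pre ex; first by rewrite /= big_nil !mulr0 oppr0.
rewrite [size _]/= [iota _ _]/= big_cons.
have := IH (rcons pre (j, (c, t))); rewrite size_rcons cat_rcons => -> //.
have -> : black x (size pre) = c.
  have e : colours x = [seq q.2.1 | q <- items x] by rewrite -(colours_of_items _ x.2); case: (x).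
  by rewrite /black e ex map_cat nth_cat size_map ltnn subnn.
rewrite splittingsE big_map.
under eq_bigr do rewrite (insertion_split z _ ex).
rewrite -!mulr_sumr /= !exprD.
have -> : raw_splitting l (fun m => item_vector z (rcons pre (j, (c, t)) ++ m)) =
   raw_splitting l (fun m => item_vector z (pre ++ (j, (c, t)) :: m)).
  by congr raw_splitting; apply/funext => m; rewrite cat_rcons.
set S := \sum_(p <- _) _; set R := raw_splitting l _.
have sj : (-1) ^+ j * (-1) ^+ j = 1 :> K by case: (j); rewrite ?mulrNN mulr1.
have st : (-1) ^+ t * (-1) ^+ t = 1 :> K by case: (t); rewrite ?mulrNN mulr1.
transitivity (word_sign x * ((-1) ^+ ncells l * (S - R))); first by ring.
transitivity (word_sign x * ((-1) ^+ ncells l * (((-1) ^+ j * (-1) ^+ j) * ((-1) ^+ t * (-1) ^+ t)  * (S - R)))).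
  by rewrite sj st !mul1r.
ring.
Qed.

Lemma insertion_left_end x z :
  ins 1 (link true false) x z = word_sign x * item_vector z ((true, (true, false)) :: items x).
Proof.
rewrite insertionE insertion_coloursE /item_vector /word_vector.
have -> : substitute 1 (colours (link true false)) (colours x)
   = colours (of_items ((true, (true, false)) :: items x)).
  by rewrite /substitute /= cats0.
case: (colours z == _); last by rewrite mulr0.
have -> : insertion_forms 1 (link true false) x = singles (edge 0 :: map (shift_cell 1) (cells x)) by [].
rewrite form_value_singles.
rewrite (@interleaved_word_eval x (fun r => word_coef (edge 0 :: map (shift_cell 1) r) z)); last first.
  exact: (alternating_map _ (alternating_cons (edge 0) (word_coef_alternating K z))).
congr (_ * word_coef _ _).
rewrite /interleaved_word map_cat map_nseq shift_interleaved //=.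
by case: (x) => -[c t] l.
Qed.

Lemma insertion_right_end x z :
  ins 0 (link false true) x z
    = word_sign x * (sg x * item_vector z (rcons (items x) (true, (true, false)))).
Proof.
rewrite insertionE insertion_coloursE /item_vector /word_vector.
have -> : substitute 0 (colours (link false true)) (colours x)
   = colours (of_items (rcons (items x) (true, (true, false)))).
  by rewrite /substitute /colours /= !map_rcons cats1.
case: (colours z == _); last by rewrite !mulr0.
have -> : insertion_forms 0 (link false true) x = singles (edge (size x.2) :: cells x).
  rewrite /insertion_forms /singles /=; congr (_ :: map _ _).
  by rewrite -[RHS]map_id; apply: eq_map => -[].
rewrite form_value_singles.
have hw := word_coef_alternating K z.
rewrite (@interleaved_word_eval x (fun r => word_coef (edge (size x.2) :: r) z)); last first.
  exact: (alternating_cons _ hw).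
congr (_ * _).
have := alternating_move [::] (interleaved_word x) (edge (size x.2)) [::] hw.
rewrite cats0 (perm_size (perm_interleaved_word x)) /= => h.
have -> : interleaved_word (of_items (rcons (items x) (true, (true, false))))
   = interleaved_word x ++ [:: edge (size x.2)].
  by rewrite /interleaved_word /= -cats1 interleaved_cat /= catA.
rewrite h mulrA -exprD addnn -muln2 exprM sqrr_sign mul1r //.
Qed.

Definition delta a b : K := derivation a (fun l => (l == b)%:R).

(** The black vertices added by mu at both ends cancel the end terms which are left
    by the splittings. *)
Theorem bamboo_diff_delta x z :
  bamboo_diff K x z = word_sign x * word_sign z * delta (items x) (items z).
Proof.
rewrite bamboo_diffE insertion_left_end insertion_right_end.
have -> : \sum_(v <- iota 0 (nvertices x)) \sum_(y <- splittings (black x v)) ins v x y z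
   = - (word_sign x * ((-1) ^+ ncells (items x) * raw_splitting (items x) (item_vector z))).
  exact: (@sum_splittings x z [::] (items x) erefl).
rewrite raw_splittingE ncells_items.
have ss : sg x * sg x = 1 by rewrite -exprD addnn -muln2 exprM sqrr_sign.
transitivity (word_sign x * derivation (items x) (item_vector z)).
  set a := item_vector z _; set c := item_vector z (rcons _ _); set D := derivation _ _.
  rewrite exprS mulN1r.
  transitivity (word_sign x * (a + sg x * c - (sg x * sg x) * (a - D + sg x * c))); first by ring.
  rewrite ss; ring.
rewrite -mulrA; congr (_ * _); rewrite -derivationZ; apply: derivation_ext_head => w m _.
rewrite -(of_itemsK w m) item_vectorE (inj_eq (can_inj itemsK)) eq_sym.
by case: eqP => [->|]; rewrite ?mulr0.
Qed.

End WordDifferential.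

(** * Completeness of the twisted operad and of its homology *)

Section TwistedOperad.
Variable K : fieldType.

(** The derivation of the word of a bamboo only produces words of bamboos: their
    first item is again joined to the virtual predecessor. *)
Lemma derivation_expand (x : bamboo) (g : seq item -> K) N : (nvertices x < N)%N ->
  derivation (items x) g
    = \sum_(p <- bamboo_list N) delta K (items x) (items p) * g (items p).
Proof.
move=> xN; rewrite /items (@derivation_ext_head K x.1 x.2 g (fun m =>
    \sum_(p <- bamboo_list N) g (items p) * (m == items p)%:R)) -/(items x).
  by rewrite derivation_sum; apply: eq_bigr => p _; rewrite derivationZ mulrC.
move=> w m sm; rewrite -(of_itemsK w m); set q := of_items _.
rewrite (eq_bigr (fun p => (p == q)%:R * g (items p))).
  rewrite sum_delta ?uniq_bamboo_list ?mem_bamboo_list //.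
  by rewrite /q /nvertices /= sm.
by move=> p _; rewrite (inj_eq (can_inj itemsK)) eq_sym mulrC.
Qed.

Lemma bamboo_diff_square (x z : bamboo) N : (nvertices z <= N)%N ->
  \sum_(p <- bamboo_list N) bamboo_diff K x p * bamboo_diff K p z = 0.
Proof.
move=> zN; have [xN|Nx] := ltnP (nvertices x) N; last first.
  rewrite big1 // => p _.
  have [->|/bamboo_diff_supp[_ _ _ e]] := eqVneq (bamboo_diff K x p) 0; first by rewrite mul0r.
  have [->|/bamboo_diff_supp[_ _ _ e']] := eqVneq (bamboo_diff K p z) 0; first by rewrite mulr0.
  by move: zN; rewrite e' e; lia.
transitivity (word_sign K x * word_sign K z *
    derivation (items x) (fun m => derivation m (fun l => (l == items z)%:R) : K)).
  rewrite (derivation_expand _ xN) mulr_sumr; apply: eq_bigr => p _.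
  rewrite !bamboo_diff_delta -/(delta K _ _).
  transitivity (word_sign K x * word_sign K z * (word_sign K p * word_sign K p)
     * (delta K (items x) (items p) * delta K (items p) (items z))); first by ring.
  by rewrite word_sign_sqr mulr1.
by rewrite derivation_square mulr0.
Qed.

Theorem bamboo_differential : differential_constants bamboo_arity bamboo_degree
  bamboo_weight (@bamboo_coef K) nvertices bamboo_list (@bamboo_diff K).
Proof.
split.
- by move=> x z /bamboo_diff_supp[-> -> -> ->].
- exact: bamboo_diff_square.
- exact: bamboo_derivation.
Qed.

Theorem TwncBV_complete : is_complete_dgoperad (TwncBV K).
Proof.
exact: (series_dgoperad_complete _ (bamboo_structure K) bamboo_differential).
Qed.

Lemma scoef_diff_Tw n d e (h : e + 1 = d) (x : TwncBV K n d) z N : (nvertices z <= N)%N ->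
  scoef (dg_diff h x : series K bamboo_arity bamboo_degree n e) z
    = \sum_(p <- bamboo_list N) scoef x p * bamboo_diff K p z.
Proof. by move=> zN; apply: (scoef_diff (bamboo_structure K) bamboo_differential). Qed.

(** The differential raises the weight by exactly one, so that a limit of
    boundaries can be lifted weight by weight. *)
Lemma Tw_closed_boundaries n d (x : TwncBV K n d) : is_cycle x ->
  (forall k, exists2 y, is_boundary y & op_fil k (x - y)) -> is_boundary x.
Proof.
move=> _ hx.
have /choice[y hy] : forall k, exists y : TwncBV K n (d + 1),
    op_fil k (x - dg_diff (erefl (d + 1)) y).
  by move=> k; have [_ [y <-] h] := hx k; exists y.
exists (ser_of bamboo_arity bamboo_degree n (d + 1)
   (fun p => scoef (y (bamboo_weight p).+2) p)).
apply: series_ext => z; rewrite (scoef_diff_Tw _ _ (leqnn _)).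
transitivity (scoef (dg_diff (erefl (d + 1)) (y (bamboo_weight z).+1)
    : series K bamboo_arity bamboo_degree n d) z).
  rewrite (scoef_diff_Tw _ _ (leqnn _)); apply: eq_bigr => p _.
  rewrite scoef_ser_of; last by move/scoef_supp.
  have [->|/bamboo_diff_supp[_ _ -> _]] := eqVneq (bamboo_diff K p z) 0; first by rewrite !mulr0.
  by [].
apply/esym/eqP; rewrite -subr_eq0 -scoefB; apply/eqP.
by have /filP := hy (bamboo_weight z).+1; apply.
Qed.

Theorem homology_Tw_complete : is_complete_operad (homology (TwncBV K)).
Proof. exact: (homology_complete TwncBV_complete Tw_closed_boundaries). Qed.

End TwistedOperad.

(** * An acyclic matching of words *)

Section Matching.
Variable K : fieldType.
Implicit Types (l a b : seq item) (v : vertex) (j s : bool).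

Notation delta := (delta K).

Lemma derivation_head i a b :
  derivation a (fun m => (i :: m == b)%:R)
    = if b is i' :: b' then (i == i')%:R * delta a b' else 0 :> K.
Proof.
case: b => [|i' b']; first by rewrite derivation0.
rewrite /delta -derivationZ; apply: derivation_ext => m _.
by rewrite eqseq_cons -mulnb natrM.
Qed.

Lemma deltaE j c t l b : delta ((j, (c, t)) :: l) b =
  (if j then 0
   else (((true, (true, false)) :: (false, (c, t)) :: l) == b)%:R
        + (((false, (true, false)) :: (true, (c, t)) :: l) == b)%:R)
  + (-1) ^+ (~~ j) *
     ((if c && ~~ t then (((j, (true, false)) :: (true, (true, false)) :: l) == b)%:R else 0)
      + (if ~~ c && t then (((j, (true, true)) :: (true, (false, false)) :: l) == b)%:R
                          - (((j, (false, false)) :: (true, (true, true)) :: l) == b)%:R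
         else 0))
  + (-1) ^+ (j + t) * (if b is i' :: b' then ((j, (c, t)) == i')%:R * delta l b' else 0).
Proof. by rewrite /delta /= derivation_head. Qed.

Lemma delta_supp j v l b : delta ((j, v) :: l) b != 0 ->
  [\/ ~~ j /\ (b = (true, (true, false)) :: (false, v) :: l \/
               b = (false, (true, false)) :: (true, v) :: l),
      v = (true, false) /\ b = (j, (true, false)) :: (true, (true, false)) :: l,
      v = (false, true) /\ (b = (j, (true, true)) :: (true, (false, false)) :: l \/
               b = (j, (false, false)) :: (true, (true, true)) :: l)
    | exists2 b', b = (j, v) :: b' & delta l b' != 0].
Proof.
have nzD (p q : K) : p + q != 0 -> p != 0 \/ q != 0.
  by have [->|] := eqVneq p 0; rewrite ?add0r; [right|left].
have nzM (p q : K) : p * q != 0 -> q != 0.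
  by have [->|] := eqVneq q 0; rewrite ?mulr0 ?eqxx.
have nzB (P : bool) : (P%:R : K) != 0 -> P by case: P; rewrite ?eqxx.
have nz0 : (0 : K) != 0 -> False by rewrite eqxx.
case: v => c t; rewrite deltaE.
case/nzD => [/nzD[|/nzM /nzD[]]|/nzM].
- case: j => [/nz0 //|/nzD[] /nzB/eqP e]; constructor 1; split=> //; [left|right];
  by rewrite -e.
- by case: c t => -[] /=; try (by move/nz0); move=> /nzB/eqP e; constructor 2; rewrite -e.
- case: c t => -[] /=; try (by move/nz0); case/nzD => [/nzB/eqP e|].
    by constructor 3; split=> //; left; rewrite -e.
  rewrite oppr_eq0 => /nzB/eqP e.
  by constructor 3; split=> //; right; rewrite -e.
case: b => [/nz0 //|i b'] h; constructor 4; exists b'; last exact: nzM h.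
by case: ((j, (c, t)) =P i) h => [-> //|_]; rewrite mul0r => /nz0.
Qed.

Lemma delta_nil b : delta [::] b = 0. Proof. by []. Qed.

Fixpoint block_parity l : bool :=
  match l with
  | (true, (true, false)) :: l' => ~~ block_parity l'
  | (false, _) :: _ => true
  | _ => false
  end.

(** Inserting a black vertex in front of a block of joined black vertices has a
    coefficient which only depends on the parity of the block and on whether it
    is followed by a break, the splittings along the block having alternating
    signs. *)
Lemma delta_insert l : delta l ((true, (true, false)) :: l) = (block_parity l)%:R.
Proof.
elim: l => [//|[j [c t]] l IH]; rewrite deltaE.
rewrite !eqseq_cons !xpair_eqE eqxx.
case: j; case: c; case: t => //=; rewrite ?andbF ?andbT ?subr0 ?mulr0 ?addr0 ?add0r ?mul0r ?mul1r ?expr0 ?expr1 ?mulN1r //=.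
all: rewrite ?IH ?eqxx ?mulr0 ?subr0 ?addr0 ?subr0 //.
by case: (block_parity l) => /=; rewrite ?subrr ?subr0.
Qed.

Lemma delta_parity a b : delta a b != 0 ->
  b = (true, (true, false)) :: a \/ block_parity b = block_parity a.
Proof.
elim: a b => [|[j v] a IH] b; first by rewrite delta_nil eqxx.
case/delta_supp => [[nj [->|->]]|[-> ->]|[-> [->|->]]|[b' -> /IH h]].
- by case: j nj => // _; left.
- by case: j nj => // _; right.
- by case: j; [left|right].
- by case: j; right.
- by case: j; right.
case: j => /=; last by right.
case: v => -[] [] /=; try by right.
by case: h => [->|->]; [left|right].
Qed.

Definition whites_in l : nat := count (fun i : item => ~~ i.2.1) l.

(** The rank of the matching.  A tadpole moves from a white vertex to the left
    black vertex or to the right one; the first choice creates an inversion. *)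
Fixpoint tadpole_inversions l : nat :=
  if l is i :: l' then (i.2.2 * whites_in l' + tadpole_inversions l')%N else 0%N.

Lemma delta_inversions a b : delta a b != 0 -> whites_in b = whites_in a /\
  (tadpole_inversions a <= tadpole_inversions b)%N.
Proof.
elim: a b => [|[j v] a IH] b; first by rewrite delta_nil eqxx.
case/delta_supp => [[nj [->|->]]|[-> ->]|[-> [->|->]]|[b' -> /IH [h1 h2]]];
  rewrite /= ?mul0n ?mul1n ?add0n ?h1 //; split=> //; try lia.
Qed.

(** The acyclic matching.  Reading from the left, skip the black tadpoles and the
    white vertices until one of the following occurs: a block of joined black
    vertices which can be lengthened or shortened by one (according to its
    parity and to the presence of a break after it); a white vertex with a
    tadpole, matched with a white vertex followed by a black tadpole.  The words
    in which nothing occurs are the normal forms of the commutative relation. *)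
Fixpoint matching_after l : option (bool * seq item) :=
  if block_parity l then Some (true, (true, (true, false)) :: l) else
  match l with
  | (true, (true, false)) :: l' => Some (false, l')
  | (true, (false, true)) :: l' =>
      Some (true, (true, (false, false)) :: (true, (true, true)) :: l')
  | (true, v) :: l' =>
      match l' with
      | (true, (true, true)) :: l'' =>
          if v == (false, false) then Some (false, (true, (false, true)) :: l'')
          else omap (fun p => (p.1, (true, v) :: p.2)) (matching_after l')
      | _ => omap (fun p => (p.1, (true, v) :: p.2)) (matching_after l')
      end
  | _ => None
  end.

Definition starts_with_tadpole l : bool :=
  if l is (true, (true, true)) :: _ then true else false.

Lemma matching_after_cons v l : v = (true, true) \/ v = (false, false) ->
  matching_after ((true, v) :: l) =
  if (v == (false, false)) && starts_with_tadpole l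
  then Some (false, (true, (false, true)) :: behead l)
  else omap (fun p => (p.1, (true, v) :: p.2)) (matching_after l).
Proof.
case=> ->; first by case: l => [//|[[] [[] []]] l].
by case: l => [//|[[] [[] []]] l].
Qed.

Lemma matching_after_parity l : block_parity l ->
  matching_after l = Some (true, (true, (true, false)) :: l).
Proof. by case: l => //= i l ->. Qed.

Variant matching_spec l : option (bool * seq item) -> Prop :=
| MatchInsert of block_parity l : matching_spec l (Some (true, (true, (true, false)) :: l))
| MatchRemove l' of l = (true, (true, false)) :: l' & block_parity l' :
    matching_spec l (Some (false, l'))
| MatchCommute l' of l = (true, (false, true)) :: l' :
    matching_spec l (Some (true, (true, (false, false)) :: (true, (true, true)) :: l'))
| MatchUncommute l' of l = (true, (false, false)) :: (true, (true, true)) :: l' :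
    matching_spec l (Some (false, (true, (false, true)) :: l'))
| MatchSkip v l' of l = (true, v) :: l' & v = (true, true) \/ v = (false, false)
    & ~~ ((v == (false, false)) && starts_with_tadpole l') :
    matching_spec l (omap (fun p => (p.1, (true, v) :: p.2)) (matching_after l'))
| MatchNil of l = [::] : matching_spec l None.

Lemma matching_afterP l : matching_spec l (matching_after l).
Proof.
have [bl|nb] := boolP (block_parity l).
  by rewrite matching_after_parity //; constructor.
case: l nb => [|[[] v] l] nb //; first by constructor.
have [e|ne] := eqVneq v (true, false).
  rewrite e in nb *; rewrite /= in nb *; rewrite negbK in nb.
  by rewrite nb /=; apply: MatchRemove.
have [e|ne'] := eqVneq v (false, true); first by rewrite e; apply: MatchCommute.
have hv : v = (true, true) \/ v = (false, false).
  by case: v nb ne ne' => -[] [] //; [left|right].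
rewrite matching_after_cons //; case: ifP => [/andP[/eqP ev sl]|h].
  rewrite ev; case: l sl nb => [//|[[] [[] []]] l] //= _ _.
  exact: MatchUncommute.
by apply: MatchSkip => //; rewrite h.
Qed.

Lemma matching_after_starts l s l' : matching_after l = Some (s, l') ->
  starts_with_tadpole l' = starts_with_tadpole l.
Proof.
case: (matching_afterP l) => [bl|l1 -> b1|l1 ->|l1 ->|v l1 -> hv _|->] //.
- by move=> [_ <-] /=; case: l bl => [//|[[] [[] []]] l].
- by move=> [_ <-] /=; case: l1 b1 => [//|[[] [[] []]] l1].
- by move=> [_ <-].
- by move=> [_ <-].
by case: (matching_after l1) => [[s1 l2]|//] /= [_ <-].
Qed.

Lemma matching_after_remove l : block_parity l ->
  matching_after ((true, (true, false)) :: l) = Some (false, l).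
Proof. by move=> /= ->. Qed.

Lemma matching_afterK l s l' : matching_after l = Some (s, l') ->
  matching_after l' = Some (~~ s, l).
Proof.
elim: l s l' => [//|i l IH] s l'.
case: (matching_afterP (i :: l)) => [bl|l1 [-> ->] b1|l1 [-> ->]|l1 [-> ->]|v l1 [-> <-] hv nv|] //.
- by move=> [<- <-]; rewrite matching_after_remove.
- by move=> [<- <-]; rewrite matching_after_parity.
- by move=> [<- <-].
- by move=> [<- <-].
case e : (matching_after l) => [[s1 l2]|//] /= [<- <-].
rewrite matching_after_cons // (matching_after_starts e) (negbTE nv).
by rewrite (IH _ _ e).
Qed.

Lemma matching_after_inversions l s l' : matching_after l = Some (s, l') ->
  whites_in l' = whites_in l /\ tadpole_inversions l' = tadpole_inversions l.
Proof.
elim: l s l' => [//|i l IH] s l'.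
case: (matching_afterP (i :: l)) => [bl|l1 [-> ->] b1|l1 [-> ->]|l1 [-> ->]|v l1 [-> <-] hv nv|] //.
- by move=> [_ <-].
- by move=> [_ <-].
- by move=> [_ <-]; rewrite /= ?mul0n ?mul1n.
- by move=> [_ <-]; rewrite /= ?mul0n ?mul1n.
case e : (matching_after l) => [[s1 l2]|//] /= [_ <-].
by have [h1 h2] := IH _ _ e; rewrite /= h1 h2.
Qed.

Lemma matching_after_unit a a' : matching_after a = Some (true, a') ->
  exists e : bool, delta a a' = (-1) ^+ e.
Proof.
elim: a a' => [//|i a IH] a'.
case: (matching_afterP (i :: a)) => [bl|l1 [-> ->] b1|l1 [-> ->]|l1 [-> ->]|v l1 [-> <-] hv nv|] //.
- by move=> [<-]; exists false; rewrite delta_insert bl.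
- move=> [<-]; exists true; rewrite deltaE.
  rewrite !eqseq_cons !xpair_eqE /= !eqxx /= mul0r mulr0 !addr0 !add0r.
  by rewrite expr0 mul1r.
case e : (matching_after a) => [[s1 l2]|//] /= [es <-]; rewrite es in e.
have [e1 h] := IH _ e.
case: hv => ->; rewrite deltaE eqxx mul1r h /= ?addr0 ?mulr0 ?add0r.
  by exists e1; case: (e1); ring.
by exists (~~ e1); case: (e1); ring.
Qed.

(** All the other terms of the differential of a source are sources themselves
    unless they have more inversions: this makes the matching acyclic. *)
Lemma matching_after_triangular a a' b : matching_after a = Some (true, a') ->
  delta a b != 0 ->
  [\/ b = a', exists b', matching_after b = Some (true, b')
    | (tadpole_inversions a < tadpole_inversions b)%N].
Proof.
elim: a a' b => [//|i a IH] a' b.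
case: (matching_afterP (i :: a)) => [bl|l1 [-> ->] b1|l1 [-> ->]|l1 [-> ->]|v l1 [-> <-] hv nv|] //.
- move=> [<-] /delta_parity[->|e]; first by constructor 1.
  by constructor 2; exists ((true, (true, false)) :: b); rewrite matching_after_parity ?e.
- move=> [<-] /delta_supp[[]//|[]//|[_ [->|->]]|[b' -> _]].
  + by constructor 3; rewrite /= /whites_in /=; lia.
  + by constructor 1.
  + by constructor 2; exists ((true, (false, false)) :: (true, (true, true)) :: b').
case e : (matching_after a) => [[s1 l2]|//] /= [es <-]; rewrite es in e.
case/delta_supp => [[]//|[hv' _]|[hv' _]|[b' -> hb]]; try by move: hv; rewrite hv' => -[].
have [wb ib] := delta_inversions hb.
have inv3 : (tadpole_inversions a < tadpole_inversions b' ->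
    tadpole_inversions ((true, v) :: a) < tadpole_inversions ((true, v) :: b'))%N.
  by rewrite /= wb ltn_add2l.
have [h1|[b2 h2]|h3] := IH _ _ e hb.
- by constructor 1; rewrite h1.
- have [sb|nsb] := boolP ((v == (false, false)) && starts_with_tadpole b').
    constructor 3; apply: inv3; move: sb nv => /andP[-> sb] /= na.
    case: a na hb e {IH wb ib} => [//|[j w] a] na hb e.
    case/delta_supp: hb => [[nj [eb|eb]]|[ew eb]|[ew [eb|eb]]|[b1 eb _]]; rewrite eb in sb h2 *.
    + by [].
    + by case: (j) nj.
    + by case: (j) sb.
    + by rewrite ew /= /whites_in /=; lia.
    + by case: (j) sb.
    + by move: na sb; rewrite /=; case: (j); case: (w) => -[] [].
  constructor 2; exists ((true, v) :: b2).
  by rewrite matching_after_cons // (negbTE nsb) h2.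
by constructor 3; exact: inv3.
Qed.

Lemma matching_after_critical l : matching_after l = None ->
  exists k n, l = nseq k (true, (true, true)) ++ nseq n (true, (false, false)).
Proof.
elim: l => [|i l IH]; first by exists 0%N, 0%N.
case: (matching_afterP (i :: l)) => [bl|l1 [-> ->] b1|l1 [-> ->]|l1 [-> ->]|v l1 [-> <-] hv nv|] //.
case e : (matching_after l) => [//|] /= _.
have [k [n el]] := IH e; case: hv nv => ->; rewrite el => nv.
  by exists k.+1, n.
case: k el nv => [|k] el //= _.
by exists 0%N, n.+1.
Qed.

End Matching.

(** * The matching at the left end *)

Section TopMatching.
Variable K : fieldType.
Implicit Types (l a b : seq item) (v : vertex) (j s : bool).

Notation delta := (delta K).

Definition head_joined l : bool := if l is (true, _) :: _ then true else false.

Definition starts_with_isolated l : bool :=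
  if l is (true, (true, false)) :: (false, _) :: _ then true else false.

(** At the left end, a single black vertex followed by a break cannot be
    shortened; then the block of black vertices after the break is lengthened or
    shortened instead.  Two isolated black vertices are left unmatched. *)
Definition matching l : option (bool * seq item) :=
  match l with
  | (true, (true, false)) :: (false, v) :: l' =>
      if block_parity ((true, v) :: l') then
        if l' is (_, v') :: l'' then Some (false, (true, (true, false)) :: (false, v') :: l'')
        else None
      else Some (true, (true, (true, false)) :: (false, (true, false)) :: (true, v) :: l')
  | _ => matching_after l
  end.

Lemma matching_isolated v l :
  matching ((true, (true, false)) :: (false, v) :: l) =
      if block_parity ((true, v) :: l) then
        if l is (_, v') :: l' then Some (false, (true, (true, false)) :: (false, v') :: l')
        else None
      else Some (true, (true, (true, false)) :: (false, (true, false)) :: (true, v) :: l).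
Proof. by []. Qed.

Lemma matching_not_isolated l : ~~ starts_with_isolated l ->
  matching l = matching_after l.
Proof. by case: l => [//|[[] [[] []]] [|[[] v] l]]. Qed.

Lemma isolatedP l : starts_with_isolated l ->
  exists v l', l = (true, (true, false)) :: (false, v) :: l'.
Proof. by case: l => [//|[[] [[] []]] [//|[[] v] l]] // _; exists v, l. Qed.

Lemma matching_after_isolated l s l' : head_joined l -> ~~ starts_with_isolated l ->
  matching_after l = Some (s, l') -> head_joined l' /\ ~~ starts_with_isolated l'.
Proof.
case: (matching_afterP l) => [bl|l1 -> b1|l1 ->|l1 ->|v l1 -> hv _|->] //.
- by move=> hl _ [_ <-]; split=> //; case: l bl hl => [//|[[] v] l].
- move=> _ h [_ <-]; case: l1 b1 h => [//|[[] [[] []]] l1] //=.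
  by case: l1 => [//|[[] v] l1].
- by move=> _ _ [_ <-].
- by move=> _ _ [_ <-].
case: (matching_after l1) => [[s1 l2]|//] /= _ _ [_ <-].
by split=> //; case: hv => ->.
Qed.

Lemma matchingK l s l' : head_joined l -> matching l = Some (s, l') ->
  head_joined l' /\ matching l' = Some (~~ s, l).
Proof.
have [/isolatedP[v [m ->]] _|ni] := boolP (starts_with_isolated l); last first.
  move=> hl; rewrite matching_not_isolated // => e.
  have [hl' ni'] := matching_after_isolated hl ni e; split=> //.
  by rewrite matching_not_isolated // (matching_afterK e).
rewrite matching_isolated.
have [bp|bp] := boolP (block_parity ((true, v) :: m)); last first.
  move=> [<- <-]; split=> //; rewrite matching_isolated.
  by rewrite [block_parity (_ :: (true, v) :: m)](_ : _ = ~~ block_parity ((true, v) :: m)) // bp.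
case: m bp => [//|[j v'] m] bp [<- <-]; split=> //; rewrite matching_isolated.
by case: v bp => -[] [] //=; case: j => //= bp; rewrite (negbTE bp).
Qed.

Lemma matching_inversions l l' : matching l = Some (true, l') ->
  tadpole_inversions l' = tadpole_inversions l.
Proof.
have [/isolatedP[v [m ->]]|ni] := boolP (starts_with_isolated l); last first.
  by rewrite matching_not_isolated // => /matching_after_inversions[].
rewrite matching_isolated; case: ifP => _; first by case: m => [//|[]].
by move=> [<-].
Qed.

Lemma delta_head j v a b : delta ((j, v) :: a) b != 0 ->
  exists j' v' b', b = (j', v') :: b' /\ (~~ j' -> ~~ j).
Proof.
case/delta_supp => [[nj [->|->]]|[_ ->]|[_ [->|->]]|[b' -> _]];
  by do 3!eexists; split; first reflexivity.
Qed.

Lemma delta_isolated a b : head_joined a -> delta a b != 0 ->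
  starts_with_isolated b -> starts_with_isolated a.
Proof.
case: a => [//|[[] v] a] // _ /delta_supp[[]//|[-> ->]|[-> [->|->]]|[b' -> hb]] //.
case: v => -[] [] //; case: b' hb => [//|[[] w] b'] // hb _.
case: a hb => [|[j u] a]; first by rewrite delta_nil eqxx.
by move=> /delta_head[j' [v' [b1 [[<- _ _] /(_ isT)]]]]; case: j.
Qed.

Lemma delta_isolated_supp v l b :
  block_parity ((true, v) :: l) = false ->
  delta ((true, (true, false)) :: (false, v) :: l) b != 0 ->
  b = (true, (true, false)) :: (false, (true, false)) :: (true, v) :: l \/
  exists w b', b = (true, (true, false)) :: (false, w) :: b' /\
    block_parity ((true, w) :: b') = false.
Proof.
move=> bp hb; have nb : b <> (true, (true, false)) :: (true, (true, false)) :: (false, v) :: l.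
  by move=> e; move: hb; rewrite e delta_insert eqxx.
case/delta_supp: hb nb => [[]//|[_ ->] /(_ erefl) //|[]//|[b' -> hb] nb].
case/delta_supp: hb nb => [[_ [->|->]]|[ev ->]|[ev [->|->]]|[b3 -> hb]] nb //.
- by left.
- by left; rewrite ev.
- by right; do 2!eexists; split; first reflexivity.
- by right; do 2!eexists; split; first reflexivity.
have [->|e] := delta_parity hb.
  case: v bp nb => -[] [] bp nb; try by right; do 2!eexists; split; first reflexivity.
  by left.
right; exists v, b3; split=> //.
by move: bp; rewrite /=; case: (v) => -[] []; rewrite ?e.
Qed.

Lemma matching_triangular a a' b : head_joined a -> matching a = Some (true, a') ->
  delta a b != 0 ->
  [\/ b = a', exists b', matching b = Some (true, b')
    | (tadpole_inversions a < tadpole_inversions b)%N].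
Proof.
move=> ha; have [/isolatedP[v [m ->]]|ni] := boolP (starts_with_isolated a); last first.
  rewrite matching_not_isolated // => e hb.
  have nib : ~~ starts_with_isolated b by apply: contra ni; exact: delta_isolated.
  have [h1|[b2 h2]|h3] := matching_after_triangular e hb.
  - by constructor 1.
  - by constructor 2; exists b2; rewrite matching_not_isolated.
  - by constructor 3.
rewrite matching_isolated; case: ifP => [_|bp]; first by case: m => [//|[]].
move=> [<-] /(delta_isolated_supp bp)[->|[w [b' [-> e]]]]; first by constructor 1.
by constructor 2; rewrite matching_isolated e; eexists.
Qed.

Lemma matching_unit a a' : matching a = Some (true, a') ->
  exists e : bool, delta a a' = (-1) ^+ e.
Proof.
have [/isolatedP[v [m ->]]|ni] := boolP (starts_with_isolated a); last first.
  by rewrite matching_not_isolated // => /matching_after_unit.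
rewrite matching_isolated; case: ifP => [_|bp]; first by case: m => [//|[]].
move=> [<-]; exists true; case: v bp => c t bp.
rewrite !deltaE !eqseq_cons !xpair_eqE !eqxx /=.
case: c t bp => -[] /= bp; rewrite ?delta_insert ?(negbFE bp) /= ?andbF; ring.
Qed.

(** The exceptional rule at the left end only adds gamma to the words left over by
    [matching_after]. *)
Lemma matching_critical l : head_joined l -> matching l = None ->
  l = [:: (true, (true, false)); (false, (true, false))] \/
  exists k n, l = nseq k (true, (true, true)) ++ nseq n (true, (false, false)).
Proof.
have [/isolatedP[v [m ->]] _|ni _] := boolP (starts_with_isolated l); last first.
  by rewrite matching_not_isolated // => /matching_after_critical; right.
rewrite matching_isolated; case: ifP => // bp; case: m bp => [|[]//] bp _; left.
by case: v bp => -[] [].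
Qed.

Lemma derivation_critical l f : head_joined l -> matching l = None ->
  derivation l f = 0 :> K.
Proof.
move=> hl /(matching_critical hl)[->|[k [n ->]]]; first by rewrite /=; ring.
elim: k f => [|k IH] f /=; last by rewrite IH; ring.
by elim: n f => [|n IH] f //=; rewrite IH; ring.
Qed.

End TopMatching.

(** * Algebraic discrete Morse theory *)

Section MorseReduction.
Variables (K : fieldType) (X : choiceType) (sz : X -> nat) (lst : nat -> seq X).
Variable dcf : X -> X -> K.
Hypothesis lst_uniq : forall N, uniq (lst N).
Hypothesis mem_lst : forall N x, (x \in lst N) = (sz x <= N)%N.
Hypothesis dcf_sz : forall x z, dcf x z != 0 -> (sz x <= sz z)%N.

(* [mate a = Some (true, b)] when [a] is matched with the term [b] of its
   differential, and then [mate b = Some (false, a)]. *)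
Variables (mate : X -> option (bool * X)) (rank : X -> nat).
Hypothesis mateK : forall s a b, mate a = Some (s, b) -> mate b = Some (~~ s, a).
Hypothesis mate_unit : forall a b, mate a = Some (true, b) -> dcf a b != 0.
Hypothesis mate_rank : forall a b, mate a = Some (true, b) -> rank b = rank a.
Hypothesis triangular : forall a a' b, mate a = Some (true, a') -> dcf a b != 0 ->
  [\/ b = a', exists b', mate b = Some (true, b') | (rank a < rank b)%N].

Definition boundary (F : X -> K) (z : X) : K := \sum_(p <- lst (sz z)) F p * dcf p z.

Lemma boundaryE F z N : (sz z <= N)%N ->
  boundary F z = \sum_(p <- lst N) F p * dcf p z.
Proof.
move=> zN; rewrite [RHS](bigID (fun p => (sz p <= sz z)%N)) /= [X in _ + X]big1 ?addr0.
  rewrite -[RHS]big_filter; apply: perm_big; apply: uniq_perm.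
  - exact: lst_uniq.
  - by rewrite filter_uniq.
  move=> p; rewrite mem_filter !mem_lst; case: leqP => //= pz.
  by rewrite (leq_trans pz).
move=> p pz; have [->|/dcf_sz h] := eqVneq (dcf p z) 0; first by rewrite mulr0.
by rewrite h in pz.
Qed.

Lemma boundary_boundary F z :
  (forall p z N, (sz z <= N)%N -> \sum_(q <- lst N) dcf p q * dcf q z = 0) ->
  boundary (boundary F) z = 0.
Proof.
move=> dd; set L := lst (sz z).
transitivity (\sum_(p <- L) (\sum_(q <- L) F q * dcf q p) * dcf p z).
  rewrite /boundary big_seq [RHS]big_seq; apply: eq_bigr => p; rewrite mem_lst => pz.
  by congr (_ * _); exact: boundaryE.
rewrite (double_sum_comp L F dcf dcf z) big1 // => p _.
by rewrite dd ?mulr0.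
Qed.

Definition is_source a : bool := if mate a is Some (true, _) then true else false.

Lemma source_triangular a b p : mate a = Some (true, b) -> is_source p ->
  dcf p b != 0 -> p = a \/ (rank p < rank a)%N.
Proof.
rewrite /is_source => ab; case e : (mate p) => [[[] p']|] // _ pb.
have ba := mateK ab.
have [ebp|[b' h]|h] := triangular e pb.
- by left; have := mateK e; rewrite -ebp ba => -[].
- by rewrite ba in h.
- by right; rewrite -(mate_rank ab).
Qed.

Section Solution.
Variable G : X -> K.

(** The coefficients of the sources, by increasing rank: the coefficient of [a] is
   chosen so that the boundary takes the value [G b] at the mate [b] of [a], the
   sources of smaller rank being known. *)
Fixpoint partial_solution k a : K :=
  if k is k'.+1 then
    partial_solution k' a +
    (if mate a is Some (true, b) then
       if rank a == k' then (dcf a b)^-1 * (G b - boundary (partial_solution k') b) else 0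
     else 0)
  else 0.

Definition solution a : K := partial_solution (rank a).+1 a.

Lemma partial_solutionE k a :
  partial_solution k a = if (rank a < k)%N then solution a else 0.
Proof.
elim: k => //= k IH; rewrite ltnS leq_eqVlt.
have [e|ne] := eqVneq (rank a) k; first by rewrite /solution e /= e eqxx.
have -> : (if mate a is Some (true, b) then 0 else 0) = 0 :> K.
  by case: (mate a) => [[[] b]|].
by rewrite IH addr0.
Qed.

Lemma solution_source a : solution a != 0 -> is_source a.
Proof.
rewrite /solution /= /is_source partial_solutionE ltnn add0r.
by case: (mate a) => [[[] b]|]; rewrite ?eqxx.
Qed.

Lemma boundary_solution a b : mate a = Some (true, b) -> boundary solution b = G b.
Proof.
move=> ab; have ab0 := mate_unit ab; set k := rank a.
have ab_lst : a \in lst (sz b) by rewrite mem_lst dcf_sz.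
transitivity (boundary (partial_solution k) b + solution a * dcf a b).
  rewrite /boundary (bigD1_seq a) //= [in RHS](bigD1_seq a) //= partial_solutionE.
  rewrite ltnn mul0r add0r addrC; congr (_ + _); apply: eq_bigr => p pa.
  rewrite partial_solutionE; case: ltnP => // kp.
  have [->|/solution_source sp] := eqVneq (solution p) 0; first by [].
  have [->|pb] := eqVneq (dcf p b) 0; first by rewrite !mulr0.
  (* The other sources whose boundary contains [b] have smaller rank. *)
  have [e|] := source_triangular ab sp pb; first by rewrite e eqxx in pa.
  by rewrite ltnNge kp.
rewrite /solution /= partial_solutionE ltnn add0r ab eqxx -/k.
by rewrite mulrC mulrA divff // mul1r addrC subrK.
Qed.

End Solution.

Lemma source_unique (F : X -> K) : (forall a, F a != 0 -> is_source a) ->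
  (forall a b, mate a = Some (true, b) -> boundary F b = 0) -> forall a, F a = 0.
Proof.
move=> sF dF a; have [k] := ubnP (rank a); elim: k a => // k IH a.
rewrite ltnS => ak; apply/eqP; apply: contraT => Fa.
have := sF _ Fa; rewrite /is_source; case ab : (mate a) => [[[] b]|] // _.
have := dF _ _ ab; rewrite /boundary (bigD1_seq a) //=; last first.
  by rewrite mem_lst dcf_sz // mate_unit.
rewrite big1 => [/eqP|p pa].
  by rewrite addr0 mulf_eq0 (negbTE (mate_unit ab)) orbF (negbTE Fa).
have [->|Fp] := eqVneq (F p) 0; first by rewrite mul0r.
have [->|pb] := eqVneq (dcf p b) 0; first by rewrite mulr0.
have [e|h] := source_triangular ab (sF _ Fp) pb; first by rewrite e eqxx in pa.
by rewrite IH ?mul0r // (leq_trans h).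
Qed.

Hypothesis critical : forall a z, mate a = None -> dcf a z = 0.

(** Subtracting the boundary which agrees with [G] on all targets leaves a cycle
    without targets; its part on the sources has no boundary on the targets,
    hence vanishes by triangularity. *)
Theorem morse_reduction (G : X -> K) : (forall z, boundary G z = 0) ->
  (forall F z, boundary (boundary F) z = 0) ->
  exists2 F : X -> K, (forall a, F a != 0 -> is_source a) &
    forall z, G z - boundary F z != 0 -> mate z = None.
Proof.
move=> dG dd; exists (solution G); first exact: solution_source.
pose H z := G z - boundary (solution G) z.
have dH z : boundary H z = 0.
  transitivity (boundary G z - boundary (boundary (solution G)) z).
    by rewrite /boundary -sumrB; apply: eq_bigr => p _; rewrite mulrBl.
  by rewrite dG dd subr0.
pose S a := if is_source a then H a else 0.
have HT a b : mate a = Some (true, b) -> H b = 0.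
  by move=> ab; rewrite /H (boundary_solution G ab) subrr.
have S0 : forall a, S a = 0.
  apply: source_unique => [a|a b ab]; first by rewrite /S; case: ifP; rewrite ?eqxx.
  rewrite -(dH b); apply: eq_bigr => p _; rewrite /S; case: ifP => // ns.
  case e : (mate p) => [[s q]|]; last by rewrite critical // !mulr0.
  case: s e => e; first by move: ns; rewrite /is_source e.
  by rewrite (HT _ _ (mateK e)) !mul0r.
move=> z; rewrite -/(H z) => Hz; case e : (mate z) => [[s q]|//].
case: s e => e; last by rewrite (HT _ _ (mateK e)) eqxx in Hz.
by have := S0 z; rewrite /S /is_source e => h; rewrite h eqxx in Hz.
Qed.

End MorseReduction.

Section TwistedCycles.
Variable K : fieldType.
Implicit Types (a b z p : bamboo).

Definition bamboo_mate z : option (bool * bamboo) :=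
  omap (fun u : bool * seq item => (u.1, of_items u.2)) (matching (items z)).

Lemma bamboo_mateP z s b : bamboo_mate z = Some (s, b) ->
  matching (items z) = Some (s, items b).
Proof.
rewrite /bamboo_mate; case e : (matching _) => [[s' l]|//] /= [<- <-].
have [hl _] := matchingK (isT : head_joined (items z)) e.
by case: l hl {e} => [//|[[] v] l].
Qed.

Lemma bamboo_mateE z s b : matching (items z) = Some (s, items b) ->
  bamboo_mate z = Some (s, b).
Proof. by rewrite /bamboo_mate => ->; rewrite /= itemsK. Qed.

Lemma bamboo_mate_none z : bamboo_mate z = None -> matching (items z) = None.
Proof. by rewrite /bamboo_mate; case: (matching _). Qed.

Lemma bamboo_diff_neq0 a b : (bamboo_diff K a b != 0) = (delta K (items a) (items b) != 0).
Proof.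
rewrite bamboo_diff_delta mulf_eq0 mulf_eq0 /word_sign !signr_eq0 //.
Qed.

Lemma bamboo_diff_critical a z : bamboo_mate a = None -> bamboo_diff K a z = 0.
Proof.
move=> /bamboo_mate_none h; rewrite bamboo_diff_delta /delta derivation_critical //.
by rewrite mulr0.
Qed.

(** The differential being homogeneous, the solution of [morse_reduction] can be
    restricted to the given arity and degree. *)
Theorem cycle_reduction n d (x : TwncBV K n d) : is_cycle x ->
  exists y : TwncBV K n (d + 1), forall z,
    scoef (x - dg_diff (erefl (d + 1)) y : series K bamboo_arity bamboo_degree n d) z != 0 ->
    matching (items z) = None.
Proof.
move=> cx.
have dsz a z : bamboo_diff K a z != 0 -> (nvertices a <= nvertices z)%N.
  by move=> /bamboo_diff_supp[_ _ _ ->].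
have dx z : boundary nvertices bamboo_list (@bamboo_diff K) (scoef x) z = 0.
  rewrite /boundary -(scoef_diff_Tw (subrK 1 d) x (leqnn _)).
  by rewrite (cycle_diff _ cx) scoef0.
have hK s a b : bamboo_mate a = Some (s, b) -> bamboo_mate b = Some (~~ s, a).
  move=> /bamboo_mateP e.
  by have [_ h] := matchingK (isT : head_joined (items a)) e; apply: bamboo_mateE.
have hU a b : bamboo_mate a = Some (true, b) -> bamboo_diff K a b != 0.
  by move=> /bamboo_mateP/(@matching_unit K)[e h]; rewrite bamboo_diff_neq0 h signr_eq0.
have hR a b : bamboo_mate a = Some (true, b) ->
    tadpole_inversions (items b) = tadpole_inversions (items a).
  by move=> /bamboo_mateP/matching_inversions.
have hT a a' b : bamboo_mate a = Some (true, a') -> bamboo_diff K a b != 0 ->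
    [\/ b = a', exists b', bamboo_mate b = Some (true, b')
      | (tadpole_inversions (items a) < tadpole_inversions (items b))%N].
  move=> /bamboo_mateP e; rewrite bamboo_diff_neq0 => hb.
  have [h|[l h]|h] := matching_triangular (isT : head_joined (items a)) e hb.
  - by constructor 1; apply: (can_inj itemsK).
  - by constructor 2; exists (of_items l); rewrite /bamboo_mate h.
  - by constructor 3.
have hD (G : bamboo -> K) z : boundary nvertices bamboo_list (@bamboo_diff K)
    (boundary nvertices bamboo_list (@bamboo_diff K) G) z = 0.
  apply: boundary_boundary => //.
  - exact: uniq_bamboo_list.
  - exact: mem_bamboo_list.
  exact: bamboo_diff_square.
have [F _ hF] := morse_reduction uniq_bamboo_list mem_bamboo_list dsz hK hU hR hT
  bamboo_diff_critical dx hD.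
exists (ser_of bamboo_arity bamboo_degree n (d + 1) (fun a =>
    if (bamboo_arity a == n) && (bamboo_degree a == d + 1) then F a else 0)) => z hz.
have [xn xd] := scoef_supp hz; apply: bamboo_mate_none; apply: hF.
move: hz; rewrite scoefB (scoef_diff_Tw _ _ (leqnn _)) => hz.
rewrite /boundary (eq_bigr (fun p => scoef (ser_of bamboo_arity bamboo_degree n (d + 1) (fun a =>
    if (bamboo_arity a == n) && (bamboo_degree a == d + 1) then F a else 0)) p * bamboo_diff K p z)) //.
move=> p _; rewrite scoef_ser_of; last first.
  by case: ifP => [/andP[/eqP -> /eqP ->]|]; rewrite ?eqxx.
have [->|/bamboo_diff_supp[ea ed _ _]] := eqVneq (bamboo_diff K p z) 0; first by rewrite !mulr0.
by rewrite ea ed xn xd !eqxx.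
Qed.

End TwistedCycles.

(** * The map from trees to bamboos *)

Section TreeWords.
Implicit Types (t s l r u : tree).

(** A node joins the bamboos of its subtrees by an edge.  Trees are read in prefix
    order, so that the edge comes first in the word of its cells. *)
Fixpoint tree_colours t : seq bool :=
  match t with
  | Input => [:: false]
  | Gamma => [:: true; true]
  | Zeta => [:: true]
  | Node l r => tree_colours l ++ tree_colours r
  end.

Fixpoint tree_word t : seq cell :=
  match t with
  | Input | Gamma => [::]
  | Zeta => [:: tadpole 0]
  | Node l r => edge (size (tree_colours l)).-1
      :: tree_word l ++ map (shift_cell (size (tree_colours l))) (tree_word r)
  end.

Fixpoint tree_items t : seq item :=
  match t with
  | Input => [:: (true, (false, false))]
  | Gamma => [:: (true, (true, false)); (false, (true, false))]
  | Zeta => [:: (true, (true, true))]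
  | Node l r => tree_items l ++ tree_items r
  end.

Definition tree_bamboo t : bamboo := of_items (tree_items t).

Lemma size_tree_colours_gt0 t : (0 < size (tree_colours t))%N.
Proof. by elim: t => //= l IHl r _; rewrite size_cat ltn_addr. Qed.

Lemma leaves_le_colours t : (leaves t <= size (tree_colours t))%N.
Proof. by elim: t => //= l IHl r IHr; rewrite size_cat leq_add. Qed.

Lemma count_negb_tree_colours t : count negb (tree_colours t) = inputs t.
Proof. by elim: t => //= l IHl r IHr; rewrite count_cat IHl IHr. Qed.

Lemma count_id_tree_colours t : count id (tree_colours t) = tree_weight 2 t.
Proof. by elim: t => //= l IHl r IHr; rewrite count_cat IHl IHr. Qed.

Lemma tree_weight_le w t : (w <= 2)%N -> (tree_weight w t <= tree_weight 2 t)%N.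
Proof. by move=> w2; elim: t => //= l IHl r IHr; rewrite leq_add. Qed.

Lemma size_tree_word t : size (tree_word t) = odd_generators t.
Proof. by elim: t => //= l IHl r IHr; rewrite size_cat size_map IHl IHr. Qed.

Lemma tree_degreeE t : tree_degree t =
  (size (tree_word t))%:Z - (count id (tree_colours t)).*2%:Z.
Proof.
elim: t => //= l -> r ->; rewrite count_cat size_cat size_map; lia.
Qed.

Lemma tree_items_head t : exists v m, tree_items t = (true, v) :: m.
Proof. by elim: t => [|||l [v [m /= ->]] r _]; do 2!eexists; reflexivity. Qed.

Lemma items_tree_bamboo t : items (tree_bamboo t) = tree_items t.
Proof. by rewrite /tree_bamboo; have [v [m ->]] := tree_items_head t. Qed.

Lemma map_tree_items t : [seq p.2.1 | p <- tree_items t] = tree_colours t.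
Proof. by elim: t => //= l IHl r IHr; rewrite map_cat IHl IHr. Qed.

Lemma colours_tree_bamboo t : colours (tree_bamboo t) = tree_colours t.
Proof.
rewrite /tree_bamboo -map_tree_items; have [v [m ->]] := tree_items_head t.
exact: colours_of_items.
Qed.

Lemma interleaved_tree_items k t : (0 < k)%N ->
  perm_eq (interleaved k (tree_items t)) (edge k.-1 :: map (shift_cell k) (tree_word t)).
Proof.
elim: t k => [|||l IHl r IHr] k k0 //=; first by rewrite addn0.
rewrite interleaved_cat -(size_map (fun p => p.2.1)) map_tree_items.
have l0 := size_tree_colours_gt0 l.
apply/permP => P; rewrite count_cat (permP (IHl k k0)) (permP (IHr _ _)); last by lia.
rewrite /= map_cat count_cat -map_comp.
have -> : (k + (size (tree_colours l)).-1 = (k + size (tree_colours l)).-1)%N by lia.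
rewrite (@eq_map _ _ (shift_cell k \o shift_cell (size (tree_colours l)))
  (shift_cell (k + size (tree_colours l)))); last by move=> c; exact: shift_shift.
lia.
Qed.

Lemma shift_cell_inj v : injective (shift_cell v).
Proof. by move=> [i|i] [j|j] // [/addnI ->]. Qed.

Lemma perm_tree_word t : perm_eq (tree_word t) (cells (tree_bamboo t)).
Proof.
apply: perm_trans (perm_interleaved_word (tree_bamboo t)).
apply: (perm_map_inj (@shift_cell_inj 1)); rewrite -(perm_cons (edge 0)).
move: (interleaved_tree_items t (ltn0Sn 0)); rewrite perm_sym => h; apply: (perm_trans h).
rewrite -items_tree_bamboo {h}; case: (tree_bamboo t) => -[c b] m.
by rewrite /interleaved_word map_cat map_nseq shift_interleaved.
Qed.

Lemma tree_word_valid t : all (valid (size (tree_colours t))) (tree_word t).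
Proof.
rewrite (perm_all _ (perm_tree_word t)) -colours_tree_bamboo size_colours.
exact: valid_cells.
Qed.

(** The white vertices of the bamboo of a tree have no tadpole: grafting distributes
    no tadpole. *)
Lemma tree_word_tadpole t j : inr j \in tree_word t -> nth false (tree_colours t) j.
Proof.
rewrite (perm_mem (perm_tree_word t)) mem_cells /= => /andP[_].
rewrite -colours_tree_bamboo /has_tadpole /colours.
have : all (fun v : vertex => v.2 ==> v.1) (vertices (tree_bamboo t)).
  rewrite -[vertices _]/(map snd (items (tree_bamboo t))) items_tree_bamboo all_map.
  by elim: t => //= l IHl r IHr; rewrite all_cat IHl.
elim: (vertices _) j => [|v vs IH] [|j] //= /andP[h1 h2] h.
  by move: h1; rewrite h implyTb.
exact: IH.
Qed.

(** What becomes of a cell when a vertex without tadpole is blown up. *)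
Definition move_cell v k (c : cell) : cell :=
  match c with
  | inl j => if (j < v)%N then edge j else edge (j + k).-1
  | inr j => if (j < v)%N then tadpole j else tadpole (j + k).-1
  end.

Lemma blow_up_move v k c : c != inr v -> blow_up v k c = [:: move_cell v k c].
Proof. by case: c => j /=; [case: ifP|case: ltngtP => // ->; rewrite eqxx]. Qed.

Lemma white_positions_graft t i s : (i < inputs t)%N ->
  (nth 0%N (white_positions (tree_colours t)) i < size (tree_colours t))%N /\
  tree_colours (graft t i s)
    = substitute (nth 0%N (white_positions (tree_colours t)) i) (tree_colours t) (tree_colours s).
Proof.
elim: t i => [|||l IHl r IHr] i //=.
  by rewrite ltnS leqn0 => /eqP ->; rewrite white_positions_cons /= /substitute /= cats0.
move=> ilr; have [il|il] := ltnP i (inputs l) => /=.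
  have [h1 h2] := IHl i il; have il' : (i < count negb (tree_colours l))%N by rewrite count_negb_tree_colours.
  have [a [b [e ea ev]]] := white_position_split il'.
  rewrite h2 ev e -catA cat_cons -ea nth_white_positions !substitute_cat -!catA; split=> //.
  by rewrite !size_cat /=; lia.
have ir : (i - inputs l < inputs r)%N by lia.
have [h1 h2] := IHr _ ir; have ir' : (i - inputs l < count negb (tree_colours r))%N by rewrite count_negb_tree_colours.
have [a [b [e ea ev]]] := white_position_split ir'.
have ei : i = count negb (tree_colours l ++ a).
  by rewrite count_cat ea count_negb_tree_colours subnKC.
rewrite h2 ev e catA.
have -> : nth 0%N (white_positions ((tree_colours l ++ a) ++ false :: b)) i = size (tree_colours l ++ a).
  by rewrite [in LHS]ei nth_white_positions.
rewrite !substitute_cat -!catA; split=> //.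
by rewrite !size_cat /=; lia.
Qed.

End TreeWords.

(** * Trees are sent to cycles *)

Section TreeMap.
Variables (K : fieldType) (w : nat).
Implicit Types (t s l r u : tree) (z p q : bamboo).

Local Notation ins := (@insertion K).

Definition input_position t i : nat := nth 0%N (white_positions (tree_colours t)) i.

Lemma input_position_left l r i : (i < inputs l)%N ->
  input_position (Node l r) i = input_position l i.
Proof.
rewrite /input_position -count_negb_tree_colours => /white_position_split.
move=> [a [b [e ea ->]]]; rewrite /= e -catA cat_cons -ea.
exact: nth_white_positions.
Qed.

Lemma input_position_right l r i : (inputs l <= i)%N -> (i - inputs l < inputs r)%N ->
  input_position (Node l r) i = (size (tree_colours l) + input_position r (i - inputs l))%N.
Proof.
move=> li; rewrite /input_position -(count_negb_tree_colours r) => /white_position_split.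
move=> [a [b [e ea ->]]]; rewrite /= e catA.
have -> : i = count negb (tree_colours l ++ a).
  by rewrite count_cat ea count_negb_tree_colours subnKC.
by rewrite nth_white_positions size_cat.
Qed.

Lemma input_position_lt t i : (i < inputs t)%N -> (input_position t i < size (tree_colours t))%N.
Proof. by move=> h; have [] := white_positions_graft Input h. Qed.

Lemma move_cell_shift v (u : nat) k c : (0 < k)%N ->
  move_cell (v + u) k (shift_cell v c) = shift_cell v (move_cell u k c).
Proof.
move=> k0; case: c => j /=; rewrite ltn_add2l; case: ifP => //= _.
  by congr edge; lia.
by congr tadpole; lia.
Qed.

Lemma move_cell_before v k n c : (n <= v)%N -> valid n c -> move_cell v k c = c.
Proof. by case: c => j /= nv jn; rewrite ifT //; lia. Qed.

Lemma move_cell_after v k n c : (v < n)%N -> (0 < k)%N ->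
  move_cell v k (shift_cell n c) = shift_cell (n + k).-1 c.
Proof.
move=> vn k0; case: c => j /=; (rewrite ifF; last by lia).
  by congr edge; lia.
by congr tadpole; lia.
Qed.

(** Grafting inserts the word of [s] in prefix order among that of [t], instead of
    after it; both words differ by the sign in the composition of trees. *)
Lemma tree_word_graft (F : seq cell -> K) t i s : alternating F -> (i < inputs t)%N ->
  F (map (move_cell (input_position t i) (size (tree_colours s))) (tree_word t)
       ++ map (shift_cell (input_position t i)) (tree_word s))
  = (-1) ^+ (odd_generators_after t i * odd_generators s)%N * F (tree_word (graft t i s)).
Proof.
have k0 := size_tree_colours_gt0 s; set k := size (tree_colours s) in k0 *.
elim: t i F => [|||l IHl r IHr] i F hF //= ilr.
  move: ilr; rewrite ltnS leqn0 => /eqP ->; rewrite expr0 mul1r; congr F.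
  by rewrite -[RHS]map_id; apply: eq_map => -[].
have [il|il] := ltnP i (inputs l).
  rewrite input_position_left //; set v := input_position l i.
  have vl : (v < size (tree_colours l))%N by exact: input_position_lt.
  rewrite /= ifF; last by lia.
  rewrite map_cat -map_comp -catA -cat_cons.
  rewrite (@eq_map _ _ (move_cell v k \o shift_cell (size (tree_colours l)))
    (shift_cell (size (tree_colours l) + k).-1)); last by move=> c; exact: move_cell_after.
  rewrite alternating_swap // !size_map !size_tree_word catA cat_cons.
  set e := edge _; set R := map _ (tree_word r).
  have := IHl i (fun m => F (e :: m ++ R)) _ il; rewrite -/v => ->; last first.
    by apply: (@alternating_suffix K _ (fun m => F (e :: m))); exact: alternating_cons.
  have [_ cg] := white_positions_graft s il.
  have sg : size (tree_colours (graft l i s)) = (size (tree_colours l) + k).-1.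
    by rewrite cg size_substitute.
  rewrite sg mulrA -exprD -/R.
  have -> : edge (size (tree_colours l) + k).-1.-1 = e by rewrite /e; congr edge; lia.
  by congr ((-1) ^+ _ * _); rewrite mulnDl addnC.
have ir : (i - inputs l < inputs r)%N by lia.
rewrite input_position_right //; set v := input_position r _; set n := size (tree_colours l).
have n0 : (0 < n)%N := size_tree_colours_gt0 l.
rewrite /= ifT; last by lia.
rewrite map_cat -!map_comp.
have -> : map (move_cell (n + v) k) (tree_word l) = tree_word l.
  rewrite -[RHS]map_id; apply/eq_in_map => c /(allP (tree_word_valid l)).
  exact: move_cell_before (leq_addr _ _).
rewrite (@eq_map _ _ (move_cell (n + v) k \o shift_cell n) (shift_cell n \o move_cell v k)); last first.
  by move=> c; exact: move_cell_shift.
rewrite (@eq_map _ _ (shift_cell (n + v)) (shift_cell n \o shift_cell v)); last first.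
  by move=> c /=; rewrite shift_shift.
rewrite 2!map_comp -catA -map_cat.
set e := edge _.
apply: (IHr (i - inputs l)%N (fun m => F (e :: tree_word l ++ map (shift_cell n) m))) => //.
apply: (@alternating_map K _ _ _ (fun m => F (e :: tree_word l ++ m))).
apply: (@alternating_prefix K _ (fun m => F (e :: m))).
exact: alternating_cons.
Qed.

Definition phi t z : K := word_vector K (tree_colours t) (tree_word t) z.

Lemma phiE t z : phi t z = (-1) ^+ inversions (tree_word t) * (z == tree_bamboo t)%:R.
Proof.
exact: (word_vector_perm K (colours_tree_bamboo t) (perm_tree_word t)).
Qed.

Lemma nvertices_tree_bamboo t : nvertices (tree_bamboo t) = size (tree_colours t).
Proof. by rewrite -colours_tree_bamboo size_colours. Qed.

Lemma phi_comp i t s z N : (i < inputs t)%N -> (nvertices z <= N)%N ->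
  \sum_(u <- tree_list N) tree_coef K i t s u * phi u z
    = \sum_(p <- bamboo_list N) \sum_(q <- bamboo_list N)
        phi t p * phi s q * bamboo_coef K i p q z.
Proof.
move=> it zN.
rewrite sum_tree_coef ?undup_uniq //; last first.
  move=> nL; rewrite phiE; case: eqP => [e|]; rewrite ?mulr0 //; case/negP: nL.
  rewrite mem_tree_list (leq_trans _ zN) // e nvertices_tree_bamboo.
  exact: leaves_le_colours.
set v := input_position t i; have vt : (v < size (tree_colours t))%N := input_position_lt it.
have [_ cg] := white_positions_graft s it; rewrite -/(input_position t i) -/v in cg.
transitivity (ins v (tree_bamboo t) (tree_bamboo s) z *
   ((-1) ^+ inversions (tree_word t) * (-1) ^+ inversions (tree_word s))).
  rewrite insertionE insertion_coloursE !colours_tree_bamboo -cg {1}/phi /word_vector.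
  case: (colours z == _); last by rewrite mulr0 mul0r.
  have hw := word_coef_alternating K z.
  rewrite -(tree_word_graft s hw it) -/v.
  rewrite /insertion_forms.
  pose G m1 m2 := form_value (fun m => word_coef m z : K) (map (blow_up v (nvertices (tree_bamboo s))) m1 ++
    singles (map (shift_cell v) m2)).
  have G1 m2 : alternating (fun m1 => G m1 m2).
    apply: (@alternating_map K _ _ _ (fun ss => form_value _ (ss ++ _))).
    by apply: alternating_suffix; apply: form_value_alternating.
  have G2 m1 : alternating (fun m2 => G m1 m2).
    rewrite /G /singles.
    apply: (@alternating_map K _ _ _ (fun m => form_value _ (_ ++ map (fun c => [:: c]) m))).
    apply: (@alternating_map K _ _ _ (fun ss => form_value _ (_ ++ ss))).
    by apply: alternating_prefix; apply: form_value_alternating.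
  rewrite -[form_value _ _]/(G (cells (tree_bamboo t)) (cells (tree_bamboo s))).
  have e1 := alternating_perm (G1 (cells (tree_bamboo s))) (perm_tree_word t).
  have e2 := alternating_perm (G2 (tree_word t)) (perm_tree_word s).
  rewrite inversions_cells expr0 mul1r in e1; rewrite inversions_cells expr0 mul1r in e2.
  rewrite -e1 -e2 mulrAC mulrC.
  set a := (-1) ^+ inversions (tree_word t); set b := (-1) ^+ inversions (tree_word s).
  have aa : a * a = 1 by rewrite /a -exprD addnn -muln2 exprM sqrr_sign.
  have bb : b * b = 1 by rewrite /b -exprD addnn -muln2 exprM sqrr_sign.
  transitivity ((a * a) * (b * b) * G (tree_word t) (tree_word s)); last by ring.
  rewrite aa bb !mul1r /G.
  have -> : map (blow_up v (nvertices (tree_bamboo s))) (tree_word t)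
    = singles (map (move_cell v (size (tree_colours s))) (tree_word t)).
    rewrite /singles -map_comp nvertices_tree_bamboo; apply/eq_in_map => c ct.
    apply: blow_up_move; apply/eqP => ec; move: ct; rewrite ec => /tree_word_tadpole.
    have it' := it; rewrite -count_negb_tree_colours in it'.
    have [a' [b' [e _ ev]]] := white_position_split it'.
    by rewrite /v /input_position ev e nth_cat ltnn subnn.
  by rewrite /singles -map_cat form_value_singles.
rewrite -/(phi _ _).
have bt p q : (i < bamboo_arity p)%N -> bamboo_coef K i p q z = ins (white p i) p q z by exact: bamboo_coefE.
have hz : ins v (tree_bamboo t) (tree_bamboo s) z != 0 ->
   tree_bamboo t \in bamboo_list N /\ tree_bamboo s \in bamboo_list N.
  move=> h; rewrite !mem_bamboo_list.
  have vb : (v < nvertices (tree_bamboo t))%N by rewrite nvertices_tree_bamboo.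
  have := insertion_nvertices vb h => e.
  have p1 : (0 < nvertices (tree_bamboo t))%N by [].
  have p2 : (0 < nvertices (tree_bamboo s))%N by [].
  by split; apply: leq_trans zN; lia.
have ctb : bamboo_coef K i (tree_bamboo t) (tree_bamboo s) z = ins v (tree_bamboo t) (tree_bamboo s) z.
  rewrite bamboo_coefE; last by rewrite arityE colours_tree_bamboo count_negb_tree_colours.
  by rewrite /white colours_tree_bamboo.
rewrite (eq_bigr (fun p => (p == tree_bamboo t)%:R * \sum_(q <- bamboo_list N) (q == tree_bamboo s)%:R *
   ((-1) ^+ inversions (tree_word t) * (-1) ^+ inversions (tree_word s) * bamboo_coef K i p q z))); last first.
  move=> p _; rewrite mulr_sumr; apply: eq_bigr => q _; rewrite !phiE; ring.
rewrite sum_delta0 ?uniq_bamboo_list //; last first.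
  move=> nt; rewrite big1 // => q _; case: eqP => [->|]; last by rewrite mul0r.
  rewrite ctb; have [->|/hz[h _]] := eqVneq (ins v (tree_bamboo t) (tree_bamboo s) z) 0.
    by rewrite !mulr0.
  by rewrite h in nt.
rewrite sum_delta0 ?uniq_bamboo_list //; first by rewrite ctb mulrC.
move=> ns; rewrite ctb; have [->|/hz[_ h]] := eqVneq (ins v (tree_bamboo t) (tree_bamboo s) z) 0.
  by rewrite !mulr0.
by rewrite h in ns.
Qed.

Hypothesis w2 : (w <= 2)%N.

Theorem phi_morphism : kernel_morphism inputs tree_degree (tree_weight w) Input
  (@tree_coef K) leaves tree_list bamboo_arity bamboo_degree bamboo_weight
  white_vertex (@bamboo_coef K) nvertices bamboo_list phi.
Proof.
split.
- move=> t z; rewrite phiE; have [->|_] := eqVneq z (tree_bamboo t); last by rewrite mulr0 eqxx.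
  move=> _; rewrite arityE degreeE weightE colours_tree_bamboo count_negb_tree_colours.
  rewrite -(perm_size (perm_tree_word t)) -tree_degreeE count_id_tree_colours.
  rewrite nvertices_tree_bamboo; split=> //; first exact: tree_weight_le.
  exact: leaves_le_colours.
- by move=> z; rewrite phiE mul1r.
- exact: phi_comp.
Qed.

(** The letters of these words are black tadpoles, plain white vertices and pairs of
    isolated black vertices, on which the derivation vanishes. *)
Lemma diff_tree_items t f : derivation (tree_items t) f = 0 :> K.
Proof.
suff h m f' : derivation (tree_items t ++ m) f' =
    (-1) ^+ (size (tree_items t) + count (fun i : item => i.2.2) (tree_items t)
       + count (fun i : item => ~~ i.1) (tree_items t))
     * derivation m (fun m' => f' (tree_items t ++ m')) :> K.
  by rewrite -[tree_items t]cats0 h /= mulr0.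
elim: t m f' {f} => [|||l IHl r IHr] m f' /=; try ring.
rewrite -catA IHl IHr mulrA -exprD !count_cat size_cat.
congr (_ * _); last by apply: derivation_ext => m' _; rewrite catA.
by congr (_ ^+ _); lia.
Qed.

Lemma phi_cycle t z N : \sum_(p <- bamboo_list N) phi t p * bamboo_diff K p z = 0.
Proof.
rewrite big1 // => p _; rewrite phiE; case: eqP => [->|]; last by rewrite mulr0 mul0r.
by rewrite bamboo_diff_delta items_tree_bamboo /delta diff_tree_items !mulr0.
Qed.

Local Notation T := (tree_operad K w).

Definition tree_map : forall n d, T n d -> TwncBV K n d :=
  @series_map K tree inputs tree_degree tree_list bamboo bamboo_arity bamboo_degree
     nvertices phi.

Lemma tree_map_morphism : @is_morphism K T (TwncBV K) tree_map.
Proof.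
exact: (series_map_morphism (tree_structure K w) (bamboo_structure K) phi_morphism).
Qed.

Lemma scoef_tree_map n d (f : T n d) z N : (nvertices z <= N)%N ->
  scoef (tree_map f : series K bamboo_arity bamboo_degree n d) z
    = \sum_(t <- tree_list N) scoef f t * phi t z.
Proof.
exact: (scoef_series_map (tree_structure K w) phi_morphism).
Qed.

Lemma tree_map_cycle n d (f : T n d) : is_cycle (tree_map f).
Proof.
apply/cycleP => e h; apply: series_ext => z; rewrite scoef0 (scoef_diff_Tw _ _ (leqnn _)).
set L := bamboo_list _; set M := tree_list (nvertices z).
transitivity (\sum_(p <- L) (\sum_(t <- M) scoef f t * phi t p) * bamboo_diff K p z).
  rewrite big_seq [RHS]big_seq; apply: eq_bigr => p; rewrite mem_bamboo_list => pz.
  by rewrite (scoef_tree_map _ pz).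
transitivity (\sum_(t <- M) scoef f t * \sum_(p <- L) phi t p * bamboo_diff K p z).
  under eq_bigr do rewrite mulr_suml.
  rewrite exchange_big; apply: eq_bigr => t _; rewrite mulr_sumr.
  by apply: eq_bigr => p _; rewrite mulrA.
by rewrite big1 // => t _; rewrite phi_cycle mulr0.
Qed.

End TreeMap.

(** * The canonical map *)

Section MorphismComposition.
Variables (K : fieldType) (P Q R : operad K).
Variables (f : forall n d, P n d -> Q n d) (g : forall n d, Q n d -> R n d).

Lemma morphism_comp : is_morphism f -> is_morphism g ->
  is_morphism (fun n d (x : P n d) => g (f x)).
Proof.
move=> mf mg; split.
- by move=> n d a x y; rewrite (mor_linear mf) (mor_linear mg).
- by move=> n d k x xk; apply: (mor_filtered mg); apply: (mor_filtered mf).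
- by rewrite (mor_id mf) (mor_id mg).
by move=> m n p d e r hp hr i x y im; rewrite (mor_comp mf) // (mor_comp mg).
Qed.

Hypothesis mf : is_morphism f.

Lemma morZ n d a (x : P n d) : f (a *: x) = a *: f x.
Proof. by rewrite -[a *: x]addr0 (mor_linear mf) (mor0 mf) addr0. Qed.

Lemma morD n d (x y : P n d) : f (x + y) = f x + f y.
Proof. by rewrite -[x in LHS]scale1r (mor_linear mf) scale1r. Qed.

Lemma mor_sum n d (I : Type) (r : seq I) (F : I -> P n d) :
  f (\sum_(i <- r) F i) = \sum_(i <- r) f (F i).
Proof. by elim: r => [|i r IH]; rewrite ?big_nil ?(mor0 mf) // !big_cons morD IH. Qed.

End MorphismComposition.

Section TreeMonomials.
Variables (K : fieldType) (w : nat).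
Implicit Types (t s l r u : tree).

Local Notation T := (tree_operad K w).

Definition mono t n d : T n d := monomial K tree inputs tree_degree t n d.
Arguments mono : clear implicits.

Lemma scoef_mono t n d u : scoef (mono t n d : series K inputs tree_degree n d) u
  = [&& u == t, inputs t == n & tree_degree t == d]%:R.
Proof. exact: scoef_monomial. Qed.

Lemma mono0 t n d : (inputs t == n) && (tree_degree t == d) = false -> mono t n d = 0.
Proof.
move=> h; apply: series_ext => u; rewrite scoef_mono h andbF scoef0 //.
Qed.

Lemma mono_comp m n p (d e f : int) (hp : (m + n = p.+1)%N) (hf : d + e = f) i t s :
  inputs t = m -> tree_degree t = d -> inputs s = n -> tree_degree s = e -> (i < m)%N ->
  op_comp hp hf i (mono t m d) (mono s n e)
    = (-1) ^+ (odd_generators_after t i * odd_generators s)%N *: mono (graft t i s) p f.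
Proof.
move=> tm td sn se im; have it : (i < inputs t)%N by rewrite tm.
apply: series_ext => z.
rewrite (scoef_comp (tree_structure K w) _ _ _ _ _ (leqnn _)) scoefZ scoef_mono.
rewrite degree_graft // td se hf eqxx andbT.
have -> : inputs (graft t i s) == p by rewrite -eqSS inputs_graft // tm sn hp.
rewrite andbT.
transitivity (\sum_(a <- tree_list (leaves z)) (a == t)%:R *
   \sum_(b <- tree_list (leaves z)) (b == s)%:R * tree_coef K i a b z).
  apply: eq_bigr => a _; rewrite mulr_sumr; apply: eq_bigr => b _.
  by rewrite !scoef_mono tm td sn se !eqxx !andbT mulrA.
have leaf : tree_coef K i t s z != 0 -> (leaves t <= leaves z)%N && (leaves s <= leaves z)%N.
  by move=> /(sc_supp (tree_structure K w))[].
rewrite sum_delta0 ?undup_uniq //; last first.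
  move=> nt; rewrite big1 // => b _; case: eqP => [->|]; last by rewrite mul0r.
  have [->|/leaf/andP[h _]] := eqVneq (tree_coef K i t s z) 0; first by rewrite mulr0.
  by rewrite mem_tree_list h in nt.
rewrite sum_delta0 ?undup_uniq //; last first.
  move=> nt; have [//|/leaf/andP[_ h]] := eqVneq (tree_coef K i t s z) 0.
  by rewrite mem_tree_list h in nt.
rewrite /tree_coef it; case: eqP => [_|_] /=; first by rewrite mulr1.
by rewrite mulr0.
Qed.

(** The left subtree is grafted first, on the first input of b. *)
Lemma mono_node l r a b (d e f g : int) (h1 : (2 + a = (a + 1).+1)%N)
    (h2 : (a + 1 + b = (a + b).+1)%N) (hf : 1 + d = f) (hg : f + e = g) :
  inputs l = a -> tree_degree l = d -> inputs r = b -> tree_degree r = e ->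
  mono (Node l r) (a + b)%N g
    = op_comp h2 hg a (op_comp h1 hf 0%N (tree_b K w) (mono l a d)) (mono r b e).
Proof.
move=> la ld rb re.
have -> : op_comp h1 hf 0%N (tree_b K w) (mono l a d) = mono (Node l Input) (a + 1)%N f.
  by rewrite (@mono_comp 2%N _ _ 1 _ _ h1 hf 0%N (Node Input Input)) //= mul0n expr0 scale1r.
rewrite mono_comp //=; last by rewrite addn1.
  by rewrite la ltnn /= mul0n expr0 scale1r.
  by rewrite la.
by rewrite ld addr0.
Qed.

Lemma node_arity1 a : (2 + a = (a + 1).+1)%N. Proof. by rewrite addn1. Qed.
Lemma node_arity2 a b : (a + 1 + b = (a + b).+1)%N. Proof. by rewrite addn1. Qed.

Hypothesis w0 : (0 < w)%N.

Lemma leaves_le_weight t : (leaves t <= inputs t + tree_weight w t)%N.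
Proof. by elim: t => //= l IHl r IHr; lia. Qed.

(** A tree of arity [n] and weight less than [k] has fewer than [n + k] leaves. *)
Definition truncation n d k (f : T n d) : T n d :=
  \sum_(t <- tree_list (n + k)) scoef f t *: mono t n d.

Lemma truncation_fil n d k (f : T n d) : op_fil k (f - truncation k f).
Proof.
apply/filP => u uk; rewrite scoefB scoef_sum.
apply/eqP; rewrite subr_eq0; apply/eqP.
rewrite (eq_bigr (fun t => (t == u)%:R * scoef f t)); last first.
  move=> t _; rewrite scoefZ scoef_mono.
  have [->|/scoef_supp[-> ->]] := eqVneq (scoef f t) 0; first by rewrite mul0r mulr0.
  by rewrite !eqxx !andbT eq_sym mulrC.
rewrite sum_delta0 ?undup_uniq // mem_tree_list.
have [//|/scoef_supp[un _]] := eqVneq (scoef f u) 0.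
by have := leaves_le_weight u; rewrite un; lia.
Qed.

Section Generation.
Variables (Q : operad K) (cQ : is_complete_operad Q).
Variables (F G : forall n d, T n d -> Q n d).
Hypotheses (mF : is_morphism F) (mG : is_morphism G).

(** Truncations are combinations of iterated composites of b, gamma and zeta; they
    approximate every series, and the target is separated. *)
Theorem tree_morphism_eq : F (tree_b K w) = G (tree_b K w) ->
  F (tree_gamma K w) = G (tree_gamma K w) -> F (tree_zeta K w) = G (tree_zeta K w) ->
  forall n d (x : T n d), F x = G x.
Proof.
move=> hb hg hz.
have hm t : F (mono t (inputs t) (tree_degree t)) = G (mono t (inputs t) (tree_degree t)).
  elim: t => [|//|//|l IHl r IHr].
    by rewrite -[mono _ _ _]/(op_id T) (mor_id mF) (mor_id mG).
  rewrite [inputs _]/= [tree_degree _]/=.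
  rewrite (mono_node (node_arity1 _) (node_arity2 _ _) erefl erefl erefl erefl erefl erefl).
  have h : (inputs l < inputs l + 1)%N by rewrite addn1.
  by rewrite (mor_comp mF) // (mor_comp mF) // (mor_comp mG) // (mor_comp mG) // hb IHl IHr.
have hm' t n d : F (mono t n d) = G (mono t n d).
  have [/andP[/eqP <- /eqP <-]|/negbTE h] := boolP ((inputs t == n) && (tree_degree t == d)).
    exact: hm.
  by rewrite (mono0 h) (mor0 mF) (mor0 mG).
move=> n d x; apply/eqP; rewrite -subr_eq0; apply/eqP.
apply: (fil_separated (cop_filtration cQ)) => k.
have -> : F x - G x = F (x - truncation k x) - G (x - truncation k x).
  rewrite (morB mF) (morB mG).
  have -> : F (truncation k x) = G (truncation k x).
    rewrite (mor_sum mF) (mor_sum mG); apply: eq_bigr => t _.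
    by rewrite (morZ mF) (morZ mG) hm'.
  by rewrite opprB addrA subrK.
apply: (filB (cop_filtration cQ)).
  by apply: (mor_filtered mF); exact: truncation_fil.
by apply: (mor_filtered mG); exact: truncation_fil.
Qed.

End Generation.

End TreeMonomials.

Arguments mono : clear implicits.

Section CanonicalMap.
Variables (K : fieldType) (w : nat).
Hypotheses (w0 : (0 < w)%N) (w2 : (w <= 2)%N).

Local Notation T := (tree_operad K w).

Lemma tree_operad_complete : is_complete_operad T.
Proof. exact: (series_operad_complete (tree_structure K w)). Qed.

Lemma AsGZ_complete : is_complete_operad (AsGZ K w).
Proof. exact: (quotient_complete _ tree_operad_complete). Qed.

Lemma AsPP_complete : is_complete_operad (AsPP K w).
Proof. exact: (quotient_complete _ AsGZ_complete). Qed.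

Lemma zero_dgoperad_complete (P : operad K) : is_complete_operad P ->
  is_complete_dgoperad (zero_dgoperad P).
Proof.
move=> cP; split=> //=.
- by move=> n d e h k x _; exact: (fil0 (cop_filtration cP)).
- move=> m n p d e f d' e' f' hp hf hd he hf1 hf2 hf3 i x y im /=.
  have bil := cop_bilinear cP.
  by rewrite comp0l // comp0r // scaler0 addr0.
Qed.

Lemma scoef_tree_map_mono t n d z :
  scoef (tree_map (mono K w t n d) : series K bamboo_arity bamboo_degree n d) z
    = ((inputs t == n) && (tree_degree t == d))%:R * phi K t z.
Proof.
rewrite (scoef_tree_map w2 _ (leqnn _)).
rewrite (eq_bigr (fun u => (u == t)%:R *
    (((inputs t == n) && (tree_degree t == d))%:R * phi K u z))); last first.
  by move=> u _; rewrite scoef_mono -mulnb natrM mulrA.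
rewrite sum_delta0 ?undup_uniq // mem_tree_list => nt.
have [->|/(km_supp (phi_morphism K w2))[_ _ _ h]] := eqVneq (phi K t z) 0.
  by rewrite mulr0.
by rewrite h in nt.
Qed.

Lemma tree_map_mono t n d : inversions (tree_word t) = 0%N ->
  tree_map (mono K w t n d) = monomial K bamboo bamboo_arity bamboo_degree (tree_bamboo t) n d.
Proof.
move=> h; apply: series_ext => z.
rewrite scoef_tree_map_mono scoef_monomial phiE h expr0 mul1r.
rewrite arityE degreeE colours_tree_bamboo count_negb_tree_colours.
by rewrite -(perm_size (perm_tree_word t)) -tree_degreeE mulrC -natrM mulnb.
Qed.

(** Both composites of b give the bamboo with three white vertices and two edges,
    with the edges in opposite orders. *)
Lemma as_relation_tree_map n d (x : T n d) : as_relation (tree_b K w) x -> tree_map x = 0.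
Proof.
case=> {n d x}; rewrite -[tree_b K w]/(mono K w (Node Input Input) 2%N 1).
rewrite !mono_comp //= !expr0 !scale1r (morD (tree_map_morphism K w2)).
apply: series_ext => z; rewrite scoefD !scoef_tree_map_mono scoef0 /= !mul1r.
rewrite /phi /word_vector /=; case: (colours z == _); last by rewrite addr0.
have := (word_coef_alternating K z).1 [::] (edge 1) (edge 0) [::].
by rewrite /= => ->; rewrite addNr.
Qed.

Definition canonical_map : forall n d, AsGZ K w n d -> TwncBV K n d :=
  @quotient_lift K T (TwncBV K) (@tree_map K w) (as_relation (tree_b K w)).

Lemma canonical_mapE n d (x : T n d) :
  canonical_map (op_proj (as_relation (tree_b K w)) x) = tree_map x.
Proof.
exact: (quotient_liftE (cdg_operad (TwncBV_complete K)) (tree_map_morphism K w2)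
  as_relation_tree_map).
Qed.

Lemma canonical_map_morphism : @is_morphism K (AsGZ K w) (TwncBV K) canonical_map.
Proof.
exact: (quotient_lift_morphism tree_operad_complete (cdg_operad (TwncBV_complete K))
  (tree_map_morphism K w2) as_relation_tree_map).
Qed.

Lemma canonical_map_cycle n d (x : AsGZ K w n d) : is_cycle (canonical_map x).
Proof.
by move: x; apply: quotient_ind => x; rewrite canonical_mapE; exact: tree_map_cycle.
Qed.

Theorem canonical_map_canonical : is_canonical_map canonical_map.
Proof.
split.
- split; first exact: canonical_map_morphism.
  move=> n d e h x; rewrite (cycle_diff h (canonical_map_cycle x)).
  exact: (mor0 canonical_map_morphism).
- by rewrite canonical_mapE (tree_map_mono (t := Node Input Input)).
- by rewrite canonical_mapE (tree_map_mono (t := Gamma)).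
- by rewrite canonical_mapE (tree_map_mono (t := Zeta)).
Qed.

Theorem canonical_map_unique (Psi : forall n d, AsGZ K w n d -> TwncBV K n d) :
  is_canonical_map Psi -> forall n d (x : AsGZ K w n d), Psi n d x = canonical_map x.
Proof.
move=> [mPsi eb eg ez] n d; apply: quotient_ind => x.
have [_ eb' eg' ez'] := canonical_map_canonical.
have mp := op_proj_morphism (as_relation (tree_b K w)) tree_operad_complete.
apply: (tree_morphism_eq w0 (cdg_operad (TwncBV_complete K))
  (morphism_comp mp (dgmor_morphism mPsi)) (morphism_comp mp canonical_map_morphism)).
- by rewrite [LHS]eb [RHS]eb'.
- by rewrite [LHS]eg [RHS]eg'.
- by rewrite [LHS]ez [RHS]ez'.
Qed.

End CanonicalMap.

(** * Normal forms in the quotient operad *)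

Lemma op_proj_relation (K : fieldType) (P : operad K) (R : forall n d, P n d -> Prop)
  n d (x : P n d) : R n d x -> op_proj R x = 0.
Proof.
move=> Rx; apply: (iffRL (lquot_pi_eq0 _ _)); apply/mem_ideal; exact: closed_ideal_sub.
Qed.

Section NormalForms.
Variables (K : fieldType) (w : nat).
Implicit Types (t s l r u a : tree).

Local Notation T := (tree_operad K w).
Local Notation Q := (AsPP K w).
Local Notation mono := (mono K w).

Definition tree_class n d (x : T n d) : Q n d :=
  AsPP_proj (op_proj (as_relation (tree_b K w)) x).

Lemma tree_class_morphism : is_morphism tree_class.
Proof.
apply: (morphism_comp (op_proj_morphism _ (tree_operad_complete K w))).
exact: (op_proj_morphism _ (AsGZ_complete K w)).
Qed.

Let mc := tree_class_morphism.
Let cQ := AsPP_complete K w.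
Let bil := cop_bilinear cQ.

Lemma AsPP_class_eq0 n d (x : AsGZ K w n d) : AsPP_relation x -> AsPP_proj x = 0.
Proof.
exact: op_proj_relation.
Qed.

Lemma tree_class_assoc :
  tree_class (mono (Node (Node Input Input) Input) 3%N 2)
    + tree_class (mono (Node Input (Node Input Input)) 3%N 2) = 0.
Proof.
rewrite -(morD mc).
have e : op_proj (as_relation (tree_b K w))
   (mono (Node (Node Input Input) Input) 3%N 2 + mono (Node Input (Node Input Input)) 3%N 2) = 0.
  apply: op_proj_relation.
  have := @As_assoc K T (tree_b K w).
  rewrite -[tree_b K w]/(mono (Node Input Input) 2%N 1).
  by rewrite !mono_comp //= !expr0 !scale1r.
rewrite /tree_class e; exact: lquot_pi0.
Qed.

Lemma tree_class_gamma_left : tree_class (mono (Node Gamma Input) 1%N (- 3)) = 0.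
Proof.
have := AsPP_class_eq0 (@AsPP_gamma_left K (AsGZ K w) (AsGZ_b K w) (AsGZ_gamma K w) (AsGZ_zeta K w)).
rewrite (op_proj_comp _ (tree_operad_complete K w)) //.
rewrite -[tree_b K w]/(mono (Node Input Input) 2%N 1) -[tree_gamma K w]/(mono Gamma 0%N (- 4)).
by rewrite mono_comp //= expr0 scale1r.
Qed.

Lemma tree_class_gamma_right : tree_class (mono (Node Input Gamma) 1%N (- 3)) = 0.
Proof.
have := AsPP_class_eq0 (@AsPP_gamma_right K (AsGZ K w) (AsGZ_b K w) (AsGZ_gamma K w) (AsGZ_zeta K w)).
rewrite (op_proj_comp _ (tree_operad_complete K w)) //.
rewrite -[tree_b K w]/(mono (Node Input Input) 2%N 1) -[tree_gamma K w]/(mono Gamma 0%N (- 4)).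
by rewrite mono_comp //= expr0 scale1r.
Qed.

Lemma tree_class_zeta :
  tree_class (mono (Node Zeta Input) 1%N 0) + tree_class (mono (Node Input Zeta) 1%N 0) = 0.
Proof.
have := AsPP_class_eq0 (@AsPP_zeta K (AsGZ K w) (AsGZ_b K w) (AsGZ_gamma K w) (AsGZ_zeta K w)).
rewrite !(op_proj_comp _ (tree_operad_complete K w)) //.
rewrite -[tree_b K w]/(mono (Node Input Input) 2%N 1) -[tree_zeta K w]/(mono Zeta 0%N (- 1)).
rewrite !mono_comp //= !expr0 !scale1r => h; rewrite -(morD mc) -[RHS]h.
by rewrite /tree_class; congr (AsPP_proj _); exact: lquot_piD.
Qed.

(** Relations are only needed up to sign, since the classes of a basis may be
    rescaled; this avoids computing the signs of iterated graftings. *)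
Definition sign_equiv t s : Prop :=
  [/\ inputs t = inputs s, tree_degree t = tree_degree s &
   exists c : bool, forall n d, tree_class (mono t n d) = (-1) ^+ c *: tree_class (mono s n d)].

Definition class_zero t : Prop := forall n d, tree_class (mono t n d) = 0.

Lemma sign_equiv_refl t : sign_equiv t t.
Proof. by split=> //; exists false => n d; rewrite scale1r. Qed.

Lemma sign_equiv_trans t s u : sign_equiv t s -> sign_equiv s u -> sign_equiv t u.
Proof.
move=> [i1 d1 [c1 e1]] [i2 d2 [c2 e2]]; split; [by rewrite i1|by rewrite d1|].
exists (c1 (+) c2) => n d; rewrite e1 e2 scalerA; congr (_ *: _).
by case: c1 {e1}; case: c2 {e2}; rewrite /= ?mulrNN ?mulr1 ?mul1r.
Qed.

Lemma sign_equiv_sym t s : sign_equiv t s -> sign_equiv s t.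
Proof.
move=> [i1 d1 [c1 e1]]; split=> //; exists c1 => n d.
by rewrite e1 scalerA -exprD addnn -muln2 exprM sqrr_sign scale1r.
Qed.

(** In the other arities and degrees both monomials are zero. *)
Lemma sign_equivP t s : inputs t = inputs s -> tree_degree t = tree_degree s ->
  (exists c : bool, tree_class (mono t (inputs t) (tree_degree t))
      = (-1) ^+ c *: tree_class (mono s (inputs t) (tree_degree t))) -> sign_equiv t s.
Proof.
move=> it dt [c e]; split=> //; exists c => n d.
have [/andP[/eqP <- /eqP <-]//|/negbTE h] := boolP ((inputs t == n) && (tree_degree t == d)).
rewrite (mono0 _ _ h); move: h; rewrite it dt => h.
by rewrite (mono0 _ _ h) (mor0 mc) scaler0.
Qed.

Lemma class_zeroP t : tree_class (mono t (inputs t) (tree_degree t)) = 0 -> class_zero t.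
Proof.
move=> e n d.
have [/andP[/eqP <- /eqP <-]//|/negbTE h] := boolP ((inputs t == n) && (tree_degree t == d)).
by rewrite (mono0 _ _ h) (mor0 mc).
Qed.

Lemma tree_class_node l r : exists h1 h2 hf hg,
  forall l' r', inputs l' = inputs l -> tree_degree l' = tree_degree l ->
    inputs r' = inputs r -> tree_degree r' = tree_degree r ->
  tree_class (mono (Node l' r') (inputs (Node l r)) (tree_degree (Node l r)))
   = op_comp (h2 : (inputs l + 1 + inputs r = (inputs l + inputs r).+1)%N)
       (hg : 1 + tree_degree l + tree_degree r = 1 + tree_degree l + tree_degree r) (inputs l)
      (op_comp (h1 : (2 + inputs l = (inputs l + 1).+1)%N)
         (hf : 1 + tree_degree l = 1 + tree_degree l) 0%N
         (tree_class (tree_b K w)) (tree_class (mono l' (inputs l) (tree_degree l))))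
      (tree_class (mono r' (inputs r) (tree_degree r))).
Proof.
exists (node_arity1 _), (node_arity2 _ _), erefl, erefl => l' r' il dl ir dr.
rewrite [inputs (Node _ _)]/= [tree_degree (Node _ _)]/=.
rewrite (mono_node K w (node_arity1 _) (node_arity2 _ _) erefl erefl il dl ir dr).
by rewrite (mor_comp mc) ?addn1 // (mor_comp mc).
Qed.

Lemma sign_equiv_node l l' r r' : sign_equiv l l' -> sign_equiv r r' ->
  sign_equiv (Node l r) (Node l' r').
Proof.
move=> [il dl [c1 e1]] [ir dr [c2 e2]].
apply: sign_equivP; [by rewrite /= il ir|by rewrite /= dl dr|].
have [h1 [h2 [hf [hg h]]]] := tree_class_node l r.
have il1 : (inputs l < inputs l + 1)%N by rewrite addn1.
exists (c1 (+) c2); rewrite (h l r) // (h l' r') // e1 e2.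
rewrite compZr // compZr // compZl // scalerA; congr (_ *: _).
by case: c1 {e1}; case: c2 {e2}; rewrite /= ?mulrNN ?mulr1 ?mul1r.
Qed.

Lemma class_zero_nodel l r : class_zero l -> class_zero (Node l r).
Proof.
move=> z; apply: class_zeroP; have [h1 [h2 [hf [hg h]]]] := tree_class_node l r.
have il1 : (inputs l < inputs l + 1)%N by rewrite addn1.
by rewrite (h l r) // z comp0r // comp0l.
Qed.

Lemma class_zero_noder l r : class_zero r -> class_zero (Node l r).
Proof.
move=> z; apply: class_zeroP; have [h1 [h2 [hf [hg h]]]] := tree_class_node l r.
have il1 : (inputs l < inputs l + 1)%N by rewrite addn1.
by rewrite (h l r) // z comp0r.
Qed.

Lemma tree_class_graft t i s n d (hp : (inputs t + inputs s = n.+1)%N)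
  (hf : tree_degree t + tree_degree s = d) : (i < inputs t)%N ->
  tree_class (mono (graft t i s) n d)
  = (-1) ^+ (odd_generators_after t i * odd_generators s)%N *:
     op_comp hp hf i (tree_class (mono t (inputs t) (tree_degree t)))
                     (tree_class (mono s (inputs s) (tree_degree s))).
Proof.
move=> it; rewrite -(mor_comp mc) // mono_comp // (morZ mc) scalerA -exprD addnn.
by rewrite -muln2 exprM sqrr_sign scale1r.
Qed.

Lemma sign_equiv_graft t t' i s : sign_equiv t t' -> (i < inputs t)%N ->
  sign_equiv (graft t i s) (graft t' i s).
Proof.
move=> [it dt [c e]] im; have im' : (i < inputs t')%N by rewrite -it.
have ig : inputs (graft t i s) = inputs (graft t' i s).
  by apply: eq_add_S; rewrite !inputs_graft // it.
have dg : tree_degree (graft t i s) = tree_degree (graft t' i s).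
  by rewrite !degree_graft // dt.
apply: sign_equivP => //.
have hp : (inputs t + inputs s = (inputs (graft t i s)).+1)%N by rewrite inputs_graft.
have hf : tree_degree t + tree_degree s = tree_degree (graft t i s) by rewrite degree_graft.
rewrite (tree_class_graft hp hf im).
have hp' := hp; have hf' := hf; rewrite it in hp'; rewrite dt in hf'.
rewrite (tree_class_graft hp' hf' im').
move: hp hf; rewrite it dt => hp hf; rewrite e compZl // scalerA.
rewrite (eq_irrelevance hp hp') (eq_irrelevance hf hf').
exists (odd (odd_generators_after t i * odd_generators s + c
   + odd_generators_after t' i * odd_generators s)).
by rewrite signr_odd scalerA !exprD -!mulrA -expr2 sqrr_sign mulr1.
Qed.

Lemma class_zero_graft t i s : class_zero t -> (i < inputs t)%N -> class_zero (graft t i s).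
Proof.
move=> z im; apply: class_zeroP.
have hp : (inputs t + inputs s = (inputs (graft t i s)).+1)%N by rewrite inputs_graft.
have hf : tree_degree t + tree_degree s = tree_degree (graft t i s) by rewrite degree_graft.
by rewrite (tree_class_graft hp hf im) z comp0l // scaler0.
Qed.

Lemma opposite_classes t s : inputs t = inputs s -> tree_degree t = tree_degree s ->
  tree_class (mono t (inputs t) (tree_degree t)) +
    tree_class (mono s (inputs t) (tree_degree t)) = 0 -> sign_equiv t s.
Proof.
move=> it dt e; apply: sign_equivP => //; exists true.
by rewrite expr1 scaleN1r; apply/eqP; rewrite -addr_eq0 e.
Qed.

(** The relations of the quotient are propagated by grafting on their inputs. *)
Lemma sign_equiv_assoc a b c :
  sign_equiv (Node (Node a b) c) (Node a (Node b c)).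
Proof.
have h : sign_equiv (Node (Node Input Input) Input) (Node Input (Node Input Input)).
  by apply: opposite_classes => //; exact: tree_class_assoc.
have h1 := sign_equiv_graft a h (isT : (0 < 3)%N); rewrite /= in h1.
have i2 : (inputs a < inputs a + 1 + 1)%N by rewrite !addn1 ltnS leqnSn.
have h2 := sign_equiv_graft b h1 i2.
rewrite /= addn1 ltnSn ltnn subnn /= in h2.
have i3 : (inputs a + inputs b < inputs a + inputs b + 1)%N by rewrite addn1.
have h3 := sign_equiv_graft c h2 i3.
by rewrite /= ltnn [(inputs a + inputs b < inputs a)%N]ltnNge leq_addr addKn /= ltnn in h3.
Qed.

Lemma sign_equiv_zeta a : sign_equiv (Node a Zeta) (Node Zeta a).
Proof.
have h : sign_equiv (Node Zeta Input) (Node Input Zeta).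
  by apply: opposite_classes => //; exact: tree_class_zeta.
exact/sign_equiv_sym/(sign_equiv_graft a h (isT : (0 < 1)%N)).
Qed.

Lemma class_zero_gamma_left a : class_zero (Node Gamma a).
Proof.
have h : class_zero (Node Gamma Input) by apply: class_zeroP; exact: tree_class_gamma_left.
exact: (class_zero_graft a h (isT : (0 < 1)%N)).
Qed.

Lemma class_zero_gamma_right a : class_zero (Node a Gamma).
Proof.
have h : class_zero (Node Input Gamma) by apply: class_zeroP; exact: tree_class_gamma_right.
exact: (class_zero_graft a h (isT : (0 < 1)%N)).
Qed.

End NormalForms.

Arguments sign_equiv_assoc {K w} a b c.
Arguments sign_equiv_zeta {K w} a.
Arguments sign_equiv_refl {K w} t.
Arguments class_zero_gamma_left {K w} a.
Arguments class_zero_gamma_right {K w} a.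

Fixpoint comb (s : seq tree) : tree :=
  if s is t :: s' then (if nilp s' then t else Node t (comb s')) else Input.

(** In the quotient, the product of [k] copies of zeta and of [n] inputs,
    parenthesised to the right; a default value when both numbers are zero. *)
Definition normal_tree k n : tree := comb (nseq k Zeta ++ nseq n Input).

Lemma normal_tree_zeta k n : (0 < k + n)%N ->
  normal_tree k.+1 n = Node Zeta (normal_tree k n).
Proof. by case: k => [|k]; case: n. Qed.

Lemma normal_tree_input n : normal_tree 0 n.+2 = Node Input (normal_tree 0 n.+1).
Proof. by []. Qed.

Lemma normal_tree_ind (R : nat -> nat -> Prop) :
  R 1%N 0%N -> R 0%N 1%N ->
  (forall k n, (0 < k + n)%N -> R k n -> R k.+1 n) ->
  (forall n, R 0%N n.+1 -> R 0%N n.+2) ->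
  forall k n, (0 < k + n)%N -> R k n.
Proof.
move=> h10 h01 hz hi; elim=> [|k IH] n.
  by elim: n => [|[|n] IHn] // _; apply: hi; exact: IHn.
have [/eqP|kn _] := posnP (k + n); last exact/hz/IH.
by rewrite addn_eq0 => /andP[/eqP-> /eqP->].
Qed.

Lemma normal_treeE k n : (0 < k + n)%N ->
  [/\ inputs (normal_tree k n) = n,
      leaves (normal_tree k n) = (k + n)%N &
      forall w, tree_weight w (normal_tree k n) = k].
Proof.
move: k n; apply: normal_tree_ind => // [k n kn [i l h]|n [i l h]].
  by rewrite normal_tree_zeta //=; split=> [||w]; rewrite ?i ?l ?h.
by rewrite normal_tree_input; split=> [||w]; rewrite /= -/(normal_tree _ _) ?i ?l ?h.
Qed.

Section NormalForm.
Variables (K : fieldType) (w : nat).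
Hypotheses (w0 : (0 < w)%N).
Implicit Types (t s l r u a : tree).

Local Notation sign_equiv := (@sign_equiv K w).
Local Notation class_zero := (@class_zero K w).
Local Notation refl := sign_equiv_refl.

(** An input commutes with zeta, hence moves to the right of all copies of zeta. *)
Lemma sign_equiv_input_normal k n : (0 < k + n)%N ->
  sign_equiv (Node Input (normal_tree k n)) (normal_tree k n.+1).
Proof.
move: k n; apply: normal_tree_ind => [||k n kn IH|n IH]; try exact: refl.
  exact: sign_equiv_zeta.
rewrite normal_tree_zeta // normal_tree_zeta ?addnS //.
apply: sign_equiv_trans (sign_equiv_sym (sign_equiv_assoc _ _ _)) _.
apply: sign_equiv_trans (sign_equiv_node (sign_equiv_zeta Input) (refl _)) _.
apply: sign_equiv_trans (sign_equiv_assoc _ _ _) _.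
exact: sign_equiv_node (refl _) IH.
Qed.

Lemma sign_equiv_node_normal k n k' n' : (0 < k + n)%N -> (0 < k' + n')%N ->
  sign_equiv (Node (normal_tree k n) (normal_tree k' n')) (normal_tree (k + k') (n + n')).
Proof.
move=> kn0 h'; move: k n kn0; apply: normal_tree_ind => [||k n kn IH|n IH].
- by rewrite -normal_tree_zeta //; exact: refl.
- exact: sign_equiv_input_normal.
- rewrite normal_tree_zeta //; apply: sign_equiv_trans (sign_equiv_assoc _ _ _) _.
  rewrite addSn normal_tree_zeta; last by lia.
  exact: sign_equiv_node (refl _) IH.
- rewrite normal_tree_input; apply: sign_equiv_trans (sign_equiv_assoc _ _ _) _.
  apply: sign_equiv_trans (sign_equiv_node (refl _) IH) _.
  by rewrite [(n.+2 + n')%N]addSn; apply: sign_equiv_input_normal; lia.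
Qed.

(** By associativity a tree is a product of its leaves; gamma annihilates every
    other factor, and the copies of zeta are moved to the left. *)
Theorem normal_form t : [\/ t = Gamma, class_zero t |
  exists k, [/\ (0 < k + inputs t)%N, tree_weight w t = k, leaves t = (k + inputs t)%N &
    sign_equiv t (normal_tree k (inputs t))]].
Proof.
elim: t => [|||l IHl r IHr].
- by constructor 3; exists 0%N; split=> //; exact: refl.
- by constructor 1.
- by constructor 3; exists 1%N; split=> //; exact: refl.
case: IHl => [->|zl|[k [k0 wl ll el]]].
- by constructor 2; exact: class_zero_gamma_left.
- by constructor 2; exact: class_zero_nodel.
case: IHr => [->|zr|[k' [k0' wr lr er]]].
- by constructor 2; exact: class_zero_gamma_right.
- by constructor 2; exact: class_zero_noder.
constructor 3; exists (k + k')%N; split=> /=; [lia|lia|lia|].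
apply: sign_equiv_trans (sign_equiv_node el er) _; exact: sign_equiv_node_normal.
Qed.

Local Notation T := (tree_operad K w).
Local Notation mono := (mono K w).

Definition is_normal u := u = Gamma \/ exists k n, (0 < k + n)%N /\ u = normal_tree k n.

Lemma normal_reduction t : exists p : K * tree,
  [/\ p.1 != 0 -> is_normal p.2,
      [/\ leaves p.2 = leaves t, tree_weight w p.2 = tree_weight w t,
      inputs p.2 = inputs t & tree_degree p.2 = tree_degree t] &
      forall n d, tree_class (mono t n d) = p.1 *: tree_class (mono p.2 n d)].
Proof.
case: (normal_form t) => [->|z|[k [k0 wt lt [i d [c e]]]]].
- by exists (1, Gamma); split=> // [_|n d]; [left|rewrite scale1r].
- by exists (0, t); split=> // [|n d]; rewrite ?eqxx ?scale0r ?z.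
have [ni nl nw] := normal_treeE k0.
exists ((-1) ^+ c, normal_tree k (inputs t)); split=> //.
  by move=> _; right; exists k, (inputs t).
by rewrite -d nl nw lt wt.
Qed.

Definition reduction t : K * tree := sval (cid (normal_reduction t)).

Lemma reductionP t :
  [/\ (reduction t).1 != 0 -> is_normal (reduction t).2,
      [/\ leaves (reduction t).2 = leaves t, tree_weight w (reduction t).2 = tree_weight w t,
      inputs (reduction t).2 = inputs t & tree_degree (reduction t).2 = tree_degree t] &
      forall n d, tree_class (mono t n d) = (reduction t).1 *: tree_class (mono (reduction t).2 n d)].
Proof. exact: svalP (cid (normal_reduction t)). Qed.

(** The reduced tree has as many leaves as [t], so that each coefficient is a
   finite sum. *)
Definition normal_series n d (f : T n d) : T n d :=
  ser_of inputs tree_degree n d (fun u =>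
    \sum_(t <- tree_list (leaves u)) scoef f t * (reduction t).1 * ((reduction t).2 == u)%:R).

Lemma scoef_normal_series n d (f : T n d) N u : (leaves u <= N)%N ->
  scoef (normal_series f) u =
    \sum_(t <- tree_list N) scoef f t * (reduction t).1 * ((reduction t).2 == u)%:R.
Proof.
move=> uN; rewrite scoef_ser_of.
  have sub M : (leaves u <= M)%N ->
      \sum_(t <- tree_list M) scoef f t * (reduction t).1 * ((reduction t).2 == u)%:R
      = \sum_(t <- tree_list M | (leaves t <= leaves u)%N)
          scoef f t * (reduction t).1 * ((reduction t).2 == u)%:R.
    move=> uM; rewrite [RHS]big_mkcond; apply: eq_bigr => t _; case: ifP => // nt.
    have [_ [lt _ _ _] _] := reductionP t; case: eqP => [e|_]; last by rewrite mulr0.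
    by rewrite -e lt leqnn in nt.
  rewrite sub // [RHS]sub // -big_filter -[RHS]big_filter; apply: perm_big; apply: uniq_perm.
  - by rewrite filter_uniq ?undup_uniq.
  - by rewrite filter_uniq ?undup_uniq.
  move=> t; rewrite !mem_filter !mem_tree_list; case: leqP => //= tu.
  by rewrite (leq_trans tu).
move=> /eqP nz; apply: contra_notP nz => nz; rewrite big1 // => t _.
have [_ [_ _ it dt] _] := reductionP t.
have [->|/scoef_supp[an dn]] := eqVneq (scoef f t) 0; first by rewrite !mul0r.
case: eqP => [e|_]; last by rewrite mulr0.
by case: nz; rewrite -e it dt.
Qed.

(** Truncations are rewritten monomial by monomial; the reduction preserves the
    weight, and the quotient is separated. *)
Lemma tree_class_normal_series n d (f : T n d) : tree_class f = tree_class (normal_series f).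
Proof.
have cQ := AsPP_complete K w; have mc := tree_class_morphism K w.
apply/eqP; rewrite -subr_eq0; apply/eqP; apply: (fil_separated (cop_filtration cQ)) => k.
pose h := \sum_(t <- tree_list (n + k))
  (scoef f t * (reduction t).1) *: mono (reduction t).2 n d : T n d.
have eh : tree_class (truncation k f) = tree_class h.
  rewrite !(mor_sum mc); apply: eq_bigr => t _; rewrite !(morZ mc).
  by have [_ _ ->] := reductionP t; rewrite scalerA.
have fh : op_fil k (normal_series f - h).
  apply/filP => u uk.
  have [//|/scoef_supp[un _]] := eqVneq (scoef (normal_series f - h : series K _ _ _ _) u) 0.
  have uN : (leaves u <= n + k)%N by have := leaves_le_weight w0 u; rewrite un; lia.
  rewrite scoefB scoef_sum (scoef_normal_series _ uN); apply/eqP; rewrite subr_eq0; apply/eqP.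
  apply: eq_bigr => t _; rewrite scoefZ scoef_mono.
  have [_ [_ _ -> ->] _] := reductionP t.
  have [->|/scoef_supp[-> ->]] := eqVneq (scoef f t) 0; first by rewrite !mul0r.
  by rewrite !eqxx !andbT eq_sym.
rewrite -[tree_class f](subrK (tree_class (truncation k f))) -(morB mc) eh.
rewrite -addrA -(opprB (tree_class (normal_series f))) -(morB mc).
apply: (filB (cop_filtration cQ)).
  by apply: (mor_filtered mc); exact: truncation_fil.
exact: (mor_filtered mc).
Qed.

Lemma normal_series_supp n d (f : T n d) u : scoef (normal_series f) u != 0 -> is_normal u.
Proof.
rewrite (scoef_normal_series _ (leqnn _)) => nz.
apply: contra_neqP nz => nu; rewrite big1 // => t _.
have [h _ _] := reductionP t; case: eqP => [e|_]; last by rewrite mulr0.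
have [->|/h] := eqVneq (reduction t).1 0; first by rewrite mulr0 mul0r.
by rewrite e.
Qed.

End NormalForm.

(** * Detecting the critical bamboos *)

Section PlainWords.
Variable K : fieldType.
Implicit Types (l m : seq item).

Definition plain (i : item) : bool := i.1 && (i.2.1 == i.2.2).

(** Counting the connected words with given numbers of black tadpoles and of plain
    white vertices is a cocycle: such a word only occurs in the differential of a
    word with one white tadpole, together with its commuted word and the opposite
    sign. *)
Lemma derivation_plain (P : nat -> nat -> bool) l :
  derivation l (fun m => (all plain m && P (size m) (whites_in m))%:R : K) = 0.
Proof.
elim: l P => [//|[j [c t]] l IH] P /=.
have -> : derivation l (fun m => (plain (j, (c, t)) && all plain m
    && P (size m).+1 (~~ c + whites_in m)%N)%:R : K) = 0.
  case: (plain (j, (c, t))) => /=; last exact: derivation_const0.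
  exact: (IH (fun s w => P s.+1 (~~ c + w)%N)).
(* Letters created by the derivation are not plain, except by a white tadpole. *)
rewrite mulr0 /plain /whites_in /= !andbF /= add0r.
by case: j; case: c; case: t => //=; rewrite ?(addr0, subrr, mulr0).
Qed.

Definition critical_word k n : seq item :=
  nseq k (true, (true, true)) ++ nseq n (true, (false, false)).

Lemma critical_wordE k n :
  [/\ all plain (critical_word k n), size (critical_word k n) = (k + n)%N
    & whites_in (critical_word k n) = n].
Proof.
rewrite /critical_word all_cat !all_nseq !orbT size_cat !size_nseq; split=> //.
by rewrite /whites_in count_cat !count_nseq mul0n mul1n.
Qed.

Lemma matching_critical_word k n : matching (critical_word k n) = None.
Proof.
rewrite matching_not_isolated; last by case: k => //; case: n.
have step v l : v = (true, true) \/ v = (false, false) -> matching_after l = None ->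
    ~~ ((v == (false, false)) && starts_with_tadpole l) ->
    matching_after ((true, v) :: l) = None.
  by move=> hv e /negbTE h; rewrite matching_after_cons // h e.
rewrite /critical_word; elim: k => [|k IH]; last by apply: step; first by left.
by elim: n => [//|n IH]; apply: step; [right| |case: n {IH}].
Qed.

Lemma delta_two_blacks v : delta K [:: (true, v)] [:: (true, (true, false)); (false, (true, false))] = 0.
Proof. by apply/eqP/negPn/negP => /delta_supp[[]|[]|[_ []]|[b' _]]; rewrite ?delta_nil ?eqxx. Qed.

Lemma whites_in_items z : (whites_in (items z) + bamboo_weight z)%N = nvertices z.
Proof.
rewrite weightE -size_colours -[size _](count_predC id) addnC; congr (_ + _)%N.
rewrite /whites_in /colours -[vertices z]/(map snd (items z)) -map_comp count_map.
exact: eq_count.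
Qed.

(** The cocycles of [derivation_plain] separate the connected critical bamboos,
    and their terms all have the same weight; the two isolated black vertices occur
    in no differential. *)
Lemma critical_not_boundary n d k (S : TwncBV K n d) (y : TwncBV K n (d + 1)) c :
  (forall z, scoef (S : series K bamboo_arity bamboo_degree n d) z != 0 ->
     matching (items z) = None) ->
  op_fil k (S - dg_diff (erefl (d + 1)) y) -> (bamboo_weight c < k)%N ->
  scoef (S : series K bamboo_arity bamboo_degree n d) c = 0.
Proof.
move=> crit /filP low ck.
have diff z N : (nvertices z <= N)%N -> (bamboo_weight z < k)%N ->
   scoef (S : series K bamboo_arity bamboo_degree n d) z
    = \sum_(p <- bamboo_list N) scoef y p * bamboo_diff K p z.
  move=> zN zk; have := low z zk.
  by rewrite scoefB (scoef_diff_Tw _ _ zN) => /eqP; rewrite subr_eq0 => /eqP.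
have [//|nz] := eqVneq (scoef (S : series K bamboo_arity bamboo_degree n d) c) 0.
have [ec|[a [b ec]]] := matching_critical (isT : head_joined (items c)) (crit c nz).
  rewrite (diff c _ (leqnn _) ck) big1 // => p _.
  have [->|h] := eqVneq (bamboo_diff K p c) 0; first by rewrite mulr0.
  have [_ _ _ e] := bamboo_diff_supp h.
  case: p e h => v [|i p] e h; last first.
    by move/(congr1 size): ec; rewrite size_items e.
  by rewrite bamboo_diff_delta ec delta_two_blacks mulr0 eqxx in h.
(* The signed count of the plain words with as many letters t and x as [c]. *)
pose N := nvertices c; pose W := whites_in (items c).
pose chi m : K := (all plain m && ((size m == N) && (whites_in m == W)))%:R.
have chiE z : nvertices z = N -> whites_in (items z) = W -> (bamboo_weight z < k)%N.
  move=> zN zW; move: ck (whites_in_items z) (whites_in_items c).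
  by rewrite zN zW -/N -/W => ck h1 h2; move: ck; lia.
have e1 : \sum_(z <- bamboo_list N) word_sign K z * chi (items z) *
    scoef (S : series K bamboo_arity bamboo_degree n d) z
    = word_sign K c * scoef (S : series K bamboo_arity bamboo_degree n d) c.
  transitivity (\sum_(z <- bamboo_list N) (z == c)%:R *
      (word_sign K z * scoef (S : series K bamboo_arity bamboo_degree n d) z)); last first.
    by rewrite sum_delta ?uniq_bamboo_list ?mem_bamboo_list.
  apply: eq_bigr => z _; rewrite -mulrA mulrCA.
  have [->|nzz] := eqVneq (scoef (S : series K bamboo_arity bamboo_degree n d) z) 0.
    by rewrite !mulr0.
  congr (_ %:R * _); congr nat_of_bool.
  apply/idP/eqP => [/andP[pz /andP[/eqP sz /eqP wz]]|->]; last first.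
    by rewrite size_items !eqxx ec; have [-> _ _] := critical_wordE a b.
  apply: (can_inj itemsK).
  have [ez|[a' [b' ez]]] := matching_critical (isT : head_joined (items z)) (crit z nzz).
    by rewrite ez in pz.
  have [_ s1 w1] := critical_wordE a b; have [_ s2 w2] := critical_wordE a' b'.
  move: sz wz; rewrite /N /W -size_items ec ez s1 s2 w1 w2 => /eqP + eb.
  by rewrite eb eqn_add2r => /eqP ->.
have : word_sign K c * scoef (S : series K bamboo_arity bamboo_degree n d) c = 0.
  rewrite -e1.
  transitivity (\sum_(z <- bamboo_list N) \sum_(p <- bamboo_list N)
     word_sign K p * scoef y p * (delta K (items p) (items z) * chi (items z))).
    rewrite big_seq [RHS]big_seq; apply: eq_bigr => z; rewrite mem_bamboo_list => zN.
    have [pz|npz] := boolP (all plain (items z) && ((size (items z) == N) && (whites_in (items z) == W))); last first.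
      rewrite /chi (negbTE npz) mulr0 mul0r big1 // => p _.
      by rewrite !mulr0.
    have [/eqP sz /eqP wz] := andP (andP pz).2.
    rewrite (diff z N zN (chiE _ sz wz)) mulr_sumr; apply: eq_bigr => p _.
    rewrite bamboo_diff_delta.
    transitivity ((word_sign K z * word_sign K z) * (word_sign K p * scoef y p
      * (delta K (items p) (items z) * chi (items z)))); first by ring.
    by rewrite word_sign_sqr mul1r.
  rewrite exchange_big big1 //= => p _.
  rewrite -mulr_sumr.
  have [pN|Np] := ltnP (nvertices p) N; last first.
    rewrite big_seq big1 ?mulr0 // => z zL.
    have zN : (nvertices z <= N)%N by rewrite -mem_bamboo_list.
    have [->|] := eqVneq (delta K (items p) (items z)) 0; first by rewrite mul0r.
    rewrite -bamboo_diff_neq0 => /bamboo_diff_supp[_ _ _ e].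
    by move: zN; rewrite e ltnNge Np.
  by rewrite -(derivation_expand (fun m => chi m) pN) 
    (derivation_plain (fun s u => (s == N) && (u == W))) mulr0.
by move=> /eqP; rewrite mulf_eq0 (negbTE nz) orbF /word_sign signr_eq0.
Qed.

End PlainWords.

(** * The isomorphism *)

Lemma tree_items_normal k n : (0 < k + n)%N ->
  tree_items (normal_tree k n) = critical_word k n.
Proof.
move: k n; apply: normal_tree_ind => // [k n kn IH|n IH].
  by rewrite normal_tree_zeta //= IH.
by rewrite normal_tree_input /= -/(normal_tree _ _) IH.
Qed.

Lemma degree_normal_tree k n : (0 < k + n)%N -> tree_degree (normal_tree k n) = n%:Z - 1.
Proof.
move: k n; apply: normal_tree_ind => // [k n kn IH|n IH].
  by rewrite normal_tree_zeta //= IH; ring.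
by rewrite normal_tree_input /= -/(normal_tree _ _) IH -[in RHS]addn1 PoszD; ring.
Qed.

Lemma arity_tree_bamboo t : bamboo_arity (tree_bamboo t) = inputs t.
Proof. by rewrite arityE colours_tree_bamboo count_negb_tree_colours. Qed.

Lemma degree_tree_bamboo t : bamboo_degree (tree_bamboo t) = tree_degree t.
Proof.
by rewrite degreeE colours_tree_bamboo -(perm_size (perm_tree_word t)) -tree_degreeE.
Qed.

Lemma weight_tree_bamboo t : bamboo_weight (tree_bamboo t) = tree_weight 2 t.
Proof. by rewrite weightE colours_tree_bamboo count_id_tree_colours. Qed.

Lemma matching_normal u : is_normal u -> matching (items (tree_bamboo u)) = None.
Proof.
rewrite items_tree_bamboo => -[->//|[k [n [kn ->]]]].
by rewrite tree_items_normal // matching_critical_word.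
Qed.

Lemma critical_normal z : matching (items z) = None ->
  exists2 u, is_normal u & z = tree_bamboo u.
Proof.
move=> h; have [e|[k [n e]]] := matching_critical (isT : head_joined (items z)) h.
  by exists Gamma; [left|apply: (can_inj itemsK); rewrite items_tree_bamboo].
have kn : (0 < k + n)%N.
  by have [_ <- _] := critical_wordE k n; rewrite /critical_word -e.
exists (normal_tree k n); first by right; exists k, n.
by apply: (can_inj itemsK); rewrite items_tree_bamboo tree_items_normal.
Qed.

Lemma normal_tree_bamboo_inj u t : is_normal u -> is_normal t ->
  tree_bamboo u = tree_bamboo t -> u = t.
Proof.
move=> nu nt /(congr1 items); rewrite !items_tree_bamboo.
have plain_normal k n : (0 < k + n)%N -> tree_items (normal_tree k n) = tree_items Gamma -> False.
  move=> kn; rewrite tree_items_normal // => e.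
  by have [h _ _] := critical_wordE k n; rewrite e in h.
case: nu nt => [->|[k [n [kn ->]]]] [->|[k' [n' [kn' ->]]]] //.
- by move=> /esym/plain_normal; case.
- by move=> /plain_normal; case.
rewrite !tree_items_normal // => e.
have [_ s1 w1] := critical_wordE k n; have [_ s2 w2] := critical_wordE k' n'.
have en : n = n' by rewrite -w1 -w2 e.
have /eqP : (k + n = k' + n')%N by rewrite -s1 -s2 e.
by rewrite en eqn_add2r => /eqP ->.
Qed.

Section Isomorphism.
Variables (K : fieldType) (w : nat).
Hypotheses (w0 : (0 < w)%N) (w2 : (w <= 2)%N).
Implicit Types (t u : tree) (z : bamboo).

Local Notation T := (tree_operad K w).
Local Notation Tw := (TwncBV K).
Local Notation Q := (AsPP K w).
Local Notation H := (homology Tw).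
Local Notation mono := (mono K w).
Local Notation coef x z := (scoef (x : series K bamboo_arity bamboo_degree _ _) z).

Let cT := TwncBV_complete K.
Let cH := homology_Tw_complete K.

Lemma scoef_tree_map_normal n d (g : T n d) u :
  (forall t, scoef g t != 0 -> is_normal t) -> is_normal u ->
  coef (tree_map g) (tree_bamboo u) = (-1) ^+ inversions (tree_word u) * scoef g u.
Proof.
move=> gn nu; rewrite (scoef_tree_map w2 _ (leqnn _)).
rewrite (eq_bigr (fun t => (t == u)%:R * ((-1) ^+ inversions (tree_word t) * scoef g t))).
  rewrite sum_delta ?undup_uniq // mem_tree_list nvertices_tree_bamboo.
  exact: leaves_le_colours.
move=> t _; rewrite phiE.
have [->|/gn nt] := eqVneq (scoef g t) 0; first by rewrite mulr0 mul0r mulr0.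
rewrite [LHS]mulrC mulrAC mulrC eq_sym; congr (_ * _); congr (_ %:R); congr nat_of_bool.
by apply/eqP/eqP => [/normal_tree_bamboo_inj->|->].
Qed.

Lemma tree_map_supp_normal n d (g : T n d) z :
  (forall t, scoef g t != 0 -> is_normal t) ->
  coef (tree_map g) z != 0 -> matching (items z) = None.
Proof.
move=> gn; rewrite (scoef_tree_map w2 _ (leqnn _)) => nz.
apply: contra_neqP nz => nz; rewrite big1 // => t _.
have [->|/gn nt] := eqVneq (scoef g t) 0; first by rewrite mul0r.
rewrite phiE; case: eqP => [e|_]; last by rewrite !mulr0.
by case: nz; rewrite e; exact: matching_normal.
Qed.

(** The critical bamboos are the bamboos of the normal trees. *)
Lemma homology_normal n d (h : H n d) : exists g : T n d, hclass (tree_map g) = h.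
Proof.
move: h; apply: homology_ind => x cx; have [y hy] := cycle_reduction cx.
pose S : Tw n d := x - dg_diff (erefl (d + 1)) y.
pose g : T n d := ser_of inputs tree_degree n d (fun u =>
  if `[< is_normal u >] then (-1) ^+ inversions (tree_word u) * coef S (tree_bamboo u) else 0).
have gE u : scoef g u =
    if `[< is_normal u >] then (-1) ^+ inversions (tree_word u) * coef S (tree_bamboo u) else 0.
  rewrite scoef_ser_of //; case: asboolP => _; last by rewrite eqxx.
  rewrite mulf_eq0 signr_eq0 /= => /scoef_supp.
  by rewrite arity_tree_bamboo degree_tree_bamboo.
have gn t : scoef g t != 0 -> is_normal t.
  by rewrite gE; case: asboolP => //; rewrite eqxx.
have eS : tree_map g = S.
  apply: series_ext => z; have [e|] := eqVneq (matching (items z)) None.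
    have [u nu ->] := critical_normal e.
    by rewrite scoef_tree_map_normal // gE asboolT // mulrA -expr2 sqrr_sign mul1r.
  move=> nz; transitivity (0 : K).
    by apply/eqP/contraT => /(tree_map_supp_normal gn) e; rewrite e eqxx in nz.
  by apply/esym/eqP/contraT => /hy e; rewrite e eqxx in nz.
exists g; apply/(hclassP (tree_map_cycle w2 g) cx).
by rewrite eS /S addrAC subrr add0r; exists (- y); rewrite linearN.
Qed.

(** The coefficients at the normal trees are, up to sign, those at the critical
    bamboos, for which gamma counts as two black vertices. *)
Lemma tree_map_reflects n d l (g : T n d) (x : Tw n d) :
  (forall t, scoef g t != 0 -> is_normal t) ->
  is_cycle x -> op_fil l x -> hclass (tree_map g) = hclass x ->
  forall u, (tree_weight 2 u < l)%N -> scoef g u = 0.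
Proof.
move=> gn cx xl /(hclassP (tree_map_cycle w2 g) cx)[y ey] u ul.
have [//|/gn nu] := eqVneq (scoef g u) 0.
have /eqP : coef (tree_map g) (tree_bamboo u) = 0.
  apply: (critical_not_boundary (k := l) (y := y)).
  - by move=> z; exact: tree_map_supp_normal.
  - by rewrite ey opprB addrC subrK.
  - by rewrite weight_tree_bamboo.
by rewrite scoef_tree_map_normal // mulf_eq0 signr_eq0 => /eqP.
Qed.

Lemma critical_free_boundary n d (x : Tw n d) : is_cycle x ->
  (forall u, is_normal u -> inputs u = n -> tree_degree u = d -> False) -> hclass x = 0.
Proof.
move=> cx nc; apply/(hclass_eq0 cx); have [y hy] := cycle_reduction cx.
exists y; apply/eqP; rewrite eq_sym -subr_eq0; apply/eqP/series_ext => z; rewrite scoef0.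
apply/eqP/contraT => nz; have [u nu ez] := critical_normal (hy z nz).
have [] := scoef_supp nz; rewrite ez arity_tree_bamboo degree_tree_bamboo => ua ud.
by case: (nc u nu ua ud).
Qed.

(** The products b(gamma, -) and b(-, gamma) are sent to boundaries since they have
    arity 1 and degree -3, whereas a connected critical bamboo of arity [n] has
    degree [n - 1]. *)
Lemma no_normal_gamma u : is_normal u -> inputs u = 1%N -> tree_degree u = -3 -> False.
Proof.
move=> [->//|[k [n [kn ->]]]]; rewrite degree_normal_tree //.
by have [-> _ _] := normal_treeE kn; move=> ->.
Qed.

Definition white_tadpole : bamboo := ((false, true), [::]).

(** Up to sign, the relation on zeta is sent to the differential of a white vertex
    with a tadpole. *)
Lemma zeta_boundary :
  is_boundary (tree_map (mono (Node Zeta Input) 1%N 0) + tree_map (mono (Node Input Zeta) 1%N 0)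
     : Tw 1%N 0).
Proof.
exists (- (monomial K bamboo bamboo_arity bamboo_degree white_tadpole 1%N 1 : Tw 1%N 1)).
rewrite linearN -scaleN1r; apply: series_ext => z.
rewrite scoefZ (scoef_diff_Tw _ _ (leqnn _)).
rewrite (eq_bigr (fun p => (p == white_tadpole)%:R * bamboo_diff K p z)); last first.
  by move=> p _; rewrite scoef_monomial !andbT.
rewrite sum_delta ?uniq_bamboo_list ?mem_bamboo_list //.
rewrite bamboo_diff_delta deltaE /= delta_nil.
rewrite -[[:: (true, (true, true)); _]]/(items (tree_bamboo (Node Zeta Input))).
rewrite -[[:: (true, (false, false)); _]]/(items (tree_bamboo (Node Input Zeta))).
rewrite !(inj_eq (can_inj itemsK)) ![_ == z]eq_sym.
rewrite scoefD !(scoef_tree_map_mono K w2) !phiE.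
set A := tree_bamboo _; set B := tree_bamboo _.
rewrite /= !(mul1r, mulr0, addr0, add0r, mulN1r, expr0).
have [->|n1] := eqVneq z A.
  have -> : word_sign K A = -1 by rewrite /word_sign /= expr1.
  by rewrite (_ : A == B = false) //= subr0 mulN1r opprK addr0.
have [->|n2] := eqVneq z B.
  have -> : word_sign K B = 1 by rewrite /word_sign /= expr0.
  by rewrite /= sub0r mulrN1 opprK add0r.
by rewrite /= subrr mulr0 oppr0 addr0.
Qed.

Definition homology_map n d (x : AsGZ K w n d) : H n d := hclass (canonical_map x).

Lemma homology_map_morphism : @is_morphism K (AsGZ K w) H homology_map.
Proof.
exact: (hclass_morphism cT (canonical_map_morphism K w2) (canonical_map_cycle w2)).
Qed.

Lemma homology_map_relation n d (x : AsGZ K w n d) : AsPP_relation x -> homology_map x = 0.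
Proof.
have cGZ := tree_operad_complete K w.
case=> {n d x}; last first.
  rewrite !(op_proj_comp _ cGZ) // /homology_map.
  rewrite (morD (canonical_map_morphism K w2)) !canonical_mapE //.
  rewrite -[tree_b K w]/(mono (Node Input Input) 2%N 1) -[tree_zeta K w]/(mono Zeta 0%N (- 1)).
  rewrite !mono_comp //= !expr0 !scale1r.
  have b := zeta_boundary; exact: (iffRL (hclass_eq0 (boundary_cycle cT b)) b).
all: apply: (critical_free_boundary (canonical_map_cycle w2 _)); exact: no_normal_gamma.
Qed.

Definition induced_map : forall n d, Q n d -> H n d :=
  @quotient_lift K (AsGZ K w) H homology_map (@AsPP_relation K w).

Lemma induced_mapE n d (x : AsGZ K w n d) :
  induced_map (AsPP_proj x) = hclass (canonical_map x).
Proof. exact: (quotient_liftE cH homology_map_morphism homology_map_relation). Qed.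

Lemma induced_map_morphism : @is_morphism K Q H induced_map.
Proof.
exact: (quotient_lift_morphism (AsGZ_complete K w) cH homology_map_morphism
  homology_map_relation).
Qed.

Lemma induced_map_class n d (g : T n d) : induced_map (tree_class g) = hclass (tree_map g).
Proof. by rewrite /tree_class induced_mapE canonical_mapE. Qed.

Lemma tree_class_ind n d (R : Q n d -> Prop) :
  (forall g : T n d, (forall t, scoef g t != 0 -> is_normal t) -> R (tree_class g)) ->
  forall x, R x.
Proof.
move=> h; apply: quotient_ind => x; move: x; apply: quotient_ind => f.
rewrite -[op_proj _ _]/(tree_class f) tree_class_normal_series //; apply: h => t.
exact: normal_series_supp.
Qed.

(** A class of the quotient is represented by a combination of normal trees, whose
    image has no term of weight less than [l]. *)
Lemma induced_map_reflects n d k l (x : Q n d) :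
  (forall u, is_normal u -> (tree_weight w u < k)%N -> (tree_weight 2 u < l)%N) ->
  op_fil l (induced_map x) -> op_fil k x.
Proof.
move=> hkl; move: x; apply: tree_class_ind => g gn.
rewrite induced_map_class => -[x [cx xl] /esym ex].
apply: (mor_filtered (tree_class_morphism K w)); apply/filP => u uk.
have [//|/gn nu] := eqVneq (scoef g u) 0.
exact: (tree_map_reflects gn cx xl ex (hkl u nu uk)).
Qed.

Lemma normal_weight u : is_normal u ->
  (tree_weight w u < tree_weight 2 u)%N -> tree_weight 2 u = 2%N.
Proof.
by move=> [->//|[k [n [kn ->]]]]; have [_ _ h] := normal_treeE kn; rewrite !h ltnn.
Qed.

(** Weights only change on gamma, of weight two in the homology. *)
Lemma induced_map_continuous_inv n d k (x : Q n d) :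
  op_fil k.+2 (induced_map x) -> op_fil k x.
Proof.
apply: induced_map_reflects => u nu uk.
by have [/(normal_weight nu)->|] := ltnP (tree_weight w u) (tree_weight 2 u); lia.
Qed.

(** Injectivity follows from the continuity of the inverse by separation. *)
Lemma induced_map_bijective n d : bijective (@induced_map n d).
Proof.
have mi := induced_map_morphism.
have surj (h : H n d) : exists x, induced_map x = h.
  by have [g eg] := homology_normal h; exists (tree_class g); rewrite induced_map_class.
exists (fun h => sval (cid (surj h))) => [x|h]; last exact: (svalP (cid (surj h))).
apply/eqP; rewrite -subr_eq0; apply/eqP.
apply: (fil_separated (cop_filtration (AsPP_complete K w))) => k.
apply: induced_map_continuous_inv; rewrite (morB mi) (svalP (cid (surj _))) subrr.
exact: (fil0 (cop_filtration cH)).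
Qed.

Theorem induced_map_isomorphism : is_isomorphism induced_map.
Proof.
split; [exact: induced_map_morphism|exact: induced_map_bijective|].
by move=> n d k; exists k.+2 => x; exact: induced_map_continuous_inv.
Qed.

Theorem induced_map_filtration : w = 2%N -> reflects_filtration induced_map.
Proof. by move=> e n d k x; apply: induced_map_reflects => u _; rewrite e. Qed.

End Isomorphism.

Local Close Scope classical_set_scope.
Local Close Scope ring_scope.

Theorem theorem6p4 (K : fieldType) (w : nat) (hw : 0 < w <= 2) :
  [/\ is_complete_dgoperad (zero_dgoperad (AsGZ K w)),
      is_complete_dgoperad (TwncBV K),
      is_complete_operad (AsPP K w)
    & is_complete_operad (homology (TwncBV K))] /\
  exists Phi : forall (n : nat) (d : int), AsGZ K w n d -> TwncBV K n d,
  [/\ is_canonical_map Phi,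
      forall Psi : forall (n : nat) (d : int), AsGZ K w n d -> TwncBV K n d,
        is_canonical_map Psi ->
        forall n d (x : AsGZ K w n d), Psi n d x = Phi n d x
    & exists Phibar : forall (n : nat) (d : int),
        AsPP K w n d -> homology (TwncBV K) n d,
      [/\ forall n d (x : AsGZ K w n d),
            Phibar n d (AsPP_proj x) = hclass (Phi n d x),
          is_isomorphism Phibar
        & w = 2 -> reflects_filtration Phibar]].
Proof.
have [w0 w2] := andP hw; split.
  split; [exact/zero_dgoperad_complete/AsGZ_complete | exact: TwncBV_complete
    | exact: AsPP_complete | exact: homology_Tw_complete].
exists (@canonical_map K w); split; [exact: canonical_map_canonical
  | by move=> Psi hPsi n d x; apply: canonical_map_unique|].
exists (@induced_map K w); split; [exact: induced_mapE | exact: induced_map_isomorphism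
  | exact: induced_map_filtration].
Qed.
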